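(* Let $D\subset\mathbb{C}^d$ be a domain, let $\varphi$ be a positive real analytic function on $D$, let $d_0\ge 1$ be an integer, and let $$\Omega=\{(\xi,z)\in\mathbb{C}^{d_0}\times D:\ \|\xi\|^2<\varphi(z)\}.$$ Assume that $\omega_\Omega=-\frac{\sqrt{-1}}{2}\partial\bar\partial\log(\varphi(z)-\|\xi\|^2)$ is the Kähler form of a Kähler metric $g_\Omega$ on $\Omega$. If the polarization of $\varphi$ is a Nash function on $D\times\mathrm{conj}(D)$, where $\mathrm{conj}(D)=\{z:\bar z\in D\}$, then, for every integer $n\ge1$, $(\Omega,g_\Omega)$ and $\mathbb{C}^n$ with its flat metric are not relatives.
   Context: Nash function: a holomorphic function $f$ on an open set $D'\subset\mathbb{C}^k$ is a Nash function if for every $x_0\in D'$ there are an open neighbourhood $V$ of $x_0$ and a nonzero polynomial $P:\mathbb{C}^k\times\mathbb{C}\to\mathbb{C}$ with $P(x,f(x))=0$ for all $x\in V$. Polarization: the polarization of a real analytic function $\varphi$ is the holomorphic function $\varphi(z,w)$ with $\varphi(z,\bar z)=\varphi(z)$. The flat metric on $\mathbb{C}^n$ has Kähler form $\frac{\sqrt{-1}}{2}\partial\bar\partial\sum_i|z_i|^2$. Relatives: two Kähler manifolds are relatives if they have a common Kähler submanifold (of positive dimension) with their induced metrics, i.e. there are a complex manifold $S$ of positive dimension and holomorphic immersions of $S$ into both manifolds which induce the same Kähler metric on $S$. *)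

(* Defs.v *)
From HB Require Import structures.
From mathcomp Require Import all_boot all_order all_algebra.
From mathcomp Require Import complex.
From mathcomp Require Import all_classical all_reals all_analysis.
From mathcomp Require Import -(notations) mpoly.

Set Implicit Arguments.
Unset Strict Implicit.
Unset Printing Implicit Defensive.

Import Order.TTheory GRing.Theory Num.Theory.
Import numFieldNormedType.Exports.

Local Open Scope classical_set_scope.
Local Open Scope ring_scope.
Local Open Scope complex_scope.

(* The norm topology and normed module structure of R[i] over itself, as the
   library does for an abstract numClosedFieldType. *)
HB.instance Definition _ (R : realType) :=
  PseudoPointedMetric.copy R[i] R[i]^o.
HB.instance Definition _ (R : realType) := GRing.ComAlgebra.copy R[i] R[i]^o.
HB.instance Definition _ (R : realType) := Vector.copy R[i] R[i]^o.
HB.instance Definition _ (R : realType) := NormedModule.copy R[i] R[i]^o.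

(* Points and tangent vectors of C^N are row vectors over R[i]. *)

Definition conjv (R : realType) (N : nat) (z : 'rV[R[i]]_N) : 'rV[R[i]]_N :=
  map_mx Num.conj z.

Definition sqnorm (R : realType) (N : nat) (z : 'rV[R[i]]_N) : R :=
  \sum_(j < N) (complex.Re (z 0 j) ^+ 2 + complex.Im (z 0 j) ^+ 2).

Definition domain (R : realType) (N : nat) (D : set 'rV[R[i]]_N) : Prop :=
  [/\ open D, connected D & D !=set0].

(* The scalar field of 'rV[R[i]]_N is R[i], so [differentiable] is complex
   differentiability. *)
Definition holomorphic_on (R : realType) (N : nat) (W : normedModType R[i])
    (U : set 'rV[R[i]]_N) (f : 'rV[R[i]]_N -> W) : Prop :=
  forall z, U z -> differentiable f z.

Definition nash_on (R : realType) (k : nat) (U : set 'rV[R[i]]_k)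
    (f : 'rV[R[i]]_k -> R[i]) : Prop :=
  holomorphic_on U f /\
  forall x0, U x0 -> exists P : mpoly (k + 1) R[i],
    P != 0 /\
    \forall x \near x0,
      meval (fun i => row_mx x (const_mx (f x) : 'rV_1) 0 i) P = 0.

Definition real_coord (R : realType) (N : nat) (z : 'rV[R[i]]_N) :
    'rV[R]_(N + N) :=
  row_mx (map_mx (@complex.Re R) z) (map_mx (@complex.Im R) z).

Definition monomial (R : realType) (m : nat) (x : 'rV[R]_m)
    (alpha : 'I_m -> nat) : R :=
  \prod_(i < m) x 0 i ^+ alpha i.

(* Near each point of D, f is the sum of an absolutely convergent power series
   in the 2N real coordinates; the n-th partial sum is taken over the
   multi-indices with all entries < n. *)
Definition real_analytic_on (R : realType) (N : nat) (D : set 'rV[R[i]]_N)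
    (f : 'rV[R[i]]_N -> R) : Prop :=
  forall a, D a -> exists (c : ('I_(N + N) -> nat) -> R) (r M : R),
    [/\ 0 < r,
        forall n, \sum_(alpha : {ffun 'I_(N + N) -> 'I_n})
          `|c (fun i => alpha i)| * r ^+ (\sum_(i < N + N) alpha i)%N <= M
      & forall z, `|real_coord (z - a)| < r ->
          (fun n : nat => \sum_(alpha : {ffun 'I_(N + N) -> 'I_n})
             c (fun i => alpha i) *
             monomial (real_coord (z - a)) (fun i => alpha i)) @ \oo --> f z].

Definition conj_prod (R : realType) (d : nat) (D : set 'rV[R[i]]_d) :
    set 'rV[R[i]]_(d + d) :=
  [set p | D (lsubmx p) /\ D (conjv (rsubmx p))].

Definition polarization_on (R : realType) (d : nat) (D : set 'rV[R[i]]_d)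
    (phi : 'rV[R[i]]_d -> R) (Phi : 'rV[R[i]]_(d + d) -> R[i]) : Prop :=
  holomorphic_on (conj_prod D) Phi /\
  forall z, D z -> Phi (row_mx z (conjv z)) = (phi z)%:C.

Section RealDerivatives.
Context (R : realType) (N : nat).
Implicit Types (f : 'rV[R[i]]_N -> R[i]) (p v : 'rV[R[i]]_N).

Definition rderivable f p v : Prop :=
  derivable (fun t : R => complex.Re (f (p + t%:C *: v)) : R) 0 1 /\
  derivable (fun t : R => complex.Im (f (p + t%:C *: v)) : R) 0 1.

Definition rderive f v p : R[i] :=
  derive1 (fun t : R => complex.Re (f (p + t%:C *: v))) 0 +i*
  derive1 (fun t : R => complex.Im (f (p + t%:C *: v))) 0.

(* d/dz_j = (d/dx_j - i d/dy_j)/2 and d/dzbar_j = (d/dx_j + i d/dy_j)/2. *)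
Definition dz (j : 'I_N) f p : R[i] :=
  (rderive f (delta_mx 0 j) p - 'i * rderive f ('i *: delta_mx 0 j) p) / 2%:R.

Definition dzbar (j : 'I_N) f p : R[i] :=
  (rderive f (delta_mx 0 j) p + 'i * rderive f ('i *: delta_mx 0 j) p) / 2%:R.

Fixpoint class_on (k : nat) (U : set 'rV[R[i]]_N) f : Prop :=
  (forall p, U p -> {for p, continuous f}) /\
  if k is k'.+1 then
    forall v, (forall p, U p -> rderivable f p v) /\ class_on k' U (rderive f v)
  else True.

Definition smooth_on (U : set 'rV[R[i]]_N) f : Prop :=
  forall k, class_on k U f.

(* The (1,1)-form sum_jk a_jk dz_j /\ dzbar_k evaluated on two vectors. *)
Definition form11 (a : 'M[R[i]]_N) (v w : 'rV[R[i]]_N) : R[i] :=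
  \sum_(j < N) \sum_(k < N)
    a j k * (v 0 j * (w 0 k)^* - w 0 j * (v 0 k)^*).

Definition ddbar f p : 'rV[R[i]]_N -> 'rV[R[i]]_N -> R[i] :=
  form11 (\matrix_(j, k) dz j (dzbar k f) p).

(* A Hermitian metric is given by its matrices h_jk = h(d/dz_j, d/dz_k). *)
Definition kahler_form (h : 'rV[R[i]]_N -> 'M[R[i]]_N) p v w : R[i] :=
  'i / 2%:R * form11 (h p) v w.

(* For Hermitian h, the last clause says that the Kahler form is closed. *)
Definition kahler_metric (U : set 'rV[R[i]]_N)
    (h : 'rV[R[i]]_N -> 'M[R[i]]_N) : Prop :=
  [/\ forall j k, smooth_on U (fun p => h p j k),
      forall p, U p -> (map_mx Num.conj (h p))^T = h p,
      forall p v, U p -> v != 0 -> 0 < (v *m h p *m (conjv v)^T) 0 0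
    & forall p j k l, U p ->
        dz l (fun q => h q j k) p = dz j (fun q => h q l k) p].

(* Its Kahler form is (i/2) sum_j dz_j /\ dzbar_j = (i/2) ddbar (sum_j |z_j|^2). *)
Definition flat_metric (_ : 'rV[R[i]]_N) : 'M[R[i]]_N := 1%:M.

End RealDerivatives.

Record complex_manifold (R : realType) (m : nat) := ComplexManifold {
  mfd_space :> topologicalType;
  mfd_index : Type;
  chart_dom : mfd_index -> set mfd_space;
  chart : mfd_index -> mfd_space -> 'rV[R[i]]_m;
  (* meaningful only on the image of the chart *)
  chart_inv : mfd_index -> 'rV[R[i]]_m -> mfd_space;
  chart_cover : forall x, exists i, chart_dom i x;
  chart_dom_open : forall i, open (chart_dom i);
  chart_img_open : forall i, open (chart i @` chart_dom i);
  chartK : forall i x, chart_dom i x -> chart_inv i (chart i x) = x;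
  chart_continuous : forall i x,
    chart_dom i x -> {for x, continuous (chart i)};
  chart_inv_continuous : forall i z,
    (chart i @` chart_dom i) z -> {for z, continuous (chart_inv i)};
  chart_transition : forall i j,
    holomorphic_on (chart i @` (chart_dom i `&` chart_dom j))
                   (chart j \o chart_inv i);
  mfd_hausdorff : hausdorff_space mfd_space;
  mfd_second_countable : @second_countable mfd_space
}.

Section Relatives.
Context (R : realType).

Section Maps.
Context (m : nat) (S : complex_manifold R m) (N : nat).
Implicit Type f : S -> 'rV[R[i]]_N.

Definition holomorphic_immersion f : Prop :=
  forall (i : mfd_index S) z, (chart i @` chart_dom i) z ->
    differentiable (f \o chart_inv i) z /\
    row_free ('J (f \o chart_inv i) z).

(* Matrix of the pulled back Hermitian metric in the i-th chart: the
   differential at z sends v to v *m 'J, and h(v, w) = v *m h *m (conj w)^T. *)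
Definition pullback (h : 'rV[R[i]]_N -> 'M[R[i]]_N) f (i : mfd_index S)
    (z : 'rV[R[i]]_m) : 'M[R[i]]_m :=
  let J := 'J (f \o chart_inv i) z in
  J *m h (f (chart_inv i z)) *m (map_mx Num.conj J)^T.

End Maps.

(* (U1, h1) and (U2, h2) are open subsets of C^N1 and C^N2 with Kahler
   metrics. *)
Definition relatives (N1 N2 : nat)
    (U1 : set 'rV[R[i]]_N1) (h1 : 'rV[R[i]]_N1 -> 'M[R[i]]_N1)
    (U2 : set 'rV[R[i]]_N2) (h2 : 'rV[R[i]]_N2 -> 'M[R[i]]_N2) : Prop :=
  exists (m : nat) (S : complex_manifold R m)
         (f1 : S -> 'rV[R[i]]_N1) (f2 : S -> 'rV[R[i]]_N2),
    [/\ (0 < m)%N /\ [set: S] !=set0,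
        (forall x, U1 (f1 x)) /\ (forall x, U2 (f2 x)),
        holomorphic_immersion f1,
        holomorphic_immersion f2
      & forall (i : mfd_index S) z, (chart i @` chart_dom i) z ->
          pullback h1 f1 i z = pullback h2 f2 i z].

End Relatives.

Section CartanHartogs.
Context (R : realType) (d0 d : nat).
Context (D : set 'rV[R[i]]_d) (phi : 'rV[R[i]]_d -> R).

(* A point (xi, z) of C^d0 x C^d is row_mx xi z. *)
Definition hartogs_domain : set 'rV[R[i]]_(d0 + d) :=
  [set p | D (rsubmx p) /\ sqnorm (lsubmx p) < phi (rsubmx p)].

Definition omega_hartogs (p v w : 'rV[R[i]]_(d0 + d)) : R[i] :=
  - ('i / 2%:R) *
  ddbar (fun q => (ln (phi (rsubmx q) - sqnorm (lsubmx q)))%:C) p v w.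

End CartanHartogs.

(* Main.v *)
(** Let [F] and [G] be the curves in [Omega] and in flat [C^n] obtained by
    restricting the two immersions to a complex line in a chart, and let
    [a (t, s)] be the polarization of [phi - |xi|^2] along [F]. Since the induced
    metrics agree, the mixed derivative of [log a (t, s)] is minus the pairing of
    [G' t] with the conjugate of [G' (conj s)] on the diagonal [s = conj t], hence
    everywhere near 0. So [E t s = a (t, s) a (0, 0) / (a (t, 0) a (0, s))]
    satisfies [dE/ds = - (G t - G 0) . conj (G' (conj s)) E]: it is the exponential of a flat
    Calabi diastasis.

    As the polarization of [phi] is Nash, [E] satisfies a polynomial equation
    whose coefficients are finite sums [f_l(t) g_l(s)]. (If the Nash polynomial
    vanishes identically in its last variable along the curve, perturb the curve
    in a fixed direction and keep the term of lowest order.)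

    This is impossible by counting. Fix [m] points [t_i]. Reducing powers with
    the equation, all products of the [E t_i] with exponents at most [N] become,
    up to a common factor, combinations of products of powers [E t_i ^ b] with
    [b] below the degree and of monomials in the [g_l], whose number grows with a
    smaller power of [N]; so the products are linearly dependent. But they are
    exponentials whose frequencies are distinct for generic [t_i], and
    differentiating a dependency repeatedly gives a Vandermonde system. *)
Require Import Defs.
From HB Require Import structures.
From mathcomp Require Import all_boot all_order all_algebra.
From mathcomp Require Import complex.
From mathcomp Require Import all_classical all_reals all_analysis.
From mathcomp Require Import -(notations) mpoly.
From mathcomp Require Import ring lra.

Set Implicit Arguments.
Unset Strict Implicit.
Unset Printing Implicit Defensive.

Import Order.TTheory GRing.Theory Num.Theory.
Import numFieldNormedType.Exports.

Local Open Scope classical_set_scope.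
Local Open Scope ring_scope.

(** * Integrals along segments and rectangles *)

(** The coefficients of the relation for [E] are finite sums of products f(t) g(s) of arbitrary
    holomorphic functions. No degree or growth is attached to f and g, and the only finite datum is
    their number k; this is why the contradiction is a dimension count. The count is made at [rho]
    values of s simultaneously: differentiating a dependency is useful only if the vectors conj
    (G'(conj s)) at these points span the direction that defines the frequencies. As [rho] is at
    most n, it is fixed before the number m of points t. [E] is normalized by the values of a on the
    axes because each such factor depends on t alone or on s alone. This removes the ambiguity of
    the potential and keeps the coefficients separated after substitution into the Nash polynomial.
    Holomorphy is given as first-order differentiability, while the argument needs a mixed second
    derivative and propagation from s = conj t to an open set. Both come from Cauchy estimates on
    complex lines, proved on squares; the contour integral of 1/w need not be evaluated, only shown
    to be nonzero. *)

Section RealIntegral.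
Context (R : realType).
Notation mu := (@lebesgue_measure R).
Implicit Types (f g F : R -> R) (a b c x M : R).

Definition rint a b f : R := \int[mu]_(x in `[a, b]) f x.

Lemma continuous_integrable a b f :
  {in `[a, b], continuous f} -> mu.-integrable `[a, b] (EFin \o f).
Proof.
move=> cf; apply: continuous_compact_integrable; first exact: segment_compact.
by apply: continuous_in_subspaceT => x /set_mem; exact: cf.
Qed.

Lemma rintD a b f g : {in `[a, b], continuous f} -> {in `[a, b], continuous g} ->
  rint a b (fun x => f x + g x) = rint a b f + rint a b g.
Proof. by move=> cf cg; apply: RintegralD => //; exact: continuous_integrable. Qed.

Lemma rintZ a b f k : {in `[a, b], continuous f} ->
  rint a b (fun x => k * f x) = k * rint a b f.
Proof. by move=> cf; apply: RintegralZl => //; exact: continuous_integrable. Qed.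

Lemma rint_cst a b k : a <= b -> rint a b (cst k) = k * (b - a).
Proof.
move=> ab; rewrite /rint Rintegral_cst//= lebesgue_measure_itv /= lte_fin.
by case: ltgtP ab => // -> _; rewrite subrr.
Qed.

Lemma le_rint a b f g : {in `[a, b], continuous f} -> {in `[a, b], continuous g} ->
  (forall x, a <= x <= b -> f x <= g x) -> rint a b f <= rint a b g.
Proof.
move=> cf cg fg; apply: le_Rintegral => //; try exact: continuous_integrable.
Qed.

Lemma rint_split a b c f : a <= c -> c <= b -> {in `[a, b], continuous f} ->
  rint a b f = rint a c f + rint c b f.
Proof.
move=> ac cb cf.
have := @Rintegral_itvB _ f (BLeft a) (BRight b) c (continuous_integrable cf).
rewrite !bnd_simp => /(_ ac cb) E.
rewrite /rint -(@Rintegral_itv_obnd_cbnd _ c); first by rewrite -E addrC subrK.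
apply: integrableS (continuous_integrable cf) => //.
by apply: subset_itv; rewrite bnd_simp.
Qed.

Lemma rint_FTC a b f F : a <= b -> {in `[a, b], continuous f} ->
  (forall x, a <= x <= b -> is_derive x 1 F (f x)) -> rint a b f = F b - F a.
Proof.
rewrite le_eqVlt => /predU1P[<-|ab] cf dF.
  by rewrite subrr /rint set_itv1 Rintegral_set1.
have cF x : a <= x <= b -> {for x, continuous F}.
  move=> /dF d; apply: differentiable_continuous.
  by apply/derivable1_diffP; case: d.
rewrite /rint /Rintegral (@continuous_FTC2 _ f F) //.
- by apply: continuous_in_subspaceT => x /set_mem; exact: cf.
- split.
  + by move=> x /[!in_itv]/= /andP[ax xb]; case: (dF x _) => //; rewrite !ltW.
  + by apply: cvg_at_right_filter; apply: cF; rewrite lexx ltW.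
  + by apply: cvg_at_left_filter; apply: cF; rewrite lexx ltW.
- move=> x /[!in_itv]/= /andP[ax xb]; rewrite derive1E.
  by apply: derive_val; apply: dF; rewrite !ltW.
Qed.

End RealIntegral.

Section ComplexBasics.
Context (R : realType).
Local Notation C := R[i].
Local Open Scope complex_scope.

Lemma normC_real (x : R) : `|x%:C| = `|x|%:C :> C.
Proof. by rewrite normc_def /= expr0n addr0 sqrtr_sqr. Qed.

Lemma normC_Re (z : C) : (complex.Re `|z|)%:C = `|z|.
Proof. by rewrite normc_def. Qed.

Lemma gt0_Re (e : C) : 0 < e -> e = (complex.Re e)%:C /\ 0 < complex.Re e.
Proof. by case: e => a b; rewrite ltcE /= => /andP[/eqP-> ?]. Qed.

Lemma ge0_Re (e : C) : 0 <= e -> e = (complex.Re e)%:C /\ 0 <= complex.Re e.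
Proof. by case: e => a b; rewrite lecE /= => /andP[/eqP-> ?]. Qed.

Lemma normRe_le (z : C) (M : R) : `|z| <= M%:C -> `|complex.Re z| <= M.
Proof. by rewrite -lecR; apply: le_trans; exact: normc_ge_Re. Qed.

Lemma normIm_le (z : C) (M : R) : `|z| <= M%:C -> `|complex.Im z| <= M.
Proof.
rewrite -lecR; apply: le_trans; case: z => x y; rewrite normc_def /= lecR.
by rewrite -sqrtr_sqr ler_wsqrtr // lerDr sqr_ge0.
Qed.

Lemma norm_ReIm (z : C) : `|z| <= (`|complex.Re z| + `|complex.Im z|)%:C.
Proof.
rewrite {1}[z]complexE; apply: le_trans (ler_normD _ _) _.
rewrite normrM !normC_real rmorphD /= lerD2l -[leRHS]mul1r ler_wpM2r //.
  by rewrite ler0c.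
by rewrite normc_def /= expr0n expr1n add0r sqrtr1.
Qed.

Lemma near_normC (z : C) (e : R) : 0 < e -> \forall w \near z, `|z - w| <= e%:C.
Proof.
rewrite -ltcR => e0.
have /cvgrPdist_le : (fun w : C => w) @ z --> z by exact: cvg_id.
exact.
Qed.

Lemma Re_cts : continuous (@complex.Re R : C -> R).
Proof.
move=> z; rewrite /continuous_at; apply/(@cvgrPdist_le _ _ _ (nbhs z)) => e e0; apply: filterS (near_normC z e0) => w wz.
have -> : complex.Re z - complex.Re w = complex.Re (z - w) by case: z w {wz} => ? ? [].
exact: normRe_le.
Qed.

Lemma Im_cts : continuous (@complex.Im R : C -> R).
Proof.
move=> z; rewrite /continuous_at; apply/(@cvgrPdist_le _ _ _ (nbhs z)) => e e0; apply: filterS (near_normC z e0) => w wz.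
have -> : complex.Im z - complex.Im w = complex.Im (z - w) by case: z w {wz} => ? ? [].
exact: normIm_le.
Qed.

Lemma real_complex_cts : continuous (fun x : R => x%:C : C).
Proof.
move=> z; rewrite /continuous_at; apply/(@cvgrPdist_le _ _ _ (nbhs z)) => e /gt0_Re[-> e0]; near=> w.
rewrite -rmorphB normC_real lecR; near: w.
by apply: cvgr_dist_le => //; exact: cvg_id.
Unshelve. all: by end_near. Qed.

End ComplexBasics.

Section DiffEps.
Context (K : numFieldType) (V W : normedModType K).

Lemma diff_eps (f : V -> W) x : differentiable f x -> forall e : K, 0 < e ->
  \forall h \near (0 : V), `|f (h + x) - f x - 'd f x h| <= e * `|h|.
Proof.
move=> df e e0.
have /eqaddoP := diff_locally df; move=> /(_ e e0); apply: filterS => h /=.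
by rewrite /= opprD addrA.
Qed.

Lemma diff_of_eps (f : V -> W) x (L : {linear V -> W}) : continuous L ->
  (forall e : K, 0 < e ->
     \forall h \near (0 : V), `|f (h + x) - f x - L h| <= e * `|h|) ->
  differentiable f x /\ 'd f x = L :> (V -> W).
Proof.
move=> cL H.
have E : f \o shift x = cst (f x) + L +o_ 0 id.
  apply/eqaddoP => e e0; apply: filterS (H e e0) => h /=.
  by rewrite /= opprD addrA.
have dE := diff_unique cL E; split => //.
by apply/diff_locallyP; rewrite dE.
Qed.

End DiffEps.

Section LineDerivative.
Context (R : realType).
Local Notation C := R[i].
Local Open Scope complex_scope.
Context (V : normedModType C).

Lemma real_complex_dnbhs : (fun x : R => x%:C : C) @ (0 : R)^' --> (0 : C)^'.
Proof.
move=> A; rewrite /dnbhs /within /= => HA.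
have : \forall x \near (0 : R), (x%:C : C) != 0 -> A x%:C.
  exact: (@real_complex_cts R 0 [set y | y != 0 -> A y] HA).
apply: filterS => x H x0; apply: H.
by rewrite -(rmorph0 (real_complex R)) (inj_eq (@complexI R)).
Qed.

(** Stated by components because [R[i]] is a normed space over itself here: a function from [R] to
    [C] is differentiated through its two real parts. *)
Definition cder (g : R -> C) (x : R) (l : C) : Prop :=
  is_derive x (1 : R) (fun t => complex.Re (g t)) (complex.Re l) /\
  is_derive x (1 : R) (fun t => complex.Im (g t)) (complex.Im l).

Lemma is_derive_cvg (g : R -> R) x (l : R) :
  (fun h : R => h^-1 * (g (h + x) - g x)) @ 0^' --> l -> is_derive x (1 : R) g l.
Proof.
have -> : (fun h : R => h^-1 * (g (h + x) - g x)) =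
  (fun h : R => h^-1 *: ((g \o shift x) (h *: (1 : R)) - g x)).
  by apply/funext => h /=; rewrite [h *: _]mulr1.
move=> H; split; first by apply/cvg_ex; exists l.
exact/cvg_lim.
Qed.

(** Nonzero real increments tend to 0 inside the punctured neighbourhood of 0 in [C], so the complex
    difference quotient converges along them; its real and imaginary parts are the real difference
    quotients. *)
Lemma cder_line (f : V -> C) p v x : differentiable f (p + x%:C *: v) ->
  cder (fun t => f (p + t%:C *: v)) x ('d f (p + x%:C *: v) v).
Proof.
set q := p + _ => df.
have D : (fun h : C => h^-1 *: ((f \o shift q) (h *: v) - f q)) @ 0^' --> 'd f q v.
  by rewrite -deriveE //; exact: diff_derivable.
have {}D := cvg_comp _ _ real_complex_dnbhs D.
have qE (h : R) : p + (h + x)%:C *: v = h%:C *: v + q.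
  by rewrite rmorphD /= scalerDl /q addrCA.
split; apply: is_derive_cvg.
- rewrite (_ : (fun h : R => _) = @complex.Re R \o
    ((fun h : C => h^-1 *: ((f \o shift q) (h *: v) - f q)) \o (fun h : R => h%:C))).
    exact: cvg_comp _ _ D (@Re_cts R ('d f q v)).
  apply/funext => h /=; rewrite qE -/q; set u := f _; set w := f q.
  have -> : (h%:C)^-1 *: (u - w) = (h^-1)%:C * (u - w) by rewrite -fmorphV.
  by case: u w => ? ? [? ?] /=; rewrite mul0r subr0.
- rewrite (_ : (fun h : R => _) = @complex.Im R \o
    ((fun h : C => h^-1 *: ((f \o shift q) (h *: v) - f q)) \o (fun h : R => h%:C))).
    exact: cvg_comp _ _ D (@Im_cts R ('d f q v)).
  apply/funext => h /=; rewrite qE -/q; set u := f _; set w := f q.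
  have -> : (h%:C)^-1 *: (u - w) = (h^-1)%:C * (u - w) by rewrite -fmorphV.
  by case: u w => ? ? [? ?] /=; rewrite mul0r addr0.
Qed.

End LineDerivative.

Section ComplexIntegral.
Context (R : realType).
Local Notation C := R[i].
Local Open Scope complex_scope.
Implicit Types (a b c : R) (f g F : R -> C).

Definition cint a b f : C :=
  (rint a b (fun x => complex.Re (f x))) +i* (rint a b (fun x => complex.Im (f x))).

Lemma Re_comp_cts a b f : {in `[a, b], continuous f} ->
  {in `[a, b], continuous (fun x => complex.Re (f x))}.
Proof. by move=> cf x xab; apply: continuous_comp (cf x xab) (@Re_cts R _). Qed.

Lemma Im_comp_cts a b f : {in `[a, b], continuous f} ->
  {in `[a, b], continuous (fun x => complex.Im (f x))}.
Proof. by move=> cf x xab; apply: continuous_comp (cf x xab) (@Im_cts R _). Qed.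

Lemma cintD a b f g : {in `[a, b], continuous f} -> {in `[a, b], continuous g} ->
  cint a b (fun x => f x + g x) = cint a b f + cint a b g.
Proof.
move=> cf cg; rewrite /cint.
have RD (u v : C) : complex.Re (u + v) = complex.Re u + complex.Re v.
  by case: u v => ? ? [].
have ID (u v : C) : complex.Im (u + v) = complex.Im u + complex.Im v.
  by case: u v => ? ? [].
under [in X in X +i* _]eq_fun do rewrite RD.
under [in X in _ +i* X]eq_fun do rewrite ID.
by rewrite !rintD; do ?[exact: Re_comp_cts|exact: Im_comp_cts].
Qed.

Lemma cintZ a b (k : C) f : {in `[a, b], continuous f} ->
  cint a b (fun x => k * f x) = k * cint a b f.
Proof.
move=> cf; rewrite /cint; case: k => k l.
have cR := Re_comp_cts cf; have cI := Im_comp_cts cf.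
have ZR : {in `[a, b], continuous (fun x => k * complex.Re (f x))}.
  by move=> x /cR c; apply: cvgM => //; exact: cvg_cst.
have ZI : {in `[a, b], continuous (fun x => (- l) * complex.Im (f x))}.
  by move=> x /cI c; apply: cvgM => //; exact: cvg_cst.
have ZI' : {in `[a, b], continuous (fun x => k * complex.Im (f x))}.
  by move=> x /cI c; apply: cvgM => //; exact: cvg_cst.
have ZR' : {in `[a, b], continuous (fun x => l * complex.Re (f x))}.
  by move=> x /cR c; apply: cvgM => //; exact: cvg_cst.
have -> : (fun x => complex.Re ((k +i* l) * f x)) =
    (fun x => k * complex.Re (f x) + (- l) * complex.Im (f x)).
  by apply/funext => x; case: (f x) => u v /=; rewrite mulNr.
have -> : (fun x => complex.Im ((k +i* l) * f x)) =
    (fun x => k * complex.Im (f x) + l * complex.Re (f x)).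
  by apply/funext => x; case: (f x) => u v /=.
rewrite !rintD // !rintZ // mulNr.
by [].
Qed.

Lemma cint_split a b c f : a <= c -> c <= b -> {in `[a, b], continuous f} ->
  cint a b f = cint a c f + cint c b f.
Proof.
move=> ac cb cf; rewrite /cint (@rint_split _ a b c (fun x => complex.Re (f x))) //.
  rewrite (@rint_split _ a b c (fun x => complex.Im (f x))) //.
  exact: Im_comp_cts.
exact: Re_comp_cts.
Qed.

Lemma rint_bound a b (h : R -> R) M : a <= b -> {in `[a, b], continuous h} ->
  (forall x, a <= x <= b -> `|h x| <= M) -> `|rint a b h| <= M * (b - a).
Proof.
move=> ab ch hM; have cc k : {in `[a, b], continuous (cst k : R -> R)}.
  by move=> x _; exact: cvg_cst.
rewrite ler_norml -mulNr -!rint_cst //; apply/andP; split; apply: le_rint => // x /hM;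
  by rewrite ler_norml => /andP[].
Qed.

(** The factor 2 comes from estimating real and imaginary parts separately; no sharp constant is
    needed later. *)
Lemma cint_bound a b f M : a <= b -> {in `[a, b], continuous f} ->
  (forall x, a <= x <= b -> `|f x| <= M%:C) -> `|cint a b f| <= (2 * M * (b - a))%:C.
Proof.
move=> ab cf fM; apply: le_trans (norm_ReIm _) _; rewrite lecR /= -mulrA mulr_natl mulr2n.
apply: lerD; apply: rint_bound => //.
- exact: Re_comp_cts.
- by move=> x /fM; exact: normRe_le.
- exact: Im_comp_cts.
- by move=> x /fM; exact: normIm_le.
Qed.

Lemma cint_FTC a b f F : a <= b -> {in `[a, b], continuous f} ->
  (forall x, a <= x <= b -> cder F x (f x)) -> cint a b f = F b - F a.
Proof.
move=> ab cf dF; rewrite /cint.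
have -> : rint a b (fun x => complex.Re (f x)) = complex.Re (F b) - complex.Re (F a).
  apply: (@rint_FTC _ _ _ _ (fun x => complex.Re (F x))) => //.
    exact: Re_comp_cts.
  by move=> x /dF[].
have -> : rint a b (fun x => complex.Im (f x)) = complex.Im (F b) - complex.Im (F a).
  apply: (@rint_FTC _ _ _ _ (fun x => complex.Im (F x))) => //.
    exact: Im_comp_cts.
  by move=> x /dF[].
by case: (F b) (F a) => ? ? [].
Qed.

Lemma eq_cint a b f g : (forall x, a <= x <= b -> f x = g x) ->
  cint a b f = cint a b g.
Proof.
move=> fg; rewrite /cint /rint; congr (_ +i* _); apply: eq_Rintegral => x;
 by rewrite inE /= in_itv /= => /fg ->.
Qed.

End ComplexIntegral.

Section RingIdentities.
Context (K : comRingType).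
Implicit Types (i a b c d e f g h k : K).

Fact rect_add i a b c d e f g h :
  (a + e) + i * (b + f) - (c + g) - i * (d + h) =
  (a + i * b - c - i * d) + (e + i * f - g - i * h).
Proof. by ring. Qed.

Fact rect_scale i a b c d k :
  k * a + i * (k * b) - k * c - i * (k * d) = k * (a + i * b - c - i * d).
Proof. by ring. Qed.

Fact rect_addx i a b c d e f g :
  (a + e) + i * b - (c + f) - i * d =
  (a + i * g - c - i * d) + (e + i * b - f - i * g).
Proof. by ring. Qed.

Fact rect_addy i a b c d e f g :
  a + i * (b + e) - c - i * (d + f) =
  (a + i * b - g - i * d) + (g + i * e - c - i * f).
Proof. by ring. Qed.

Fact rect_prim (a b c d : K) : (b - a) + (c - b) - (c - d) - (d - a) = 0.
Proof. by ring. Qed.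

End RingIdentities.

Section RectangleIntegral.
Context (R : realType).
Local Notation C := R[i].
Local Open Scope complex_scope.
Implicit Types (a b c d : R) (f g F : C -> C).

(** The contour integral of f dz along the boundary, counterclockwise; ['i] is dz/dy on the vertical
    sides. *)
Definition rect_int f a b c d : C :=
  cint a b (fun x => f (x +i* c)) + 'i * cint c d (fun y => f (b +i* y))
  - cint a b (fun x => f (x +i* d)) - 'i * cint c d (fun y => f (a +i* y)).

Definition rect_bd a b c d (w : C) : Prop :=
  (a <= complex.Re w <= b /\ (complex.Im w = c \/ complex.Im w = d)) \/
  (c <= complex.Im w <= d /\ (complex.Re w = a \/ complex.Re w = b)).

Lemma hor_line (c x : R) : (x +i* c) = (0 +i* c) + x%:C *: 1 :> C.
Proof. by rewrite -[x%:C *: _]/(x%:C * 1); simpc. Qed.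

Lemma ver_line (a y : R) : (a +i* y) = (a +i* 0) + y%:C *: 'i :> C.
Proof. by rewrite -[y%:C *: _]/(y%:C * 'i); simpc. Qed.

Lemma line_cts (p v : C) : continuous (fun x : R => p + x%:C *: v : C).
Proof.
move=> x; apply: cvgD; first exact: cvg_cst.
exact: (cvgZ (@real_complex_cts R x) (cvg_cst _)).
Qed.

Lemma hor_cts f c x : {for (x +i* c), continuous f} ->
  {for x, continuous (fun x => f (x +i* c))}.
Proof.
under [fun x => f _]eq_fun do rewrite hor_line.
rewrite hor_line => cf; exact: (continuous_comp (@line_cts _ _ x) cf).
Qed.

Lemma ver_cts f a y : {for (a +i* y), continuous f} ->
  {for y, continuous (fun y => f (a +i* y))}.
Proof.
under [fun x => f _]eq_fun do rewrite ver_line.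
rewrite ver_line => cf; exact: (continuous_comp (@line_cts _ _ y) cf).
Qed.

Lemma rect_bd_cts a b c d f : (forall w, rect_bd a b c d w -> {for w, continuous f}) ->
  [/\ {in `[a, b], continuous (fun x => f (x +i* c))},
      {in `[c, d], continuous (fun y => f (b +i* y))},
      {in `[a, b], continuous (fun x => f (x +i* d))} &
      {in `[c, d], continuous (fun y => f (a +i* y))}].
Proof.
move=> cf; split => x; rewrite in_itv /= => xi.
- by apply: hor_cts; apply: cf; left; split; [|left].
- by apply: ver_cts; apply: cf; right; split; [|right].
- by apply: hor_cts; apply: cf; left; split; [|right].
- by apply: ver_cts; apply: cf; right; split; [|left].
Qed.

Lemma rect_intD a b c d f g :
  (forall w, rect_bd a b c d w -> {for w, continuous f}) ->
  (forall w, rect_bd a b c d w -> {for w, continuous g}) ->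
  rect_int (fun w => f w + g w) a b c d = rect_int f a b c d + rect_int g a b c d.
Proof.
move=> /rect_bd_cts[f1 f2 f3 f4] /rect_bd_cts[g1 g2 g3 g4]; rewrite /rect_int.
rewrite (cintD f1 g1) (cintD f2 g2) (cintD f3 g3) (cintD f4 g4).
exact: rect_add.
Qed.

Lemma rect_intZ a b c d k f :
  (forall w, rect_bd a b c d w -> {for w, continuous f}) ->
  rect_int (fun w => k * f w) a b c d = k * rect_int f a b c d.
Proof.
move=> /rect_bd_cts[f1 f2 f3 f4]; rewrite /rect_int.
rewrite (cintZ _ f1) (cintZ _ f2) (cintZ _ f3) (cintZ _ f4).
exact: rect_scale.
Qed.

Lemma eq_rect_int a b c d f g : (forall w, rect_bd a b c d w -> f w = g w) ->
  rect_int f a b c d = rect_int g a b c d.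
Proof.
move=> fg; rewrite /rect_int.
rewrite (@eq_cint _ a b (fun x => f (x +i* c)) (fun x => g (x +i* c))); last first.
  by move=> x xi; apply: fg; left; split; [|left].
rewrite (@eq_cint _ a b (fun x => f (x +i* d)) (fun x => g (x +i* d))); last first.
  by move=> x xi; apply: fg; left; split; [|right].
rewrite (@eq_cint _ c d (fun x => f (b +i* x)) (fun x => g (b +i* x))); last first.
  by move=> x xi; apply: fg; right; split; [|right].
rewrite (@eq_cint _ c d (fun x => f (a +i* x)) (fun x => g (a +i* x))) //.
by move=> x xi; apply: fg; right; split; [|left].
Qed.

Lemma normCi : `|'i : C| = 1.
Proof. by rewrite normc_def /= expr0n expr1n add0r sqrtr1. Qed.

Lemma rect_int_bound a b c d f M : a <= b -> c <= d ->
  (forall w, rect_bd a b c d w -> {for w, continuous f}) ->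
  (forall w, rect_bd a b c d w -> `|f w| <= M%:C) ->
  `|rect_int f a b c d| <= (4 * M * ((b - a) + (d - c)))%:C.
Proof.
move=> ab cd /rect_bd_cts[c1 c2 c3 c4] fM; rewrite /rect_int.
have -> : 4 * M * ((b - a) + (d - c)) = 2 * M * (b - a) + 2 * M * (d - c) +
  2 * M * (b - a) + 2 * M * (d - c) by ring.
rewrite !rmorphD; apply: le_trans (ler_normB _ _) _; apply: lerD; last first.
  rewrite normrM normCi mul1r; apply: (cint_bound cd c4) => x xi.
  by apply: fM; right; split; [|left].
apply: le_trans (ler_normB _ _) _; apply: lerD; last first.
  by apply: (cint_bound ab c3) => x xi; apply: fM; left; split; [|right].
apply: le_trans (ler_normD _ _) _; apply: lerD.
  by apply: (cint_bound ab c1) => x xi; apply: fM; left; split; [|left].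
rewrite normrM normCi mul1r; apply: (cint_bound cd c2) => x xi.
by apply: fM; right; split; [|right].
Qed.

Lemma rect_int_splitx a b c d e f : a <= e -> e <= b ->
  (forall w, rect_bd a b c d w -> {for w, continuous f}) ->
  rect_int f a b c d = rect_int f a e c d + rect_int f e b c d.
Proof.
move=> ae eb /rect_bd_cts[c1 c2 c3 c4]; rewrite /rect_int.
rewrite (cint_split ae eb c1) (cint_split ae eb c3).
exact: rect_addx.
Qed.

Lemma rect_int_splity a b c d e f : c <= e -> e <= d ->
  (forall w, rect_bd a b c d w -> {for w, continuous f}) ->
  rect_int f a b c d = rect_int f a b c e + rect_int f a b e d.
Proof.
move=> ae eb /rect_bd_cts[c1 c2 c3 c4]; rewrite /rect_int.
rewrite (cint_split ae eb c2) (cint_split ae eb c4).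
exact: rect_addy.
Qed.

Lemma diffC_scale (F : C -> C) w h : 'd F w h = h * 'd F w 1.
Proof. by rewrite -[in LHS](mulr1 h) -[h * 1]/(h *: 1) linearZ. Qed.

(** By the fundamental theorem each side contributes the difference of [F] at its corners, and the
    four differences cancel. *)
Lemma rect_int_prim a b c d f F : a <= b -> c <= d ->
  (forall w, rect_bd a b c d w -> {for w, continuous f}) ->
  (forall w, rect_bd a b c d w -> differentiable F w /\ 'd F w 1 = f w) ->
  rect_int f a b c d = 0.
Proof.
move=> ab cd /rect_bd_cts[c1 c2 c3 c4] dF.
have hor e x : rect_bd a b c d (x +i* e) ->
    cder (fun x => F (x +i* e)) x (f (x +i* e)).
  move=> /dF[dFx <-]; under [fun x => F _]eq_fun do rewrite hor_line.
  by rewrite (hor_line e x); apply: cder_line; rewrite -hor_line.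
have ver e y : rect_bd a b c d (e +i* y) ->
    cder (fun y => F (e +i* y)) y ('i * f (e +i* y)).
  move=> /dF[+ <-]; under [fun x => F _]eq_fun do rewrite ver_line.
  have <- := diffC_scale F (e +i* y) 'i.
  rewrite (ver_line e y) => D; apply: cder_line; exact: D.
have Zc e : {in `[c, d], continuous (fun y => f (e +i* y))} ->
   {in `[c, d], continuous (fun y => 'i * f (e +i* y))}.
  by move=> ce x /ce cx; exact: (cvgM (cvg_cst _) cx).
have H1 : cint a b (fun x => f (x +i* c)) = F (b +i* c) - F (a +i* c).
  apply: (cint_FTC (F := fun x => F (x +i* c)) ab c1) => x xi.
  by apply: hor; left; split; [|left].
have H2 : cint a b (fun x => f (x +i* d)) = F (b +i* d) - F (a +i* d).
  apply: (cint_FTC (F := fun x => F (x +i* d)) ab c3) => x xi.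
  by apply: hor; left; split; [|right].
have H3 : cint c d (fun y => 'i * f (b +i* y)) = F (b +i* d) - F (b +i* c).
  apply: (cint_FTC (F := fun x => F (b +i* x)) cd (Zc _ c2)) => x xi.
  by apply: ver; right; split; [|right].
have H4 : cint c d (fun y => 'i * f (a +i* y)) = F (a +i* d) - F (a +i* c).
  apply: (cint_FTC (F := fun x => F (a +i* x)) cd (Zc _ c4)) => x xi.
  by apply: ver; right; split; [|left].
rewrite /rect_int -(cintZ 'i c2) -(cintZ 'i c4) H1 H2 H3 H4.
exact: rect_prim.
Qed.

End RectangleIntegral.

(** * Goursat's lemma and Cauchy's estimates *)

Section ScalarDerivatives.
Context (K : numFieldType).
Implicit Types (f : K -> K).

Lemma is_derive_diff f (w l : K) : is_derive w 1 f l ->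
  differentiable f w /\ 'd f w 1 = l.
Proof.
move=> [df <-]; have D : differentiable f w by exact/derivable1_diffP.
by split=> //; rewrite deriveE.
Qed.

Lemma diff_scalar f (w l : K) :
  (forall e : K, 0 < e -> \forall h \near (0 : K), `|f (h + w) - f w - h * l| <= e * `|h|) ->
  differentiable f w /\ 'd f w 1 = l.
Proof.
move=> H.
have lin : linear (fun h : K => h * l) by move=> k u v; rewrite mulrDl -mulrA.
pose LM := GRing.isLinear.Build _ _ _ _ _ lin.
pose L : {linear K -> K} := HB.pack (fun h : K => h * l) LM.
have cL : continuous L by move=> x; exact: (@cvgM K K (nbhs x) _ id (cst l) x l cvg_id (@cst_continuous _ _ l x)).
have [dfw dE] := @diff_of_eps K K K f w L cL H.
by split=> //; rewrite dE /L /= mul1r.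
Qed.

Lemma affine_prim (k D w : K) :
  differentiable (fun w : K => k * w + D / 2 * w ^+ 2) w /\
  'd (fun w : K => k * w + D / 2 * w ^+ 2) w 1 = k + D * w.
Proof.
apply: diff_scalar => e e0; near=> h.
have -> : k * (h + w) + D / 2 * (h + w) ^+ 2 - (k * w + D / 2 * w ^+ 2) - h * (k + D * w)
  = (D / 2 * h) * h by field.
rewrite normrM ler_wpM2r // normrM.
have D1 : 0 < 1 + `|D / 2| by rewrite ltr_pwDl ?ltr01 ?normr_ge0.
have hs : `|h| <= e / (1 + `|D / 2|).
  near: h; apply: (@nbhs0_le K K^o); exact: divr_gt0.
apply: le_trans (ler_wpM2l _ hs) _ => //.
rewrite mulrA ler_pdivrMr // mulrC ler_pM2l // lerDr ler01 //.
Unshelve. all: by end_near. Qed.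

Lemma affine_cts (k D w : K) : {for w, continuous (fun w : K => k + D * w)}.
Proof.
have cM := @continuousM K K (cst D) id w (@cst_continuous _ _ D w) (@cvg_id _ (nbhs w)).
exact: (@cvgD K K K (nbhs w) _ (cst k) (cst D \* id) k (D * w) (@cst_continuous _ _ k w) cM).
Qed.

End ScalarDerivatives.

Section Goursat.
Context (R : realType).
Local Notation C := R[i].
Local Open Scope complex_scope.
Implicit Types (a b c d e : R) (f g F : C -> C).

Definition rect a b c d (w : C) : Prop :=
  a <= complex.Re w <= b /\ c <= complex.Im w <= d.

Lemma rect_bdW a b c d w : a <= b -> c <= d -> rect_bd a b c d w -> rect a b c d w.
Proof.
by move=> ab cd [[H [E|E]]|[H [E|E]]]; split; rewrite ?E ?lexx ?ab ?cd.
Qed.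

(** Norms on [R[i]] take values in [R[i]]; this real copy allows real order arguments. [vn] plays
    the same part on normed spaces. *)
Definition rnorm (z : C) : R := complex.Re `|z|.

Lemma rnormE z : `|z| = (rnorm z)%:C.
Proof. by rewrite normC_Re. Qed.

Lemma rnormD (z w : C) : rnorm (z + w) <= rnorm z + rnorm w.
Proof. by rewrite -lecR rmorphD /= -!rnormE; exact: ler_normD. Qed.

Lemma rnorm_ge0 z : 0 <= rnorm z.
Proof. by rewrite -ler0c -rnormE. Qed.

Lemma rect_dist a b c d (w w0 : C) : rect a b c d w -> rect a b c d w0 ->
  rnorm (w - w0) <= (b - a) + (d - c).
Proof.
move=> [/andP[w1 w2] /andP[w3 w4]] [/andP[v1 v2] /andP[v3 v4]].
rewrite -lecR -rnormE; apply: le_trans (norm_ReIm _) _; rewrite lecR.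
move: w w0 w1 w2 w3 w4 v1 v2 v3 v4 => [x y] [u v] /= *.
by rewrite lerD // ler_norml; lra.
Qed.

Lemma rect_int_affine a b c d k D : a <= b -> c <= d ->
  rect_int (fun w => k + D * w) a b c d = 0.
Proof.
move=> ab cd; apply: (rect_int_prim ab cd) => w _; first exact: (@affine_cts C).
exact: (@affine_prim C k D w).
Qed.

(** The affine part of [f] at [w0] has a primitive, so only the remainder contributes. It is at most
    e times the half perimeter, and the contour bound multiplies by 4 times the half perimeter
    again. *)
Lemma goursat_local a b c d f (w0 D : C) (e : R) : a <= b -> c <= d -> 0 <= e ->
  rect a b c d w0 ->
  (forall w, rect a b c d w -> {for w, continuous f}) ->
  (forall w, rect a b c d w -> `|f w - f w0 - D * (w - w0)| <= e%:C * `|w - w0|) ->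
  rnorm (rect_int f a b c d) <= 4 * e * ((b - a) + (d - c)) ^+ 2.
Proof.
move=> ab cd e0 rw0 cf fD.
pose k := f w0 - D * w0.
have cg w : rect a b c d w -> {for w, continuous (fun w => f w - (k + D * w))}.
  by move=> rw; exact: (continuousB (cf w rw) (@affine_cts C k D w)).
have -> : rect_int f a b c d = rect_int (fun w => f w - (k + D * w)) a b c d.
  rewrite -[RHS]addr0 -(rect_int_affine k D ab cd) -rect_intD.
  - by apply: eq_rect_int => w _; rewrite subrK.
  - by move=> w /(rect_bdW ab cd); exact: cg.
  - by move=> w _; exact: (@affine_cts C).
rewrite -lecR -rnormE expr2 mulrA -[4 * e * _]mulrA; apply: rect_int_bound => //.
  by move=> w /(rect_bdW ab cd); exact: cg.
move=> w /(rect_bdW ab cd) rw.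
have -> : f w - (k + D * w) = f w - f w0 - D * (w - w0).
  by rewrite /k; move: (f w) (f w0) => u v; ring.
apply: le_trans (fD w rw) _; rewrite rmorphM ler_wpM2l ?ler0c // rnormE lecR.
exact: rect_dist.
Qed.

Fact sum4_le (x1 x2 x3 x4 u z : R) : z <= x1 + x2 + (x3 + x4) ->
  x1 <= u -> x2 <= u -> x3 <= u -> x4 <= u -> z <= 4 * u.
Proof. by lra. Qed.

(** The threshold is quadratic in the size, hence is divided by exactly 4 when the sides are halved.
    Since the four quarter integrals add up to the whole, one quarter of a bad rectangle is bad. *)
Definition bad f (e : R) (q : R * R * R * R) : Prop :=
  let: (a, b, c, d) := q in
  [/\ a <= b, c <= d & e * ((b - a) + (d - c)) ^+ 2 < rnorm (rect_int f a b c d)].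

Definition quarter (q q' : R * R * R * R) : Prop :=
  let: (a, b, c, d) := q in let: (a', b', c', d') := q' in
  [/\ a <= a', b' <= b, c <= c', d' <= d & b' - a' = (b - a) / 2 /\ d' - c' = (d - c) / 2].

Fact mid_facts a b : a <= b -> let x := (a + b) / 2 in
  [/\ a <= x, x <= b, x - a = (b - a) / 2 & b - x = (b - a) / 2].
Proof. by move=> ab /=; split; lra. Qed.

Fact half_sq e u v : e * (u + v) ^+ 2 = 4 * (e * (u / 2 + v / 2) ^+ 2).
Proof. by field. Qed.

Lemma bad_quarter f e q :
  (let: (a, b, c, d) := q in forall w, rect a b c d w -> {for w, continuous f}) ->
  bad f e q -> exists q', bad f e q' /\ quarter q q'.
Proof.
move: q => [[[a b] c] d] cf [ab cd J].
have [] := mid_facts ab; set x := (a + b) / 2 => ax xb x1 x2.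
have [] := mid_facts cd; set y := (c + d) / 2 => cy yd y1 y2.
have sub a' b' c' d' w : a <= a' -> b' <= b -> c <= c' -> d' <= d -> a' <= b' -> c' <= d' ->
    rect_bd a' b' c' d' w -> {for w, continuous f}.
  move=> h1 h2 h3 h4 h5 h6 /(rect_bdW h5 h6)[/andP[r1 r2] /andP[r3 r4]].
  apply: cf; split; apply/andP; split.
  - exact: le_trans h1 r1.
  - exact: le_trans r2 h2.
  - exact: le_trans h3 r3.
  - exact: le_trans r4 h4.
have E : rect_int f a b c d = (rect_int f a x c y + rect_int f a x y d) +
   (rect_int f x b c y + rect_int f x b y d).
  rewrite (rect_int_splitx ax xb); last by move=> w; exact: sub.
  rewrite (rect_int_splity cy yd); last by move=> w; exact: sub.
  by rewrite (rect_int_splity (a := x) cy yd) // => w; exact: sub.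
have le4 : rnorm (rect_int f a b c d) <= rnorm (rect_int f a x c y) +
  rnorm (rect_int f a x y d) + (rnorm (rect_int f x b c y) + rnorm (rect_int f x b y d)).
  by rewrite E; apply: le_trans (rnormD _ _) _; apply: lerD; exact: rnormD.
rewrite half_sq in J; set u := e * _ in J.
have key a' b' c' d' : a <= a' -> b' <= b -> c <= c' -> d' <= d -> a' <= b' -> c' <= d' ->
    b' - a' = (b - a) / 2 -> d' - c' = (d - c) / 2 ->
    u < rnorm (rect_int f a' b' c' d') ->
    exists q', bad f e q' /\ quarter (a, b, c, d) q'.
  move=> h1 h2 h3 h4 g1 g2 h5 h6 h7; exists (a', b', c', d'); split; last by split.
  by split => //; rewrite h5 h6.
have [h|h1] := ltP u (rnorm (rect_int f a x c y)); first exact: key h.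
have [h|h2] := ltP u (rnorm (rect_int f a x y d)); first exact: key h.
have [h|h3] := ltP u (rnorm (rect_int f x b c y)); first exact: key h.
have [h|h4] := ltP u (rnorm (rect_int f x b y d)); first exact: key h.
by move: J; rewrite ltNge (sum4_le le4 h1 h2 h3 h4).
Qed.

Fact nested_limit (a b : nat -> R) :
  (forall n, a n <= b n) -> (forall n, a n <= a n.+1) -> (forall n, b n.+1 <= b n) ->
  exists x, forall n, a n <= x <= b n.
Proof.
move=> ab aS bS.
have ai : nondecreasing_seq a by apply/nondecreasing_seqP.
have bi : nonincreasing_seq b by apply/nonincreasing_seqP.
have anb n m : a n <= b m.
  apply: le_trans (ai _ _ (leq_maxl n m)) (le_trans (ab _) _).
  exact: bi (leq_maxr n m).
exists (sup (range a)) => n; apply/andP; split.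
  apply: ub_le_sup; last by exists n.
  by exists (b 0%N) => _ [k _ <-].
apply: ge_sup; first by exists (a 0%N); exists 0%N.
by move=> _ [k _ <-].
Qed.

Lemma goursat a b c d f : a <= b -> c <= d ->
  (forall w, rect a b c d w -> differentiable f w) -> rect_int f a b c d = 0.
Proof.
move=> ab cd df.
suff H e : 0 < e -> rnorm (rect_int f a b c d) <= e * ((b - a) + (d - c)) ^+ 2.
  apply/eqP; rewrite -normr_eq0 rnormE; apply/eqP; congr (_%:C).
  apply/eqP; rewrite eq_le rnorm_ge0 andbT.
  set s := b - a + (d - c) in H.
  have s0 : 0 <= s by rewrite /s; lra.
  apply/ler_addgt0Pr => e e0; rewrite add0r.
  have s1 : 0 < 1 + s ^+ 2 by rewrite ltr_pwDl // sqr_ge0.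
  apply: le_trans (H (e / (1 + s ^+ 2)) (divr_gt0 e0 s1)) _.
  rewrite -mulrA ger_pMr // mulrC ler_pdivrMr // mul1r.
  by rewrite lerDr.
move=> e0; rewrite leNgt; apply/negP => J.
have cf w : rect a b c d w -> {for w, continuous f}.
  by move=> /df; exact: differentiable_continuous.
pose inside (q : R * R * R * R) := let: (a', b', c', d') := q in
  [/\ a <= a', b' <= b, c <= c' & d' <= d].
(* The statement is made total so that [choice] yields a function to iterate: a rectangle that is
   not bad is simply returned. *)
have step q : exists q', bad f e q /\ inside q -> bad f e q' /\ inside q' /\ quarter q q'.
  case: (pselect (bad f e q /\ inside q)) => [[]|nb]; last by exists q => /nb.
  move: q => [[[a1 b1] c1] d1] B [i1 i2 i3 i4].
  have [|q' [Bq' Qq']] := @bad_quarter f e (a1, b1, c1, d1) _ B.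
    move=> w [/andP[? ?] /andP[? ?]]; apply: cf; split; apply/andP; split; lra.
  exists q' => _; split => //; split => //; move: q' Qq' {Bq'} => [[[a2 b2] c2] d2].
  by move=> [? ? ? ? _]; split; lra.
have [g gP] := choice step.
pose q n := iter n g (a, b, c, d).
have qP n : bad f e (q n) /\ inside (q n).
  elim: n => [|n IHn]; first by split; split.
  by have [? []] := gP _ IHn.
have qQ n : quarter (q n) (q n.+1) by have [_ []] := gP _ (qP n).
pose qa n := (q n).1.1.1; pose qb n := (q n).1.1.2; pose qc n := (q n).1.2.
pose qd n := (q n).2.
have qE n : q n = (qa n, qb n, qc n, qd n).
  by rewrite /qa /qb /qc /qd; case: (q n) => [[[? ?] ?] ?].
have bq n : bad f e (qa n, qb n, qc n, qd n) by rewrite -qE; case: (qP n).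
have iq n : inside (qa n, qb n, qc n, qd n) by rewrite -qE; case: (qP n).
have hq n : quarter (qa n, qb n, qc n, qd n) (qa n.+1, qb n.+1, qc n.+1, qd n.+1).
  by rewrite -!qE.
have [x xP] : exists x, forall n, qa n <= x <= qb n.
  apply: nested_limit => n; first by case: (bq n).
    by case: (hq n).
  by case: (hq n).
have [y yP] : exists x, forall n, qc n <= x <= qd n.
  apply: nested_limit => n; first by case: (bq n).
    by case: (hq n).
  by case: (hq n).
pose w0 : C := x +i* y.
pose s n := qb n - qa n + (qd n - qc n).
have sE n : s n = (b - a + (d - c)) / 2 ^+ n.
  elim: n => [|n IHn]; first by rewrite expr0 divr1.
  have [_ _ _ _ [E1 E2]] := hq n.
  by rewrite /s E1 E2 exprSr invfM mulrA -IHn /s; lra.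
have rw0 : rect a b c d w0.
  have := xP 0%N; have := yP 0%N; rewrite /qa /qb /qc /qd /=.
  by split.
(* The quarter cancels the factor 4 of [goursat_local], so a rectangle inside the disc of
   differentiability at [w0] cannot be bad for [e]. *)
have e4 : 0 < e / 4 by rewrite divr_gt0.
have := diff_eps (df _ rw0); move=> /(_ (e / 4)%:C).
rewrite ltcR => /(_ e4) /nbhs_ballP[r' /= /gt0_Re[r'E r0] Hr].
move: r0 Hr; rewrite r'E; set r := complex.Re _ => r0 Hr .
have [n sn] : exists n, s n < r.
  have := @cvg_geometric R (b - a + (d - c)) 2^-1.
  rewrite ger0_norm ?invr_ge0 // invf_lt1 // ltr1n => /(_ isT).
  move=> /cvgrPdist_lt /(_ _ r0) [n _ /(_ n (leqnn n))].
  rewrite sub0r normrN /geometric /= exprVn -sE => H; exists n.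
  exact: le_lt_trans (ler_norm _) H.
have [Ba Bc] := bq n; rewrite ltNge => /negP; apply.
have -> : e = 4 * (e / 4) by field.
have rin w : rect (qa n) (qb n) (qc n) (qd n) w -> rect a b c d w.
  case: (iq n) => i1 i2 i3 i4 [/andP[r1 r2] /andP[r3 r4]].
  by split; rewrite (le_trans _ r1, le_trans _ r3) // (le_trans r2, le_trans r4).
apply: (@goursat_local _ _ _ _ f w0 ('d f w0 1)) => //.
- exact: ltW e4.
- by move=> w /rin; exact: cf.
move=> w rw; have := Hr (w - w0); rewrite subrK.
have -> : 'd f w0 1 * (w - w0) = 'd f w0 (w - w0) by rewrite [RHS]diffC_scale mulrC.
apply; rewrite /ball /= sub0r normrN rnormE ltcR; apply: le_lt_trans sn.
by apply: rect_dist.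
Qed.

End Goursat.

Section FieldCalculus.
Context (K : numFieldType).
Implicit Types (f : K -> K).

Lemma diff_quot f (a z w : K) : differentiable f w -> w != z ->
  differentiable (fun w => (f w - a) * (w - z)^-1) w.
Proof.
move=> df wz.
apply: (@differentiableM _ _ (fun w => f w - a) (fun w => (w - z)^-1)).
  by apply: (@differentiableB _ _ _ f (cst a)) => //; exact: differentiable_cst.
apply: (@differentiableV _ _ (fun w => w - z)); last by rewrite subr_eq0.
by apply: (@differentiableB _ _ _ id (cst z)).
Qed.

Lemma diff_invX (k : nat) (w : K) : w != 0 -> differentiable (fun w : K => w^-1 ^+ k) w.
Proof.
move=> w0; have -> : (fun w : K => w^-1 ^+ k) = (fun w : K => w^-1) ^+ k.
  by apply/funext => x; rewrite exprfctE.
apply/derivable1_diffP; apply: derivableX.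
by apply: (@derivableV _ _ id).
Qed.

Lemma invX_prim (k : nat) (w : K) : w != 0 ->
  differentiable (fun w : K => - (k.+1%:R)^-1 * w^-1 ^+ k.+1) w /\
  'd (fun w : K => - (k.+1%:R)^-1 * w^-1 ^+ k.+1) w 1 = w^-1 ^+ k.+2.
Proof.
move=> w0.
have dV : derivable (fun w : K => w^-1) w 1 by apply: (@derivableV _ _ id).
have dX : derivable ((fun w : K => w^-1) ^+ k.+1) w 1 by exact: derivableX.
pose c := - (k.+1%:R)^-1 : K.
have E : (fun w : K => c * w^-1 ^+ k.+1) = c *: ((fun w : K => w^-1) ^+ k.+1).
  by apply/funext => x; rewrite /= exprfctE.
rewrite E; apply: is_derive_diff; split; first exact: derivableZ.
rewrite (deriveZ c dX) (deriveX k.+1 dV) (@deriveV _ _ id) // derive_id.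
rewrite -[c *: _]/(c * (_ * (_ * 1))) mulr1 /c.
have k0 : k.+1%:R != 0 :> K by rewrite pnatr_eq0.
rewrite /= -exprVn; move: (w^-1) => u; rewrite [u ^+ k.+2]exprS [u ^+ k.+1]exprS expr2;
  move: (u ^+ k) => v.
by field.
Qed.

End FieldCalculus.

Section Cauchy.
Context (R : realType).
Local Notation C := R[i].
Local Open Scope complex_scope.
Implicit Types (f : C -> C).

Local Notation sq := (rect (-1) 1 (-1) (1 : R)).
Local Notation bd := (rect_bd (-1) 1 (-1) (1 : R)).
Local Notation oint f := (rect_int f (-1) 1 (-1) (1 : R)).

Lemma bd_sq (w : C) : bd w -> sq w.
Proof. by apply: rect_bdW; lra. Qed.

Lemma bd_norm (w : C) : bd w -> 1 <= `|w|.
Proof.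
have h (x : R) : x = -1 \/ x = 1 -> `|x| = 1.
  by case=> ->; rewrite ?normrN normr1.
move=> [[_ /h E]|[_ /h E]].
  apply: le_trans (_ : (`|complex.Im w|)%:C <= _); first by rewrite E.
  by rewrite rnormE lecR; apply: normIm_le; rewrite rnormE.
by apply: le_trans (normc_ge_Re _); rewrite E.
Qed.

Lemma bd_sub (z w : C) : bd w -> `|z| <= (1 / 2)%:C -> (1 / 2)%:C <= `|w - z|.
Proof.
move=> /bd_norm w1 z2; apply: le_trans (lerB_dist _ _).
have -> : (1 / 2)%:C = 1 - (1 / 2)%:C :> C.
  by rewrite -[1 in RHS](rmorph1 (real_complex R)) -rmorphB; congr (_%:C); field.
exact: lerB.
Qed.

Lemma chalf_gt0 : 0 < (1 / 2)%:C :> C.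
Proof. by rewrite ltcR divr_gt0. Qed.

Lemma sub_rect (a b c d a1 b1 c1 d1 : R) (w : C) : a <= a1 -> b1 <= b -> c <= c1 ->
  d1 <= d -> rect a1 b1 c1 d1 w -> rect a b c d w.
Proof.
move=> h1 h2 h3 h4 [/andP[w1 w2] /andP[w3 w4]].
by split; rewrite (le_trans _ w1, le_trans _ w3) // (le_trans w2, le_trans w4).
Qed.

(** The region between the two rectangles is cut into four rectangles that miss z, and Goursat's
    lemma kills each of them. *)
Lemma rect_int_puncture (a b c d a' b' c' d' : R) (z : C) h :
  a <= a' -> a' < complex.Re z -> complex.Re z < b' -> b' <= b ->
  c <= c' -> c' < complex.Im z -> complex.Im z < d' -> d' <= d ->
  (forall w, rect a b c d w -> w != z -> differentiable h w) ->
  rect_int h a b c d = rect_int h a' b' c' d'.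
Proof.
set x := complex.Re z; set y := complex.Im z => aa ax xb bb cc cy yd dd dh.
have ab' : a' <= b' by apply: ltW; exact: lt_trans xb.
have cd' : c' <= d' by apply: ltW; exact: lt_trans yd.
have a'b : a' <= b by exact: le_trans bb.
have ab : a <= b by exact: le_trans a'b.
have c'd : c' <= d by exact: le_trans dd.
have cd : c <= d by exact: le_trans c'd.
have ax' : a < x by exact: le_lt_trans ax.
have xb' : x < b by exact: lt_le_trans bb.
have cy' : c < y by exact: le_lt_trans cy.
have yd' : y < d by exact: lt_le_trans dd.
have nz w : complex.Re w != x \/ complex.Im w != y -> w != z.
  by move=> H; apply/eqP => wz; move: H; rewrite wz /x /y !eqxx; case.
have n1 : a != x by rewrite lt_eqF.
have n2 : a' != x by rewrite lt_eqF.
have n3 : b != x by rewrite gt_eqF.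
have n4 : b' != x by rewrite gt_eqF.
have n5 : c != y by rewrite lt_eqF.
have n6 : c' != y by rewrite lt_eqF.
have n7 : d != y by rewrite gt_eqF.
have n8 : d' != y by rewrite gt_eqF.
have bc p q r s w : a <= p -> q <= b -> c <= r -> s <= d -> p <= q -> r <= s ->
    p != x -> q != x -> r != y -> s != y -> rect_bd p q r s w -> {for w, continuous h}.
  move=> h1 h2 h3 h4 h5 h6 m1 m2 m3 m4 bw; apply: differentiable_continuous.
  apply: dh; first exact: sub_rect (rect_bdW h5 h6 bw).
  case: bw => [[_ [E|E]]|[_ [E|E]]]; apply: nz; rewrite E; by [left|right].
have I1 : rect_int h a b c d = rect_int h a a' c d + rect_int h a' b c d.
  apply: rect_int_splitx => // w.
  by apply: bc => //; rewrite ?lexx.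
have Z1 : rect_int h a a' c d = 0.
  apply: goursat => // w rw; apply: dh; first by apply: sub_rect rw; rewrite ?lexx.
  by case: rw => [/andP[w1 w2] w3]; apply: nz; left; rewrite lt_eqF //; exact: le_lt_trans ax.
have I2 : rect_int h a' b c d = rect_int h a' b' c d + rect_int h b' b c d.
  apply: rect_int_splitx => // w.
  by apply: bc => //; rewrite ?lexx.
have Z2 : rect_int h b' b c d = 0.
  apply: goursat => // w rw; apply: dh.
    by apply: sub_rect rw; rewrite ?lexx // ltW // (lt_trans ax').
  by case: rw => [/andP[w1 w2] w3]; apply: nz; left; rewrite gt_eqF //; exact: lt_le_trans w1.
have I3 : rect_int h a' b' c d = rect_int h a' b' c c' + rect_int h a' b' c' d.
  apply: rect_int_splity => // w.
  by apply: bc => //; rewrite ?lexx.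
have Z3 : rect_int h a' b' c c' = 0.
  apply: goursat => // w rw; apply: dh; first by apply: sub_rect rw; rewrite ?lexx.
  by case: rw => [_ /andP[w1 w2]]; apply: nz; right; rewrite lt_eqF //; exact: le_lt_trans cy.
have I4 : rect_int h a' b' c' d = rect_int h a' b' c' d' + rect_int h a' b' d' d.
  apply: rect_int_splity => // w.
  by apply: bc => //; rewrite ?lexx.
have Z4 : rect_int h a' b' d' d = 0.
  apply: goursat => // w rw; apply: dh.
    by apply: sub_rect rw; rewrite ?lexx // ltW // (lt_trans cy').
  by case: rw => [_ /andP[w1 w2]]; apply: nz; right; rewrite gt_eqF //; exact: lt_le_trans w1.
by rewrite I1 Z1 add0r I2 Z2 addr0 I3 Z3 add0r I4 Z4 addr0.
Qed.

Fact square_facts (x d : R) : -(1/2) <= x -> x <= 1/2 -> 0 < d -> d <= 1/2 ->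
  [/\ -1 <= x - d, x - d < x, x < x + d & x + d <= 1] /\ x - d <= x + d.
Proof. by move=> *; split; [split|]; lra. Qed.

(** Differentiability at z keeps the difference quotient bounded near z, where it need not be
    differentiable. Its contour integral equals that over arbitrarily small squares around z, hence
    is 0. *)
Lemma rect_int_quot f (z : C) : `|z| <= (1 / 2)%:C ->
  (forall w, sq w -> differentiable f w) ->
  oint (fun w => (f w - f z) * (w - z)^-1) = 0.
Proof.
move=> z2 df; set h := fun w => _.
have [zx zy] : `|complex.Re z| <= 1 / 2 /\ `|complex.Im z| <= 1 / 2.
  by split; [exact: normRe_le|exact: normIm_le].
move: zx zy; rewrite !ler_norml => /andP[zx1 zx2] /andP[zy1 zy2].
have sz : sq z by split; apply/andP; split; lra.
have dh w : sq w -> w != z -> differentiable h w.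
  by move=> sw wz; apply: (@diff_quot C) => //; exact: df.
have ch w : sq w -> w != z -> {for w, continuous h}.
  by move=> sw wz; apply: differentiable_continuous; exact: dh.
have [M M0 [d0 d00 Hd]] : exists2 M : R, 0 <= M & exists2 d : R, 0 < d &
   forall w : C, rnorm (w - z) < d -> rnorm (h w) <= M.
  have := diff_eps (df _ sz) (ltr01 : 0 < 1 :> C).
  move=> /nbhs_ballP[r' /= /gt0_Re[r'E r0] Hr].
  exists (1 + rnorm ('d f z 1)); first by rewrite addr_ge0 ?rnorm_ge0.
  exists (complex.Re r') => // w wz.
  have := Hr (w - z); rewrite /ball /= sub0r normrN r'E rnormE ltcR => /(_ wz).
  rewrite subrK (diffC_scale f z (w - z)) mul1r => H.
  rewrite -lecR -rnormE /h; have [->|wz0] := eqVneq w z.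
    by rewrite subrr mul0r normr0 rmorphD addr_ge0 // ler0c ?rnorm_ge0 ?ler01.
  have wz1 : 0 < `|w - z| by rewrite normr_gt0 subr_eq0.
  rewrite normrM normfV ler_pdivrMr // rmorphD mulrDl mul1r.
  rewrite -(subrK ((w - z) * 'd f z 1) (f w - f z)).
  apply: le_trans (ler_normD _ _) _; apply: lerD => //.
  by rewrite normrM mulrC ler_wpM2r // rnormE.
pose x := complex.Re z; pose y := complex.Im z.
have bound d : 0 < d -> d <= 1 / 2 -> 2 * d < d0 ->
    rnorm (oint h) <= 4 * M * ((x + d - (x - d)) + (y + d - (y - d))).
  move=> dp d2 dd.
  have [[a1 ax xb b1] ab] := square_facts zx1 zx2 dp d2.
  have [[c1 cy ye e1] ce] := square_facts zy1 zy2 dp d2.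
  rewrite (rect_int_puncture a1 ax xb b1 c1 cy ye e1 dh).
  rewrite -lecR -rnormE; apply: (rect_int_bound ab ce) => w bw.
    have rw := rect_bdW ab ce bw.
    apply: differentiable_continuous; apply: dh; first exact: sub_rect rw.
    apply/eqP => wz; case: bw; rewrite wz.
    - by move=> [_ [E|E]]; move: cy ye; rewrite -E ?ltxx // -E ltxx.
    - by move=> [_ [E|E]]; move: ax xb; rewrite -E ?ltxx // -E ltxx.
  have [/andP[w1 w2] /andP[w3 w4]] := rect_bdW ab ce bw.
  rewrite rnormE lecR; apply: Hd; apply: le_lt_trans dd.
  rewrite -lecR -rnormE; apply: le_trans (norm_ReIm _) _; rewrite lecR.
  have -> : complex.Re (w - z) = complex.Re w - x by rewrite /x; case: (w) (z) => ? ? [].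
  have -> : complex.Im (w - z) = complex.Im w - y by rewrite /y; case: (w) (z) => ? ? [].
  rewrite mulr_natl mulr2n; apply: lerD; rewrite ler_distl; exact/andP.
apply/eqP; rewrite -normr_eq0 rnormE; apply/eqP; congr (_%:C).
apply/eqP; rewrite eq_le rnorm_ge0 andbT; apply/ler_addgt0Pr => e e0; rewrite add0r.
have M1 : 0 < 1 + 16 * M by rewrite ltr_pwDl // mulr_ge0.
pose d := Num.min (1 / 2) (Num.min (d0 / 4) (e / (1 + 16 * M))).
have dp : 0 < d by rewrite /d !lt_min !divr_gt0.
have d3 : d <= e / (1 + 16 * M) by rewrite /d !ge_min lexx !orbT.
have d2 : d <= 1 / 2 by rewrite /d ge_min lexx.
have d4 : d <= d0 / 4 by rewrite /d !ge_min lexx !orbT.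
apply: le_trans (bound d dp d2 _) _; first by lra.
have -> : 4 * M * (x + d - (x - d) + (y + d - (y - d))) = 16 * M * d by ring.
apply: le_trans (_ : (1 + 16 * M) * d <= _); last by rewrite mulrC -ler_pdivlMr.
by rewrite ler_pM2r // lerDr.
Qed.

End Cauchy.

(** * Cauchy's formula and Taylor expansion on a square *)

Section Taylor.
Context (R : realType).
Local Notation C := R[i].
Local Open Scope complex_scope.
Implicit Types (f g : C -> C).

Local Notation sq := (rect (-1) 1 (-1) (1 : R)).
Local Notation bd := (rect_bd (-1) 1 (-1) (1 : R)).
Local Notation oint f := (rect_int f (-1) 1 (-1) (1 : R)).

Lemma bd_neq0 (w : C) : bd w -> w != 0.
Proof. by move=> /bd_norm; rewrite -normr_gt0; apply: lt_le_trans ltr01. Qed.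

Lemma bd_sub_neq0 (z w : C) : bd w -> `|z| <= (1 / 2)%:C -> w - z != 0.
Proof.
move=> bw z2; rewrite -normr_gt0.
by apply: lt_le_trans (bd_sub bw z2); exact: chalf_gt0.
Qed.

Lemma invX_cts k (w : C) : bd w -> {for w, continuous (fun w : C => w^-1 ^+ k)}.
Proof.
by move=> bw; apply: differentiable_continuous; apply: (@diff_invX C); exact: bd_neq0.
Qed.

Lemma inv_sub_cts (z w : C) : bd w -> `|z| <= (1 / 2)%:C ->
  {for w, continuous (fun w : C => (w - z)^-1)}.
Proof.
move=> bw z2; apply: differentiable_continuous.
apply: (@differentiableV _ _ (fun w => w - z)); last exact: bd_sub_neq0.
by apply: (@differentiableB _ _ _ id (cst z)).
Qed.

Lemma mul_cts f g (w : C) : {for w, continuous f} -> {for w, continuous g} ->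
  {for w, continuous (fun w => f w * g w)}.
Proof. exact: (@continuousM C C f g w). Qed.

(** These are the pieces of the Cauchy integral of [g] under the finite geometric expansion of 1/(w
    - z): the coefficient of z^k, not yet divided by [kappa], and the remainder, of which z^n is a
    separate factor. *)
Definition oint_coef g k := oint (fun w => g w * w^-1 ^+ k.+1).
Definition oint_rem g z n := oint (fun w => g w * (w^-1 ^+ n * (w - z)^-1)).

(** Integrate 1/(w^n (w - z)) = 1/w^(n+1) + z/(w^(n+1) (w - z)) against [g]. *)
Lemma oint_remS g (z : C) n : `|z| <= (1 / 2)%:C ->
  (forall w, bd w -> {for w, continuous g}) ->
  oint_rem g z n = oint_coef g n + z * oint_rem g z n.+1.
Proof.
move=> z2 cg.
have c1 w : bd w -> {for w, continuous (fun w => g w * w^-1 ^+ n.+1)}.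
  by move=> bw; apply: mul_cts; [exact: cg|exact: invX_cts].
have c2 w : bd w -> {for w, continuous (fun w => g w * (w^-1 ^+ n.+1 * (w - z)^-1))}.
  move=> bw; apply: mul_cts; first exact: cg.
  by apply: mul_cts; [exact: invX_cts|exact: inv_sub_cts].
have c3 w : bd w ->
   {for w, continuous (fun w => z * (g w * (w^-1 ^+ n.+1 * (w - z)^-1)))}.
  move=> bw; apply: (@mul_cts (fun _ => z)); last exact: c2.
  exact: cst_continuous.
rewrite /oint_coef /oint_rem -(rect_intZ z c2) -(rect_intD c1 c3).
apply: eq_rect_int => w bw; have w0 := bd_neq0 bw; have wz := bd_sub_neq0 bw z2.
move: (g w) => u; rewrite !exprS; move: (w^-1 ^+ n) => v.
by field; rewrite w0 wz.
Qed.

Lemma oint_expand g (z : C) n : `|z| <= (1 / 2)%:C ->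
  (forall w, bd w -> {for w, continuous g}) ->
  oint (fun w => g w * (w - z)^-1) =
  \sum_(k < n) oint_coef g k * z ^+ k + z ^+ n * oint_rem g z n.
Proof.
move=> z2 cg; elim: n => [|n IHn].
  rewrite big_ord0 add0r expr0 mul1r; apply: eq_rect_int => w _.
  by rewrite expr0 mul1r.
rewrite IHn (oint_remS n z2 cg) big_ord_recr /= exprSr.
by move: (\sum_(_ < _) _) (z ^+ n) (oint_coef g n) (oint_rem g z n.+1) => a b c d; ring.
Qed.

Lemma norm_invX k (w : C) : bd w -> `|w^-1 ^+ k| <= 1.
Proof.
move=> /bd_norm w1; rewrite normrX normfV exprn_ile1 // invr_le1 //.
  by rewrite unitfE gt_eqF // (lt_le_trans ltr01).
exact: lt_le_trans ltr01 w1.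
Qed.

(** The constant is the factor 4 of the contour bound times the half perimeter 4; powers of 1/w are
    at most 1 on the boundary. In the remainder bound the constant doubles because [w - z] has norm
    at least 1/2. *)
Lemma oint_coef_bound g k (M : R) : (forall w, bd w -> {for w, continuous g}) ->
  (forall w, bd w -> `|g w| <= M%:C) -> `|oint_coef g k| <= (16 * M)%:C.
Proof.
move=> cg gM; have -> : 16 * M = 4 * M * (1 - -1 + (1 - -1)) by ring.
apply: rect_int_bound; [lra|lra| |] => w bw.
  by apply: mul_cts; [exact: cg|exact: invX_cts].
by rewrite normrM -[leRHS]mulr1 ler_pM // ?norm_invX // gM.
Qed.

Lemma oint_rem_bound g n (z : C) (M : R) : `|z| <= (1 / 2)%:C ->
  (forall w, bd w -> {for w, continuous g}) ->
  (forall w, bd w -> `|g w| <= M%:C) -> `|oint_rem g z n| <= (32 * M)%:C.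
Proof.
move=> z2 cg gM; have -> : 32 * M = 4 * (M * 2) * (1 - -1 + (1 - -1)) by ring.
apply: rect_int_bound; [lra|lra| |] => w bw.
  apply: mul_cts; first exact: cg.
  by apply: mul_cts; [exact: invX_cts|exact: inv_sub_cts].
have -> : (M * 2)%:C = M%:C * ((1 / 2)%:C)^-1 :> C.
  by rewrite -fmorphV -rmorphM; congr (_%:C); rewrite div1r invrK.
rewrite normrM; apply: ler_pM => //; first exact: gM.
rewrite normrM -[leRHS]mul1r; apply: ler_pM => //; first exact: norm_invX.
rewrite normfV lef_pV2 ?posrE; first exact: bd_sub.
  by rewrite normr_gt0 bd_sub_neq0.
exact: chalf_gt0.
Qed.

Lemma le0_geometric (x K : R) : (forall n, x <= K * (1 / 2) ^+ n) -> x <= 0.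
Proof.
move=> H; rewrite leNgt; apply/negP => x0.
have K0 : 0 < K by have := H 0%N; rewrite expr0 mulr1; apply: lt_le_trans.
pose n := Num.bound (K / x).
have /= : K / x < n%:R by rewrite archi_boundP // divr_ge0 // ltW.
rewrite ltr_pdivrMr // ltNge => /negP; apply.
have := H n; rewrite expr_div_n expr1n mulrA mulr1 ler_pdivlMr ?exprn_gt0 //.
apply: le_trans; rewrite mulrC ler_pM2l // -natrX ler_nat.
exact: ltnW (ltn_expl _ _).
Qed.

(** The contour integral of 1/w, classically 2 pi i. Only [kappa_neq0] is proved about its value. *)
Definition kappa : C := oint_coef (cst 1) 0.

(** In the geometric expansion all terms beyond the first are integrals of w^(-k-2), which has a
    primitive, and the remainder is at most 32 / 2^n. *)
Lemma kappa_z (z : C) : `|z| <= (1 / 2)%:C -> oint (fun w => 1 * (w - z)^-1) = kappa.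
Proof.
move=> z2; apply/eqP; rewrite -subr_eq0 -normr_eq0 rnormE; apply/eqP; congr (_%:C).
have c1 w : bd w -> {for w, continuous (cst 1 : C -> C)} by move=> _; exact: cst_continuous.
apply/eqP; rewrite eq_le rnorm_ge0 andbT; apply: (@le0_geometric _ 32) => n.
apply: le_trans (_ : 32 * (1 / 2) ^+ n.+1 <= _); last first.
  by rewrite ler_pM2l // exprSr ger_pMr ?exprn_gt0 //; lra.
rewrite -lecR -rnormE (oint_expand n.+1 z2 c1) big_ord_recl expr0 mulr1.
rewrite big1 ?addr0 => [|k _]; last first.
  rewrite [X in X * _](_ : _ = 0) ?mul0r //.
  have dP w : bd w -> differentiable (fun w : C => - (k.+1%:R)^-1 * w^-1 ^+ k.+1) w /\
     'd (fun w : C => - (k.+1%:R)^-1 * w^-1 ^+ k.+1) w 1 = cst 1 w * w^-1 ^+ k.+2.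
    by move=> /bd_neq0 w0; rewrite /cst mul1r; exact: (@invX_prim C).
  apply: rect_int_prim dP; [lra|lra|move=> w bw].
  by apply: mul_cts; [exact: c1|exact: invX_cts].
rewrite /= addrC addKr normrM mulrC rmorphM; apply: ler_pM => //.
  rewrite -[32 in leRHS]mulr1; apply: oint_rem_bound => // w _.
  by rewrite normr1.
by rewrite normrX rmorphXn lerXn2r // nnegrE // ltW // chalf_gt0.
Qed.

(** Cauchy's formula: split f w as f z plus the increment, whose quotient by w - z integrates to 0
    by [rect_int_quot]. *)
Lemma kappa_f f (z : C) : `|z| <= (1 / 2)%:C ->
  (forall w, sq w -> differentiable f w) ->
  oint (fun w => f w * (w - z)^-1) = f z * kappa.
Proof.
move=> z2 df; have cf w : bd w -> {for w, continuous f}.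
  by move=> /bd_sq /df; exact: differentiable_continuous.
rewrite -(kappa_z z2) -rect_intZ; last first.
  move=> w bw; apply: (@mul_cts (cst 1)); first exact: cst_continuous.
  exact: inv_sub_cts.
rewrite -[RHS]add0r -(rect_int_quot z2 df) -rect_intD.
- apply: eq_rect_int => w _.
  by move: (f w) (f z) ((w - z)^-1) => a b c; ring.
- move=> w bw; apply: mul_cts; last exact: inv_sub_cts.
  by apply: (@continuousB _ _ _ f (cst (f z))); [exact: cf|exact: cst_continuous].
move=> w bw; apply: (@mul_cts (cst _)); first exact: cst_continuous.
apply: (@mul_cts (cst 1)); first exact: cst_continuous.
exact: inv_sub_cts.
Qed.

End Taylor.

Section Taylor2.
Context (R : realType).
Local Notation C := R[i].
Local Open Scope complex_scope.
Implicit Types (f g : C -> C).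

Local Notation sq := (rect (-1) 1 (-1) (1 : R)).
Local Notation bd := (rect_bd (-1) 1 (-1) (1 : R)).
Local Notation oint f := (rect_int f (-1) 1 (-1) (1 : R)).

Lemma rint_ge1 (h : R -> R) : {in `[-1, 1], continuous h} ->
  (forall x, -1 <= x <= 1 -> 1 / 2 <= h x) -> 1 <= rint (-1) 1 h.
Proof.
move=> ch hh; apply: le_trans (_ : rint (-1) 1 (cst (1 / 2 : R)) <= _).
  rewrite rint_cst; lra.
by apply: le_rint => // x _; exact: cst_continuous.
Qed.

Lemma invC_half (x y : R) : -1 <= x <= 1 -> y = 1 \/ y = -1 -> 1 / 2 <= 1 / (x ^+ 2 + y ^+ 2).
Proof.
move=> /andP[x1 x2] yE; have -> : y ^+ 2 = 1 by case: yE => ->; rewrite ?sqrrN expr1n.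
have x2' : x ^+ 2 <= 1 by nra.
have x0 : 0 <= x ^+ 2 by exact: sqr_ge0.
rewrite !div1r lef_pV2 ?posrE; lra.
Qed.

(** On every side the contribution to the imaginary part is the integral of 1/(1 + x^2), at least
    1/2, over a segment of length 2; so the imaginary part is at least 4. *)
Lemma kappa_neq0 : kappa R != 0.
Proof.
have E : kappa R = oint (fun w => w^-1).
  by apply: eq_rect_int => w _; rewrite mul1r expr1.
suff : 0 < complex.Im (kappa R).
  by case: (kappa R) => a b /= b0; apply/eqP => -[_ b1]; rewrite b1 ltxx in b0.
have cV w : bd w -> {for w, continuous (fun w : C => w^-1)}.
  move=> bw; apply: differentiable_continuous.
  by apply: (@differentiableV _ _ id) => //; exact: bd_neq0.
have [c1 c2 c3 c4] := rect_bd_cts cV.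
have -> : complex.Im (kappa R) =
   rint (-1) 1 (fun x => complex.Im (x +i* (-1))^-1) +
   rint (-1) 1 (fun x => complex.Re (1 +i* x)^-1) -
   rint (-1) 1 (fun x => complex.Im (x +i* 1)^-1) -
   rint (-1) 1 (fun x => complex.Re (-1 +i* x)^-1).
  rewrite E /rect_int /cint.
  by rewrite /= !mul0r !mul1r !add0r.
have N (h : R -> R) : {in `[-1, 1 : R], continuous h} -> - rint (-1) 1 h = rint (-1) 1 (fun x => -1 * h x).
  by move=> ch; rewrite (rintZ _ ch) mulN1r.
have cN (h : R -> R) : {in `[-1, 1 : R], continuous h} -> {in `[-1, 1 : R], continuous (fun x => -1 * h x)}.
  move=> ch x /ch cx; apply: (@continuousM R R (cst (-1)) h) => //.
  exact: cst_continuous.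
have {c1} d1 := Im_comp_cts c1; have {c2} d2 := Re_comp_cts c2.
have {c3} d3 := Im_comp_cts c3; have {c4} d4 := Re_comp_cts c4.
rewrite (N _ d3) (N _ d4).
have h1 : 1 <= rint (-1) 1 (fun x : R => complex.Im (x +i* (-1))^-1).
  apply: (rint_ge1 d1) => x xi /=; rewrite mulNr opprK.
  by apply: invC_half => //; right.
have h2 : 1 <= rint (-1) 1 (fun x : R => complex.Re (1 +i* x)^-1).
  apply: (rint_ge1 d2) => x xi /=; rewrite addrC.
  by apply: invC_half => //; left.
have h3 : 1 <= rint (-1) 1 (fun x : R => -1 * complex.Im (x +i* 1)^-1).
  apply: (rint_ge1 (cN _ d3)) => x xi /=.
  by rewrite mulN1r opprK; apply: invC_half => //; left.
have h4 : 1 <= rint (-1) 1 (fun x : R => -1 * complex.Re (-1 +i* x)^-1).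
  apply: (rint_ge1 (cN _ d4)) => x xi /=.
  by rewrite mulN1r mulNr opprK addrC; apply: invC_half => //; right.
lra.
Qed.

Lemma realCM (a b : R) : (a * b)%:C = a%:C * b%:C :> C.
Proof. exact: rmorphM. Qed.

Definition cauchy_coef f k : C := (kappa R)^-1 * oint_coef f k.

(** The larger of the constants 16 and 32 is taken, so that one constant serves both the
    coefficients and the remainder. *)
Definition cauchy_const : R := 32 * rnorm (kappa R)^-1.

Lemma cauchy_const_ge0 : 0 <= cauchy_const.
Proof. by rewrite mulr_ge0 // rnorm_ge0. Qed.

Lemma cauchy_coef_bound f k (M : R) :
  (forall w, sq w -> differentiable f w) ->
  (forall w, bd w -> `|f w| <= M%:C) -> `|cauchy_coef f k| <= (cauchy_const * M)%:C.
Proof.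
move=> df fM; have cf w : bd w -> {for w, continuous f}.
  by move=> /bd_sq /df; exact: differentiable_continuous.
have M0 : 0 <= M.
  have b1 : bd (1 +i* 1) by left; split; [apply/andP; split => /=; lra|right].
  by rewrite -ler0c; apply: le_trans (fM _ b1).
have -> : cauchy_const * M = rnorm (kappa R)^-1 * (32 * M) by rewrite /cauchy_const; ring.
rewrite normrM realCM; apply: ler_pM => //.
apply: le_trans (oint_coef_bound k cf fM) _; rewrite lecR ler_wpM2r //; lra.
Qed.

Theorem cauchy_taylor f n (z : C) (M : R) :
  (forall w, sq w -> differentiable f w) ->
  (forall w, bd w -> `|f w| <= M%:C) -> `|z| <= (1 / 2)%:C ->
  `|f z - \sum_(k < n) cauchy_coef f k * z ^+ k| <= (cauchy_const * M)%:C * `|z| ^+ n.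
Proof.
move=> df fM z2; have cf w : bd w -> {for w, continuous f}.
  by move=> /bd_sq /df; exact: differentiable_continuous.
have k0 := kappa_neq0.
have -> : f z - \sum_(k < n) cauchy_coef f k * z ^+ k =
    (kappa R)^-1 * (z ^+ n * oint_rem f z n).
  have -> : f z = (kappa R)^-1 * (f z * kappa R) by rewrite mulrC mulfK.
  have S : \sum_(k < n) cauchy_coef f k * z ^+ k =
      (kappa R)^-1 * \sum_(k < n) oint_coef f k * z ^+ k.
    by rewrite mulr_sumr; apply: eq_bigr => k _; rewrite -mulrA.
  by rewrite S -(kappa_f z2 df) (oint_expand n z2 cf) mulrDr addrAC subrr add0r.
have -> : cauchy_const * M = rnorm (kappa R)^-1 * (32 * M) by rewrite /cauchy_const; ring.
rewrite normrM realCM -mulrA; apply: ler_pM => //.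
rewrite normrM normrX mulrC ler_wpM2r ?exprn_ge0 //.
exact: oint_rem_bound.
Qed.

End Taylor2.

(** * Holomorphic functions on normed spaces *)

Section LineGeneric.
Context (K : numFieldType) (V : normedModType K).

Lemma diff_along (f : V -> K) p v (z : K) : differentiable f (p + z *: v) ->
  differentiable (fun z : K => f (p + z *: v)) z /\
  'd (fun z : K => f (p + z *: v)) z 1 = 'd f (p + z *: v) v.
Proof.
move=> df; apply: diff_scalar => e e0.
set q := p + z *: v in df *.
have v1 : 0 < 1 + `|v| by rewrite ltr_pwDl ?ltr01 ?normr_ge0.
have cv : (h *: v) @[h --> (0 : K)] --> (0 : V).
  have := @cvgZr_tmp K V K (nbhs (0 : K)) _ id 0 v (@cvg_id _ _); rewrite scale0r => E; exact: E.
have N : \forall h \near (0 : K), `|f (h *: v + q) - f q - 'd f q (h *: v)| <=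
    e / (1 + `|v|) * `|h *: v| by exact: (cv _ (diff_eps df (divr_gt0 e0 v1))).
apply: filterS N => h H.
have -> : p + (h + z) *: v = h *: v + q by rewrite scalerDl addrCA.
have -> : h * 'd f q v = 'd f q (h *: v) by rewrite linearZ.
apply: le_trans H _; rewrite normrZ mulrCA [leRHS]mulrC ler_wpM2l //.
by rewrite mulrAC ler_pdivrMr // ler_pM2l // lerDr ler01.
Qed.

End LineGeneric.

Section NormedSpace.
Context (R : realType).
Local Notation C := R[i].
Local Open Scope complex_scope.
Context (V : normedModType C).

Lemma realCD (a b : R) : (a + b)%:C = a%:C + b%:C :> C.
Proof. exact: rmorphD. Qed.

Definition vn (x : V) : R := complex.Re `|x|.

Lemma vnE x : `|x| = (vn x)%:C.
Proof. by have [] := ge0_Re (normr_ge0 x). Qed.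

Lemma vn_ge0 x : 0 <= vn x.
Proof. by have [] := ge0_Re (normr_ge0 x). Qed.

Lemma vnD (x y : V) : vn (x + y) <= vn x + vn y.
Proof. by rewrite -lecR realCD -!vnE; exact: ler_normD. Qed.

Lemma vnZ (k : C) (x : V) : vn (k *: x) = rnorm k * vn x.
Proof. by apply: complexI; rewrite realCM -!vnE normrZ rnormE. Qed.

Lemma vn0 : vn 0 = 0.
Proof. by rewrite /vn normr0. Qed.

Lemma near_vn (x0 : V) (P : V -> Prop) :
  (\forall x \near x0, P x) <-> exists2 r : R, 0 < r & forall x, vn (x - x0) < r -> P x.
Proof.
split=> [/nbhs_ballP[e /= /gt0_Re[-> e0] H]|[r r0 H]].
  exists (complex.Re e) => // x xr; apply: H.
  by rewrite -ball_normE /= distrC vnE ltcR.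
apply/nbhs_ballP; exists r%:C => /=; first by rewrite ltcR.
by move=> x; rewrite -ball_normE /= distrC vnE ltcR; exact: H.
Qed.

Lemma hol_bounded (f : V -> C) x0 : (\forall x \near x0, differentiable f x) ->
  exists r M : R, 0 < r /\
    forall x, vn (x - x0) < r -> differentiable f x /\ `|f x| <= M%:C.
Proof.
move=> H; have cf : {for x0, continuous f}.
  by apply: differentiable_continuous; exact: nbhs_singleton H.
have /cvgrPdist_le /(_ 1 ltr01) H2 : f @ x0 --> f x0 by exact: cf.
have /near_vn[r r0 Hr] : \forall x \near x0, differentiable f x /\ `|f x0 - f x| <= 1.
  by near=> x; split; near: x.
exists r, (1 + rnorm (f x0)); split; first exact: r0.
move=> x /Hr[df fx]; split; first exact: df.
rewrite realCD -(subrK (f x0) (f x)); apply: le_trans (ler_normD _ _) _.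
apply: lerD; first by rewrite distrC.
by rewrite rnormE.
Unshelve. all: by end_near. Qed.

End NormedSpace.

Section Holomorphic.
Context (R : realType).
Local Notation C := R[i].
Local Open Scope complex_scope.
Context (V : normedModType C).
Implicit Types (f : V -> C).

Local Notation sq := (rect (-1) 1 (-1) (1 : R)).
Local Notation bd := (rect_bd (-1) 1 (-1) (1 : R)).

Lemma sq_norm (w : C) : sq w -> rnorm w <= 2.
Proof.
move=> [/andP[w1 w2] /andP[w3 w4]].
rewrite -lecR -rnormE; apply: le_trans (norm_ReIm _) _; rewrite lecR.
by rewrite -[2]/(1 + 1) lerD // ler_norml ?w1 ?w3.
Qed.

(** The expansion with one term, evaluated at 0, gives the value; the expansion with two terms has a
    quadratic error, which identifies the derivative. *)
Lemma cauchy_coef0 (g : C -> C) : (forall w, sq w -> differentiable g w) ->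
  (exists M : R, forall w, bd w -> `|g w| <= M%:C) ->
  cauchy_coef g 0 = g 0 /\ cauchy_coef g 1 = 'd g 0 1.
Proof.
move=> dg [M gM].
have z0 : `|0 : C| <= (1 / 2)%:C by rewrite normr0 ltW // chalf_gt0.
have E0 : cauchy_coef g 0 = g 0.
  have := cauchy_taylor 1 dg gM z0.
  rewrite big_ord_recl big_ord0 addr0 expr0 mulr1 normr0 expr1 mulr0.
  by rewrite normr_le0 subr_eq0 => /eqP.
split=> //; apply/esym.
have K0 : 0 <= (cauchy_const R * M)%:C :> C.
  have b1 : bd (1 +i* 1) by left; split; [apply/andP; split => /=; lra|right].
  rewrite ler0c mulr_ge0 ?cauchy_const_ge0 //.
  by rewrite -ler0c; apply: le_trans (gM _ b1).
have K1 : 0 < 1 + (cauchy_const R * M)%:C :> C by rewrite ltr_pwDl ?ltr01.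
apply: (@diff_scalar C g 0 _ _).2 => e e0.
have : \forall h \near (0 : C), `|h| <= (1 / 2)%:C /\ `|h| <= e / (1 + (cauchy_const R * M)%:C).
  near=> h; split; near: h; apply: (@nbhs0_le C C^o); first exact: chalf_gt0.
  exact: divr_gt0.
apply: filterS => h [h2 he].
have := cauchy_taylor 2 dg gM h2.
rewrite big_ord_recl big_ord1 /= expr0 mulr1 expr1 E0 addr0 => H.
have -> : g h - g 0 - h * cauchy_coef g 1 = g h - (g 0 + cauchy_coef g 1 * h).
  by rewrite opprD addrA [h * _]mulrC.
apply: le_trans H _; rewrite expr2 mulrA ler_wpM2r //.
apply: le_trans (ler_wpM2l K0 he) _.
by rewrite mulrCA ger_pMr // ler_pdivrMr // mul1r lerDr ler01.
Unshelve. all: by end_near. Qed.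

End Holomorphic.

Section HolomorphicBall.
Context (R : realType).
Local Notation C := R[i].
Local Open Scope complex_scope.
Context (V : normedModType C) (f : V -> C) (x0 : V) (r M : R) (r0 : 0 < r).
Context (Hf : forall x, vn (x - x0) < r -> differentiable f x /\ `|f x| <= M%:C).

Local Notation sq := (rect (-1) 1 (-1) (1 : R)).
Local Notation bd := (rect_bd (-1) 1 (-1) (1 : R)).
Local Notation K := (cauchy_const R).

Lemma ball_bound_ge0 : 0 <= M.
Proof.
by rewrite -ler0c; apply: le_trans (Hf (x := x0) _).2; rewrite // subrr vn0.
Qed.

Lemma line_in_ball p w (z : C) : vn (p - x0) + 2 * vn w < r -> rnorm z <= 2 ->
  vn (p + z *: w - x0) < r.
Proof.
move=> pw z2; apply: le_lt_trans pw; rewrite addrAC.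
apply: le_trans (vnD _ _) _; by rewrite lerD2l vnZ; apply: ler_wpM2r; first exact: vn_ge0.
Qed.

Lemma line_diff p w z : vn (p - x0) + 2 * vn w < r -> sq z ->
  differentiable (fun z : C => f (p + z *: w)) z /\
  'd (fun z : C => f (p + z *: w)) z 1 = 'd f (p + z *: w) w.
Proof.
move=> pw /sq_norm z2; apply: (@diff_along C V f).
by have [] := Hf (line_in_ball pw z2).
Qed.

Lemma line_bound p w z : vn (p - x0) + 2 * vn w < r -> sq z ->
  `|f (p + z *: w)| <= M%:C.
Proof. by move=> pw /sq_norm z2; have [] := Hf (line_in_ball pw z2). Qed.

(** One-variable Cauchy theory on the line p + z w. Points of the square have norm at most 2, which
    explains the term [2 * vn w] in the hypothesis. *)
Lemma line_coef p w : vn (p - x0) + 2 * vn w < r ->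
  [/\ cauchy_coef (fun z : C => f (p + z *: w)) 0 = f p,
      cauchy_coef (fun z : C => f (p + z *: w)) 1 = 'd f p w &
      `|'d f p w| <= (K * M)%:C].
Proof.
move=> pw.
have dg z (sz : sq z) := (line_diff pw sz).1.
have gM z (bz : bd z) := line_bound pw (bd_sq bz).
have [E0 E1] := cauchy_coef0 dg (ex_intro _ M gM).
have s0 : sq 0 by split; apply/andP; split => /=; lra.
have D1 : 'd (fun z : C => f (p + z *: w)) 0 1 = 'd f p w.
  by rewrite (line_diff pw s0).2 scale0r addr0.
split; first by rewrite E0 scale0r addr0.
  by rewrite E1.
by rewrite -D1 -E1; exact: cauchy_coef_bound.
Qed.

Lemma line_taylor2 p w (t : C) : vn (p - x0) + 2 * vn w < r -> `|t| <= (1 / 2)%:C ->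
  `|f (p + t *: w) - f p - t * 'd f p w| <= (K * M)%:C * `|t| ^+ 2.
Proof.
move=> pw t2.
have dg z (sz : sq z) := (line_diff pw sz).1.
have gM z (bz : bd z) := line_bound pw (bd_sq bz).
have [E0 E1 _] := line_coef pw.
have := cauchy_taylor 2 dg gM t2.
rewrite big_ord_recl big_ord1 /= expr0 mulr1 expr1 E0 E1.
by rewrite opprD addrA [t * _]mulrC.
Qed.

Lemma vn_eq0 (x : V) : vn x = 0 -> x = 0.
Proof. by move=> E; apply/eqP; rewrite -normr_eq0 vnE E. Qed.

(** The direction is rescaled to length r/8 so that a line through a point within r/2 of the centre
    stays in the ball on the whole square. Then t is at most 1/2 exactly when h is at most r/16. *)
Lemma scale_split (h : V) : h != 0 ->
  exists (w : V) (t : R), [/\ h = t%:C *: w, vn w = r / 8 & t = vn h * 8 / r].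
Proof.
move=> h0; exists ((r / 8 / vn h)%:C *: h), (vn h * 8 / r); have v0 : vn h != 0 by apply: contra_neq h0; exact: vn_eq0.
have r1 : r != 0 by rewrite gt_eqF.
rewrite scalerA -realCM; split=> //.
  rewrite (_ : _ * _ = 1) ?scale1r //; by field; rewrite v0 r1.
rewrite vnZ /rnorm normC_real /= ger0_norm ?divfK //.
by rewrite !divr_ge0 ?vn_ge0 // ltW.
Qed.

(** With t = 8 |h| / r, these are the constants that turn [K * M * t] and [K * M * t ^+ 2] into
    multiples of |h| and of its square. *)
Definition lip1 : R := K * M * 8 / r.
Definition lip2 : R := K * M * 64 / r ^+ 2.

Lemma KM_ge0 : 0 <= K * M.
Proof. by rewrite mulr_ge0 ?cauchy_const_ge0 ?ball_bound_ge0. Qed.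

Lemma lip1_ge0 : 0 <= lip1.
Proof. apply: divr_ge0; last exact: ltW.
by apply: mulr_ge0; first exact: KM_ge0. Qed.

Lemma lip2_ge0 : 0 <= lip2.
Proof. apply: divr_ge0; last by rewrite exprn_ge0 // ltW.
by apply: mulr_ge0; first exact: KM_ge0. Qed.

Fact close_sum (a b : R) : a <= r / 2 -> b = r / 8 -> a + 2 * b < r.
Proof. by move=> ? ->; move: r0; lra. Qed.

Lemma diff_bound p h : vn (p - x0) <= r / 2 -> `|'d f p h| <= (lip1 * vn h)%:C.
Proof.
move=> pr; have [->|h0] := eqVneq h 0; first by rewrite linear0 normr0 vn0 mulr0.
have [w [t [hE wr tE]]] := scale_split h0.
have [_ _ B] := line_coef (close_sum pr wr).
have t0 : 0 <= t by rewrite tE !mulr_ge0 ?vn_ge0 // invr_ge0 ltW.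
have -> : 'd f p h = t%:C * 'd f p w by rewrite [in LHS]hE linearZ.
have -> : lip1 * vn h = t * (K * M) by rewrite /lip1 tE; ring.
rewrite (realCM t) normrM normC_real (ger0_norm t0); apply: ler_wpM2l => //.
by rewrite ler0c.
Qed.

Lemma taylor2 p h : vn (p - x0) <= r / 2 -> vn h <= r / 16 ->
  `|f (p + h) - f p - 'd f p h| <= (lip2 * vn h ^+ 2)%:C.
Proof.
move=> pr hr; have [->|h0] := eqVneq h 0.
  by rewrite linear0 addr0 subrr subr0 normr0 vn0 expr0n mulr0.
have [w [t [hE wr tE]]] := scale_split h0.
have t0 : 0 <= t by rewrite tE !mulr_ge0 ?vn_ge0 // invr_ge0 ltW.
have tn : `|t%:C| = t%:C :> C by rewrite normC_real (ger0_norm t0).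
have t2 : `|t%:C| <= (1 / 2)%:C :> C.
  rewrite tn lecR tE ler_pdivrMr //; move: hr; lra.
have := line_taylor2 (close_sum pr wr) t2.
rewrite -hE; have -> : t%:C * 'd f p w = 'd f p h by rewrite [in RHS]hE linearZ.
move=> H; apply: le_trans H _; rewrite tn -rmorphXn -realCM lecR /=.
have r1 : r != 0 by rewrite gt_eqF.
suff -> : lip2 * vn h ^+ 2 = K * M * t ^+ 2 by [].
by rewrite /lip2 tE; field.
Qed.

(** The quadratic error is absorbed into a linear one because increments are at most r/16. *)
Definition lip : R := lip1 + lip2 * (r / 16).

Lemma lip_ge0 : 0 <= lip.
Proof. by rewrite addr_ge0 ?lip1_ge0 // mulr_ge0 ?lip2_ge0 // divr_ge0 // ltW. Qed.

Lemma hol_lipschitz p h : vn (p - x0) <= r / 2 -> vn h <= r / 16 ->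
  `|f (p + h) - f p| <= (lip * vn h)%:C.
Proof.
move=> pr hr; rewrite -(subrK ('d f p h) (f (p + h) - f p)).
apply: le_trans (ler_normD _ _) _.
have -> : lip * vn h = lip2 * (r / 16) * vn h + lip1 * vn h by rewrite /lip; ring.
rewrite realCD; apply: lerD; last exact: diff_bound.
apply: le_trans (taylor2 pr hr) _; rewrite lecR expr2 mulrA ler_wpM2r ?vn_ge0 //.
by rewrite ler_wpM2l ?lip2_ge0.
Qed.

End HolomorphicBall.

Section GenericContinuity.
Context (K : numFieldType) (V W : normedModType K).

Lemma lipschitz_cts (g : V -> W) (x : V) (c : K) : 0 <= c ->
  (\forall y \near x, `|g x - g y| <= c * `|x - y|) -> {for x, continuous g}.
Proof.
move=> c0 H.
suff : g @ x --> g x by [].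
apply/(@cvgrPdist_le _ _ _ (nbhs x)) => e e0.
have c1 : 0 < 1 + c by rewrite ltr_pwDl ?ltr01.
have /cvgrPdist_le /(_ _ (divr_gt0 e0 c1)) N : (fun y : V => y) @ x --> x by exact: cvg_id.
near=> y.
have h1 : `|g x - g y| <= c * `|x - y| by near: y.
have h2 : `|x - y| <= e / (1 + c) by near: y; exact: N.
apply: le_trans h1 _; apply: le_trans (ler_wpM2l c0 h2) _.
by rewrite mulrCA ger_pMr // ler_pdivrMr // mul1r lerDr ler01.
Unshelve. all: by end_near. Qed.

Lemma linear_bound_cts (L : {linear V -> W}) (c : K) : 0 <= c ->
  (forall h, `|L h| <= c * `|h|) -> continuous L.
Proof.
move=> c0 H x; apply: (@lipschitz_cts _ _ c c0).
by near=> y; rewrite -linearB; exact: H.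
Unshelve. all: by end_near. Qed.

Lemma quadratic_diff (g : V -> W) (x : V) (L : {linear V -> W}) (c : K) : 0 <= c ->
  continuous L ->
  (\forall h \near (0 : V), `|g (h + x) - g x - L h| <= c * `|h| ^+ 2) ->
  differentiable g x.
Proof.
move=> c0 cL H; apply: (@diff_of_eps _ _ _ g x L cL _).1 => e e0.
have c1 : 0 < 1 + c by rewrite ltr_pwDl ?ltr01.
near=> h.
have h1 : `|g (h + x) - g x - L h| <= c * `|h| ^+ 2 by near: h.
have h2 : `|h| <= e / (1 + c) by near: h; apply: nbhs0_le; exact: divr_gt0.
apply: le_trans h1 _; rewrite expr2 mulrA ler_wpM2r //.
apply: le_trans (ler_wpM2l c0 h2) _.
by rewrite mulrCA ger_pMr // ler_pdivrMr // mul1r lerDr ler01.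
Unshelve. all: by end_near. Qed.

End GenericContinuity.

Lemma affine_line_cts (K : numFieldType) (V : normedModType K) (p v : V) (z : K) : {for z, continuous (fun z : K => p + z *: v)}.
Proof.
apply: (@lipschitz_cts K K V _ z `|v|) => //; near=> y.
by rewrite opprD addrACA subrr add0r -scalerBl normrZ mulrC.
Unshelve. all: by end_near. Qed.

Section CauchyCoefLinear.
Context (R : realType).
Local Notation C := R[i].
Local Open Scope complex_scope.
Implicit Types (f g : C -> C).
Local Notation bd := (rect_bd (-1) 1 (-1) (1 : R)).
Local Notation K := (cauchy_const R).

Let kernel_cts f k w : bd w -> {for w, continuous f} ->
  {for w, continuous (fun w : C => f w * w^-1 ^+ k.+1)}.
Proof. by move=> bw cf; exact: (mul_cts cf (invX_cts (k := k.+1) bw)). Qed.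

Lemma cauchy_coef_lin (a : C) f g k : (forall w, bd w -> {for w, continuous f}) ->
  (forall w, bd w -> {for w, continuous g}) ->
  cauchy_coef (fun w => a * f w + g w) k = a * cauchy_coef f k + cauchy_coef g k.
Proof.
move=> cf cg; rewrite /cauchy_coef /oint_coef.
have cf' w (bw : bd w) := kernel_cts (k := k) bw (cf w bw).
have cg' w (bw : bd w) := kernel_cts (k := k) bw (cg w bw).
have caf w (bw : bd w) : {for w, continuous (fun w : C => a * (f w * w^-1 ^+ k.+1))}.
  exact: (@mul_cts R (cst a) _ w (@cst_continuous _ _ a w) (cf' w bw)).
rewrite mulrCA -mulrDr -(rect_intZ a cf') -(rect_intD caf cg'); congr (_ * _).
by apply: eq_rect_int => w _; rewrite mulrDl mulrA.
Qed.

Lemma cauchy_coefB f g k : (forall w, bd w -> {for w, continuous f}) ->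
  (forall w, bd w -> {for w, continuous g}) ->
  cauchy_coef (fun w => f w - g w) k = cauchy_coef f k - cauchy_coef g k.
Proof.
move=> cf cg.
have E : (fun w => f w - g w) = (fun w => -1 * g w + f w).
  by apply/funext => w; rewrite mulN1r [LHS]addrC.
rewrite E (cauchy_coef_lin (-1) k cg cf).
by rewrite mulN1r [LHS]addrC.
Qed.

Lemma cauchy_coef_bound_cts f k (M : R) : (forall w, bd w -> {for w, continuous f}) ->
  (forall w, bd w -> `|f w| <= M%:C) -> `|cauchy_coef f k| <= (K * M)%:C.
Proof.
move=> cf fM.
have M0 : 0 <= M.
  have b1 : bd (1 +i* 1) by left; split; [apply/andP; split => /=; lra|right].
  by rewrite -ler0c; apply: le_trans (fM _ b1).
have -> : K * M = rnorm (kappa R)^-1 * (32 * M) by rewrite /cauchy_const; ring.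
rewrite normrM (realCM (rnorm _)); apply: ler_pM => //.
apply: le_trans (oint_coef_bound k cf fM) _; rewrite lecR ler_wpM2r //; lra.
Qed.

End CauchyCoefLinear.

(** * Derivatives of holomorphic functions are holomorphic *)

Section DerivativeHolomorphic.
Context (R : realType).
Local Notation C := R[i].
Local Open Scope complex_scope.
Context (V : normedModType C).
Local Notation sq := (rect (-1) 1 (-1) (1 : R)).
Local Notation bd := (rect_bd (-1) 1 (-1) (1 : R)).
Local Notation K := (cauchy_const R).

Lemma small_multiple (r : R) (h : V) : 0 < r ->
  exists (k : C) (h' : V), h = k *: h' /\ vn h' <= r / 16.
Proof.
move=> r0; pose k : R := vn h * 16 / r + 1.
have k0 : 0 < k by rewrite ltr_wpDl // divr_ge0 ?mulr_ge0 ?vn_ge0 // ltW.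
exists k%:C, ((k^-1)%:C *: h); split.
  by rewrite scalerA -realCM mulfV ?scale1r // gt_eqF.
have ki : `|k^-1| = k^-1 by rewrite ger0_norm // invr_ge0 ltW.
rewrite vnZ /rnorm normC_real /= ki [k^-1 * _]mulrC ler_pdivrMr //.
have -> : r / 16 * k = vn h + r / 16 by rewrite /k; field; rewrite gt_eqF.
by rewrite lerDl divr_ge0 // ltW.
Qed.

Context (f : V -> C) (x0 : V) (r M : R) (r0 : 0 < r).
Context (Hf : forall x, vn (x - x0) < r -> differentiable f x /\ `|f x| <= M%:C).
Local Notation lip := (lip r M).
Local Notation lip1 := (lip1 r M).
Local Notation lip2 := (lip2 r M).

Lemma line_shift (p v : V) (z : C) : rnorm z <= 2 -> vn v <= r / 16 ->
  vn (p + z *: v - x0) <= vn (p - x0) + r / 8.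
Proof.
move=> z2 vr; rewrite addrAC; apply: le_trans (vnD _ _) _; rewrite lerD2l vnZ.
apply: le_trans (_ : 2 * (r / 16) <= _); last by lra.
by apply: ler_pM => //; [exact: rnorm_ge0|exact: vn_ge0].
Qed.

Lemma line_fun_cts (p v : V) : vn (p - x0) <= r / 4 -> vn v <= r / 16 ->
  forall w, bd w -> {for w, continuous (fun z : C => f (p + z *: v))}.
Proof.
move=> pr vr w bw; apply: (@continuous_comp _ _ _ (fun z : C => p + z *: v) f).
  exact: (@affine_line_cts C V).
apply: differentiable_continuous; apply: (Hf _).1.
apply: le_lt_trans (line_shift _ (sq_norm (bd_sq bw)) vr) _.
by move: r0 pr; lra.
Qed.

(** The derivative becomes a contour integral of values of f, so its dependence on p can be studied
    under the integral sign. *)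
Lemma deriv_coef (p v : V) : vn (p - x0) <= r / 4 -> vn v <= r / 16 ->
  cauchy_coef (fun z : C => f (p + z *: v)) 1 = 'd f p v.
Proof.
by move=> pr vr; have [] := line_coef Hf (_ : vn (p - x0) + 2 * vn v < r);
  [move: r0; lra|].
Qed.

(** The difference of derivatives at two points is a Cauchy coefficient of a difference of values of
    f, and f is Lipschitz. *)
Lemma deriv_cts (h x1 : V) : vn (x1 - x0) <= r / 8 ->
  {for x1, continuous (fun x => 'd f x h)}.
Proof.
move=> xr; have [k [h' [-> hr]]] := small_multiple h r0.
have -> : (fun x => 'd f x (k *: h')) = (fun x => k * 'd f x h').
  by apply/funext => x; rewrite linearZ.
apply: (@continuousM C V (cst k)); first exact: cst_continuous.
have Kl : 0 <= K * lip by rewrite mulr_ge0 ?cauchy_const_ge0 // (lip_ge0 r0 Hf).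
apply: (@lipschitz_cts C V C _ x1 (K * lip)%:C); first by rewrite ler0c.
apply/near_vn; exists (r / 16); first by rewrite divr_gt0.
move=> x xx1.
have xr' : vn (x - x0) <= r / 4.
  rewrite -(subrK x1 x) -addrA; apply: le_trans (vnD _ _) _.
  by move: xx1 xr r0; lra.
have x1r : vn (x1 - x0) <= r / 4 by move: xr r0; lra.
rewrite -(deriv_coef xr' hr) -(deriv_coef x1r hr) distrC -cauchy_coefB; last 2 first.
- exact: line_fun_cts.
- exact: line_fun_cts.
have -> : (K * lip)%:C * `|x1 - x| = (K * (lip * vn (x - x1)))%:C.
  by rewrite distrC vnE -realCM mulrA.
apply: cauchy_coef_bound_cts => w bw.
  exact: (continuousB (line_fun_cts xr' hr bw) (line_fun_cts x1r hr bw)).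
have -> : x + w *: h' = (x1 + w *: h') + (x - x1) by rewrite [RHS]addrC [RHS]addrA subrK.
apply: (hol_lipschitz r0 Hf); last exact: ltW.
apply: le_trans (line_shift _ (sq_norm (bd_sq bw)) hr) _.
by move: r0 xr; lra.
Qed.

(** Differentiation under the integral sign. [taylor2] bounds the first-order error of f by a
    multiple of |h|^2 uniformly on the contour, and the Cauchy coefficient preserves this bound. *)
Lemma deriv_diff_small (v : V) : vn v <= r / 16 ->
  differentiable (fun x => 'd f x v) x0.
Proof.
move=> vr.
(* The candidate differential in h: the same contour integral with f replaced by its derivative in
   direction h. It is linear since the Cauchy coefficient is; this needs [deriv_cts] for
   integrability. *)
pose B (h : V) := cauchy_coef (fun z : C => 'd f (x0 + z *: v) h) 1.
have x00 : vn (x0 - x0) = 0 by rewrite subrr vn0.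
have x0r : vn (x0 - x0) <= r / 4 by rewrite x00 divr_ge0 // ltW.
have pr (w : C) : bd w -> vn (x0 + w *: v - x0) <= r / 8.
  move=> bw; apply: le_trans (line_shift _ (sq_norm (bd_sq bw)) vr) _.
  by rewrite x00 add0r.
have pr2 (w : C) : bd w -> vn (x0 + w *: v - x0) <= r / 2.
  by move=> /pr; move: r0; lra.
have cB h w : bd w -> {for w, continuous (fun z : C => 'd f (x0 + z *: v) h)}.
  move=> bw; apply: (@continuous_comp _ _ _ (fun z : C => x0 + z *: v) (fun x => 'd f x h)).
    exact: (@affine_line_cts C V).
  by apply: deriv_cts; exact: pr.
have lin : linear B.
  move=> a u w.
  have E : (fun z : C => 'd f (x0 + z *: v) (a *: u + w)) =
      (fun z : C => a * 'd f (x0 + z *: v) u + 'd f (x0 + z *: v) w).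
    by apply/funext => z; rewrite linearP.
  rewrite /B E; exact: (cauchy_coef_lin a 1 (cB u) (cB w)).
pose LM := GRing.isLinear.Build _ _ _ _ _ lin.
pose L : {linear V -> C} := HB.pack B LM.
have K0 : 0 <= K by exact: cauchy_const_ge0.
have cL : continuous L.
  apply: (@linear_bound_cts C V C L (K * lip1)%:C).
    by rewrite ler0c mulr_ge0 // (lip1_ge0 r0 Hf).
  move=> h; have -> : (K * lip1)%:C * `|h| = (K * (lip1 * vn h))%:C.
    by rewrite vnE -realCM mulrA.
  apply: cauchy_coef_bound_cts; first exact: cB.
  by move=> w bw; apply: (diff_bound r0 Hf); exact: pr2.
apply: (@quadratic_diff C V C _ x0 L (K * lip2)%:C) => //.
  by rewrite ler0c mulr_ge0 // (lip2_ge0 r0 Hf).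
apply/near_vn; exists (r / 16); first by rewrite divr_gt0.
move=> h; rewrite subr0 => hr.
have hr' : vn (h + x0 - x0) <= r / 4 by rewrite addrK; move: hr r0; lra.
rewrite -(deriv_coef hr' vr) -(deriv_coef x0r vr).
have -> : (K * lip2)%:C * `|h| ^+ 2 = (K * (lip2 * vn h ^+ 2))%:C.
  by rewrite vnE -rmorphXn -realCM mulrA.
have c1 := line_fun_cts hr' vr; have c2 := line_fun_cts x0r vr.
have c12 w : bd w -> {for w, continuous
    (fun z : C => f (h + x0 + z *: v) - f (x0 + z *: v))}.
  by move=> bw; exact: (continuousB (c1 w bw) (c2 w bw)).
rewrite -(cauchy_coefB 1 c1 c2) /L /= /B -(cauchy_coefB 1 c12 (cB h)).
apply: cauchy_coef_bound_cts => w bw.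
  exact: (continuousB (c12 w bw) (cB h w bw)).
have -> : h + x0 + w *: v = (x0 + w *: v) + h by rewrite -addrA addrC.
by apply: (taylor2 r0 Hf); [exact: pr2|exact: ltW].
Qed.

End DerivativeHolomorphic.

Section DerivativeHolomorphic2.
Context (R : realType).
Local Notation C := R[i].
Context (V : normedModType C).

Lemma deriv_differentiable (f : V -> C) (x0 v : V) :
  (\forall x \near x0, differentiable f x) ->
  differentiable (fun x => 'd f x v) x0.
Proof.
move=> /hol_bounded[r [M [r0 Hf]]].
have [k [v' [-> vr]]] := small_multiple v r0.
have -> : (fun x => 'd f x (k *: v')) = k *: (fun x => 'd f x v').
  by apply/funext => x; rewrite linearZ.
by apply: differentiableZ; exact: (deriv_diff_small r0 Hf).
Qed.

Lemma deriv_near_differentiable (f : V -> C) (x0 v : V) :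
  (\forall x \near x0, differentiable f x) ->
  \forall x \near x0, differentiable (fun x => 'd f x v) x.
Proof.
by move=> /near_join; apply: filterS => x; exact: deriv_differentiable.
Qed.

End DerivativeHolomorphic2.

(** * The identity theorem on the anti-diagonal *)

Section IdentityTheorem.
Context (R : realType).
Local Notation C := R[i].
Local Open Scope complex_scope.
Local Notation sq := (rect (-1) 1 (-1) (1 : R)).
Local Notation bd := (rect_bd (-1) 1 (-1) (1 : R)).
Local Notation K := (cauchy_const R).

Lemma rnormM (a b : C) : rnorm (a * b) = rnorm a * rnorm b.
Proof. by apply: complexI; rewrite realCM -!rnormE normrM. Qed.

Lemma realCX (x : R) n : (x ^+ n)%:C = x%:C ^+ n :> C.
Proof. exact: rmorphXn. Qed.

Lemma rnorm_real (x : R) : rnorm x%:C = `|x|.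
Proof. by rewrite /rnorm normC_real. Qed.

Fact le_small_mul (u k : R) : 0 <= k ->
  (forall x, 0 < x -> x <= 1 / 2 -> u <= k * x) -> u <= 0.
Proof.
move=> k0 H; rewrite leNgt; apply/negP => u0.
have k1 : 0 < 1 + k by lra.
have x0 : 0 < Num.min (1 / 2) (u / (1 + k)) by rewrite lt_min !divr_gt0.
have := H _ x0; rewrite ge_min lexx => /(_ isT).
apply/negP; rewrite -ltNge; apply: le_lt_trans (_ : k * (u / (1 + k)) < _).
  by rewrite ler_wpM2l // ge_min lexx orbT.
by rewrite mulrA ltr_pdivrMr // mulrC ltr_pM2l // ltrDr.
Qed.

(** If all earlier coefficients vanish, the Taylor estimate at real x gives |c_k| x^k <= K M
    x^(k+1), hence |c_k| <= K M x for all small x. With every coefficient 0, the remainder K M / 2^n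
    forces the value 0. *)
Lemma real_zeros_unit (g : C -> C) (M : R) :
  (forall w, sq w -> differentiable g w) -> (forall w, sq w -> `|g w| <= M%:C) ->
  (forall x : R, 0 < x -> x <= 1 / 2 -> g x%:C = 0) ->
  forall z, `|z| <= (1 / 2)%:C -> g z = 0.
Proof.
move=> dg gM g0 z z2.
have gM' w (bw : bd w) := gM w (bd_sq bw).
have M0 : 0 <= M.
  have s0 : sq 0 by split; apply/andP; split => /=; lra.
  by rewrite -ler0c; apply: le_trans (gM _ s0).
have KM0 : 0 <= K * M by rewrite mulr_ge0 ?cauchy_const_ge0.
have c0 k : cauchy_coef g k = 0.
  elim/ltn_ind: k => k IHk; apply/eqP; rewrite -normr_eq0 rnormE.
  apply/eqP; congr (_%:C); apply/eqP; rewrite eq_le rnorm_ge0 andbT.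
  apply: (le_small_mul KM0) => x x0 x2.
  have xn : `|x%:C| = x%:C :> C by rewrite normC_real ger0_norm // ltW.
  have x2' : `|x%:C| <= (1 / 2)%:C :> C by rewrite xn lecR.
  have := cauchy_taylor k.+1 dg gM' x2'.
  rewrite (g0 x x0 x2) big_ord_recr /= big1 => [|j _]; last by rewrite IHk ?mul0r.
  rewrite sub0r add0r normrN normrM normrX xn rnormE -!realCX -!realCM lecR.
  by rewrite exprS [leRHS]mulrA ler_pM2r ?exprn_gt0.
apply/eqP; rewrite -normr_eq0 rnormE; apply/eqP; congr (_%:C); apply/eqP.
rewrite eq_le rnorm_ge0 andbT; apply: (@le0_geometric _ _ (K * M)) => n.
have := cauchy_taylor n dg gM' z2.
rewrite big1 => [|j _]; last by rewrite c0 mul0r.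
rewrite subr0 rnormE => H; rewrite -lecR; apply: le_trans H _.
rewrite (realCM (K * M)); apply: ler_wpM2l; first by rewrite ler0c.
rewrite rmorphXn; apply: lerXn2r; rewrite ?nnegrE //.
by rewrite ltW // chalf_gt0.
Qed.

Lemma real_zeros (g : C -> C) (r M : R) : 0 < r ->
  (forall z, rnorm z < r -> differentiable g z /\ `|g z| <= M%:C) ->
  (forall x : R, `|x| < r -> g x%:C = 0) ->
  forall z, rnorm z <= r / 8 -> g z = 0.
Proof.
(* Scaling by r/4 maps the square, of norm at most 2, into the disc of radius r, and the points with
   |z| <= r/8 come from |z| <= 1/2. *)
move=> r0 Hg g0 z zr; pose k : C := (r / 4)%:C.
have k0 : k != 0 by rewrite -(rmorph0 (real_complex R)) (inj_eq (@complexI R)) gt_eqF ?divr_gt0.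
have kr : rnorm k = r / 4 by rewrite rnorm_real ger0_norm // divr_ge0 // ltW.
have zE : z = 0 + z / k *: k by rewrite add0r -[_ *: k]/(z / k * k) divfK.
have in_r w : sq w -> rnorm (0 + w *: k) < r.
  move=> /sq_norm w2; rewrite add0r rnormM kr.
  apply: le_lt_trans (_ : 2 * (r / 4) < _); last by lra.
  by rewrite ler_wpM2r // divr_ge0 // ltW.
rewrite zE; apply: (@real_zeros_unit (fun w => g (0 + w *: k)) M).
- by move=> w sw; apply: (diff_along _).1; have [] := Hg _ (in_r w sw).
- by move=> w sw; have [] := Hg _ (in_r w sw).
- move=> x x0 x2; rewrite add0r -[_ *: k]/(x%:C * k) -realCM; apply: g0.
  rewrite ger0_norm ?mulr_ge0 ?divr_ge0 // ?ltW //.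
  apply: le_lt_trans (_ : (1 / 2) * (r / 4) < _); last by lra.
  by rewrite ler_wpM2r // divr_ge0 // ltW.
rewrite rnormE lecR; have -> : rnorm (z / k) = rnorm z / (r / 4).
  apply: (mulIf (x := r / 4)); first by rewrite gt_eqF ?divr_gt0.
  by rewrite -{1}kr -rnormM !divfK // gt_eqF ?divr_gt0.
by rewrite ler_pdivrMr ?divr_gt0 //; lra.
Qed.

Lemma near_prod (V W : normedModType C) (x0 : V) (y0 : W) (P : V * W -> Prop) :
  (\forall p \near (x0, y0), P p) <-> exists2 r : R, 0 < r &
    forall a b, vn (a - x0) < r -> vn (b - y0) < r -> P (a, b).
Proof.
split=> [/nbhs_ballP[e /= /gt0_Re[-> e0] H]|[r r0 H]].
  exists (complex.Re e) => // a b ar br; apply: H; split => /=.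
    by rewrite -ball_normE /= distrC vnE ltcR.
  by rewrite -ball_normE /= distrC vnE ltcR.
apply/nbhs_ballP; exists r%:C => /=; first by rewrite ltcR.
move=> [a b] [/= ar br]; apply: H; rewrite -ltcR -vnE distrC.
  by move: ar; rewrite -ball_normE.
by move: br; rewrite -ball_normE.
Qed.

Lemma vnCE (z : C) : vn z = rnorm z.
Proof. by []. Qed.

Lemma rnorm_i : rnorm ('i : C) = 1.
Proof. by rewrite /rnorm normCi. Qed.

Lemma rnormB (a b : C) : rnorm (a - b) <= rnorm a + rnorm b.
Proof. by apply: le_trans (rnormD _ _) _; rewrite lerD2l /rnorm normrN. Qed.

(** In the coordinates (z + i w, z - i w) the points (t, conj t) are those with z and w real. The
    one-variable identity theorem is applied in z for fixed real w, and then in w for fixed complex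
    z. *)
Lemma diag_zero (f : C * C -> C) : (\forall p \near (0 : C * C), differentiable f p) ->
  (\forall t \near (0 : C), f (t, t^*) = 0) -> \forall p \near (0 : C * C), f p = 0.
Proof.
move=> df /near_vn[r2 r20 f0].
have [r1 [M [r10 Hf]]] := hol_bounded df.
have /near_prod[r3 r30 H] : \forall p \near (0 : C, 0 : C), differentiable f p /\ `|f p| <= M%:C.
  by apply/near_vn; exists r1.
pose r := Num.min r2 r3; have r0 : 0 < r by rewrite lt_min r20.
have Hr (a b : C) : rnorm a < r -> rnorm b < r -> differentiable f (a, b) /\ `|f (a, b)| <= M%:C.
  move=> ar br; apply: H; rewrite subr0 vnCE.
    by apply: lt_le_trans ar _; rewrite /r ge_min lexx orbT.
  by apply: lt_le_trans br _; rewrite /r ge_min lexx orbT.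
have Z t : rnorm t < r -> f (t, t^*) = 0.
  by move=> tr; apply: f0; rewrite subr0 vnCE; apply: lt_le_trans tr _; rewrite /r ge_min lexx.
pose F (z w : C) := f (z + 'i * w, z - 'i * w).
have inF (z w : C) : rnorm z < r / 2 -> rnorm w < r / 2 ->
    differentiable f (z + 'i * w, z - 'i * w) /\ `|f (z + 'i * w, z - 'i * w)| <= M%:C.
  move=> zr wr; apply: Hr.
    by apply: le_lt_trans (rnormD _ _) _; rewrite rnormM rnorm_i mul1r; lra.
  by apply: le_lt_trans (rnormB _ _) _; rewrite rnormM rnorm_i mul1r; lra.
have F1 (z : C) (y : R) : rnorm z <= r / 16 -> `|y| < r / 2 -> F z y%:C = 0.
  move=> zr yr; have r20' : 0 < r / 2 by rewrite divr_gt0.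
  have yr' : rnorm y%:C < r / 2 by rewrite rnorm_real.
  refine (@real_zeros (fun z => F z y%:C) (r / 2) M r20' _ _ z _).
  - move=> z1 z1r; have [d1 b1] := inF z1 _ z1r yr'; split; last exact: b1.
    have E : (fun z : C => F z y%:C) =
      (fun z : C => f (('i * y%:C, - ('i * y%:C)) + z *: ((1, 1) : C * C))).
      apply/funext => z2; rewrite /F; congr (f (_, _)) => /=; rewrite addrC.
        by congr (_ + _); rewrite -[_ *: _]/(z2 * 1) mulr1.
      by congr (_ + _); rewrite -[_ *: _]/(z2 * 1) mulr1.
    rewrite E; apply: (diff_along _).1.
    suff -> : ('i * y%:C, - ('i * y%:C)) + z1 *: ((1, 1) : C * C) =
      (z1 + 'i * y%:C, z1 - 'i * y%:C) by exact: d1.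
    by congr (_, _) => /=; rewrite addrC; congr (_ + _); rewrite -[_ *: _]/(z1 * 1) mulr1.
  - move=> x xr; have -> : F x%:C y%:C = f (x +i* y, (x +i* y)^*).
      by rewrite /F; congr (f (_, _)); simpc.
    apply: Z; apply: le_lt_trans (_ : `|x| + `|y| < _); last by lra.
    by rewrite -lecR -rnormE; exact: norm_ReIm.
  - by move: zr; lra.
have F2 (z w : C) : rnorm z <= r / 16 -> rnorm w <= r / 16 -> F z w = 0.
  move=> zr wr; have r20' : 0 < r / 2 by rewrite divr_gt0.
  have zr' : rnorm z < r / 2 by move: zr r0; lra.
  refine (@real_zeros (F z) (r / 2) M r20' _ _ w _).
  - move=> w1 w1r; have [d1 b1] := inF _ w1 zr' w1r; split; last exact: b1.
    have E : F z = (fun w : C => f ((z, z) + w *: (('i, - 'i) : C * C))).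
      apply/funext => w2; rewrite /F; congr (f (_, _)) => /=.
        by congr (_ + _); rewrite -[_ *: _]/(w2 * 'i) mulrC.
      by congr (_ + _); rewrite -[_ *: _]/(w2 * - 'i) mulrN mulrC.
    rewrite E; apply: (diff_along _).1.
    suff -> : (z, z) + w1 *: (('i, - 'i) : C * C) = (z + 'i * w1, z - 'i * w1) by exact: d1.
    congr (_, _) => /=; congr (_ + _).
      by rewrite -[_ *: _]/(w1 * 'i) mulrC.
    by rewrite -[_ *: _]/(w1 * - 'i) mulrN mulrC.
  - by move=> y yr; apply: F1.
  - by move: wr; lra.
apply/(@near_prod C C 0 0); exists (r / 16); first by rewrite divr_gt0.
move=> a b; rewrite !subr0 !vnCE => ar br.
have two : rnorm (2^-1 : C) = 2^-1.
  have E2 : (2^-1 : R)%:C = 2^-1 :> C by rewrite fmorphV rmorph_nat.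
  by rewrite -E2 rnorm_real ger0_norm.
(* The coordinate change is inverted: z = (a + b)/2 and w = (a - b)/(2i). *)
have <- : F ((a + b) / 2) (- 'i * ((a - b) / 2)) = f (a, b).
  have ii : 'i * (- 'i * ((a - b) / 2)) = (a - b) / 2.
    by rewrite mulrA mulrN -expr2 sqr_i opprK mul1r.
  by rewrite /F ii; congr (f (_, _)); field.
apply: F2.
  rewrite rnormM two ler_pdivrMr //; apply: le_trans (rnormD _ _) _; lra.
rewrite rnormM {1}/rnorm normrN normCi mul1r rnormM two ler_pdivrMr //.
by apply: le_trans (rnormB _ _) _; lra.
Qed.

End IdentityTheorem.

(** * The counting argument *)

Section Monomials.
Context (K : fieldType) (k : nat) (S : Type) (g : 'I_k -> S -> K).

Definition mono (kap : {ffun 'I_k -> nat}) (s : S) : K := \prod_(l < k) g l s ^+ kap l.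

(** The bound c is on each exponent separately, which makes the number of monomials (c+1)^k. Lists
    allow repeated monomials, so sums and products need no normal form. *)
Definition in_span (c : nat) (f : S -> K) : Prop :=
  exists L : seq (K * {ffun 'I_k -> nat}),
    (forall x, x \in L -> forall l, (x.2 l <= c)%N) /\
    forall s, f s = \sum_(x <- L) x.1 * mono x.2 s.

Lemma in_span_ext c f h : (forall s, f s = h s) -> in_span c h -> in_span c f.
Proof. by move=> fh [L [LP E]]; exists L; split=> // s; rewrite fh. Qed.

Lemma in_span0 c : in_span c (fun _ => 0).
Proof. by exists [::]; split=> // s; rewrite big_nil. Qed.

Lemma in_span_const c a : in_span c (fun _ => a).
Proof.
exists [:: (a, [ffun _ => 0%N])]; split; last first.
  by move=> s; rewrite big_seq1 /mono big1 ?mulr1 // => l _; rewrite ffunE expr0.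
by move=> x; rewrite inE => /eqP -> l; rewrite ffunE.
Qed.

Lemma in_spanD c f h : in_span c f -> in_span c h -> in_span c (fun s => f s + h s).
Proof.
move=> [L [LP fE]] [M [MP hE]]; exists (L ++ M); split.
  by move=> x; rewrite mem_cat => /orP[/LP|/MP].
by move=> s; rewrite big_cat /= fE hE.
Qed.

Lemma in_span_sum c (I : Type) (r : seq I) (F : I -> S -> K) :
  (forall i, in_span c (F i)) -> in_span c (fun s => \sum_(i <- r) F i s).
Proof.
move=> FP; elim: r => [|i r IHr].
  by apply: in_span_ext (in_span0 c) => s; rewrite big_nil.
by apply: in_span_ext (in_spanD (FP i) IHr) => s; rewrite big_cons.
Qed.

Lemma in_spanM c d f h : in_span c f -> in_span d h -> in_span (c + d) (fun s => f s * h s).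
Proof.
move=> [L [LP fE]] [M [MP hE]].
pose mul (x y : K * {ffun 'I_k -> nat}) : K * {ffun 'I_k -> nat} :=
  (x.1 * y.1, [ffun l => (x.2 l + y.2 l)%N]).
exists [seq mul x y | x <- L, y <- M]; split.
  move=> z /allpairsP[[x y] /= [xL yM ->]] l /=; rewrite ffunE.
  exact: leq_add (LP _ xL l) (MP _ yM l).
move=> s; rewrite fE hE big_allpairs_dep /= mulr_suml; apply: eq_bigr => x _.
rewrite mulr_sumr; apply: eq_bigr => y _; rewrite mulrACA; congr (_ * _).
by rewrite /mono -big_split; apply: eq_bigr => l _; rewrite ffunE exprD.
Qed.

Lemma in_spanZ c a f : in_span c f -> in_span c (fun s => a * f s).
Proof. by move=> fP; have := in_spanM (in_span_const 0 a) fP. Qed.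

Lemma in_span_prod m c (F : 'I_m -> S -> K) : (forall i, in_span c (F i)) ->
  in_span (m * c) (fun s => \prod_(i < m) F i s).
Proof.
elim: m F => [|m IHm] F FP.
  by apply: in_span_ext (in_span_const (0 * c) 1) => s; rewrite big_ord0.
rewrite mulSn.
apply: in_span_ext (in_spanM (FP ord0) (IHm (fun i => F (lift ord0 i)) (fun i => FP _))) => s.
by rewrite big_ord_recl.
Qed.

Lemma in_span_gen l : in_span 1 (g l).
Proof.
exists [:: (1, [ffun l' => (l' == l) : nat])]; split.
  by move=> x; rewrite inE => /eqP -> l'; rewrite ffunE /=; case: eqP.
move=> s; rewrite big_seq1 mul1r /mono (bigD1 l) //= ffunE eqxx expr1.
by rewrite big1 ?mulr1 // => j /negPf jl; rewrite ffunE jl.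
Qed.

Lemma in_span_coords c f : in_span c f ->
  exists w : {ffun 'I_k -> 'I_c.+1} -> K,
    forall s, f s = \sum_(kap : {ffun 'I_k -> 'I_c.+1}) w kap * \prod_(l < k) g l s ^+ kap l.
Proof.
move=> [L []]; elim: L f => [|x L IHL] f LP fE.
  by exists (fun _ => 0) => s; rewrite fE big_nil big1 // => i _; rewrite mul0r.
have [|w wE] := IHL (fun s => \sum_(x <- L) x.1 * mono x.2 s) _ (fun s => erefl).
  by move=> y yL; apply: LP; rewrite inE yL orbT.
pose kx : {ffun 'I_k -> 'I_c.+1} := [ffun l => inord (x.2 l)].
exists (fun kap => w kap + (if kap == kx then x.1 else 0)) => s.
rewrite fE big_cons wE addrC.
under [RHS]eq_bigr do rewrite mulrDl.
rewrite big_split /=; congr (_ + _).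
rewrite (bigD1 kx) //= eqxx [X in _ + X]big1 ?addr0; last first.
  by move=> kap /negPf ->; rewrite mul0r.
congr (_ * _); apply: eq_bigr => l _; rewrite ffunE inordK // ltnS.
by apply: LP; rewrite inE eqxx.
Qed.

Context (V : S -> Prop).

(** Induction on a: multiply the expression for E^a by Q E and replace the single term with E^(D+1)
    by the relation. Each step raises the exponents of the [g] by at most 1. *)
Lemma power_reduction D (q : 'I_D.+1 -> S -> K) (Q E : S -> K) :
  (forall i, in_span 1 (q i)) -> in_span 1 Q ->
  (forall s, V s -> Q s * E s ^+ D.+1 = \sum_(i < D.+1) q i s * E s ^+ i) ->
  forall a, exists A : 'I_D.+1 -> S -> K, (forall b, in_span a (A b)) /\
    forall s, V s -> Q s ^+ a * E s ^+ a = \sum_(b < D.+1) A b s * E s ^+ b.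
Proof.
move=> qP QP rel; elim=> [|a [A [AP AE]]].
  exists (fun b _ => if b == ord0 then 1 else 0); split.
    by move=> b; case: (b == ord0); exact: in_span_const.
  move=> s _; rewrite big_ord_recl /= mulr1 big1 ?addr0 ?expr0 ?mulr1 //.
  by move=> i _; rewrite mul0r.
(* Multiplication by E moves each coefficient up by one; the last coefficient, [A ord_max], has no
   place there and is handled by the relation. *)
pose u (b : 'I_D.+1) s := if unlift ord0 b is Some c then A (widen_ord (leqnSn D) c) s else 0.
exists (fun b s => u b s * Q s + A ord_max s * q b s); split.
  move=> b; rewrite -addn1; apply: in_spanD; apply: in_spanM => //.
  by rewrite /u; case: (unlift ord0 b) => [c|]; [exact: AP|exact: in_span0].
move=> s Vs; rewrite !exprSr mulrACA AE //.
have S1 : \sum_(b < D.+1) u b s * Q s * E s ^+ b =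
    (\sum_(i < D) A (widen_ord (leqnSn D) i) s * E s ^+ i) * (Q s * E s).
  rewrite big_ord_recl {1}/u unlift_none !mul0r add0r mulr_suml.
  apply: eq_bigr => i _; rewrite /u liftK /= /bump leq0n add1n exprSr.
  by move: (A _ s) (Q s) (E s ^+ i) (E s) => x1 x2 x3 x4; ring.
have S2 : \sum_(b < D.+1) A ord_max s * q b s * E s ^+ b =
    A ord_max s * (Q s * E s ^+ D.+1).
  by rewrite rel // mulr_sumr; apply: eq_bigr => i _; rewrite mulrA.
rewrite [RHS](eq_bigr (fun b : 'I_D.+1 => u b s * Q s * E s ^+ b +
  A ord_max s * q b s * E s ^+ b)); last by move=> i _; rewrite mulrDl.
rewrite big_split /= S1 S2 big_ord_recr /= mulrDl; congr (_ + _).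
by rewrite -mulrA; congr (_ * _); rewrite exprSr mulrCA.
Qed.

End Monomials.

Section Dependence.
Context (K : fieldType).

Lemma dependent (A Y : finType) (M : A -> Y -> K) : (#|Y| < #|A|)%N ->
  exists c : A -> K, (exists a, c a != 0) /\ forall y, \sum_(a : A) c a * M a y = 0.
Proof.
move=> YA; pose m := \matrix_(i < #|A|, j < #|Y|) M (enum_val i) (enum_val j).
have : kermx m != 0.
  rewrite kermx_eq0 /row_free neq_ltn; apply/orP; left.
  exact: leq_ltn_trans (rank_leq_col m) YA.
case/rowV0Pn => v /sub_kermxP vm v0.
exists (fun a => v 0 (enum_rank a)); split.
  have /rV0Pn[i vi] := v0; exists (enum_val i); by rewrite enum_valK.
move=> y; have /matrixP/(_ 0 (enum_rank y)) := vm; rewrite !mxE => E; rewrite -[RHS]E.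
rewrite [LHS](reindex_onto enum_val enum_rank) /=; last by move=> a _; rewrite enum_rankK.
apply: eq_big => [i|i _]; first by rewrite enum_valK eqxx.
by rewrite mxE enum_valK enum_rankK.
Qed.

End Dependence.

(** Since mN + 1 <= m(N + 1), the left side is at most D^(m rho) m^(k rho) (N+1)^(k rho) = N
    (N+1)^(k rho), and m is one more than k rho. The value of N is chosen to equal the constant
    factor. *)
Fact counting_ineq (D m k rho N : nat) : (0 < m)%N -> m = (k * rho).+1 ->
  N = (D ^ (m * rho) * m ^ (k * rho))%N ->
  ((D ^ m * (m * N).+1 ^ k) ^ rho < N.+1 ^ m)%N.
Proof.
move=> m0 mE NE; apply: (@leq_ltn_trans (N * N.+1 ^ (k * rho))); last first.
  by rewrite mE expnS ltn_pmul2r ?expn_gt0.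
rewrite expnMn -!expnM [X in (_ <= X * _)%N]NE -mulnA leq_mul2l; apply/orP; right.
rewrite -expnMn; case: (k * rho)%N => // e; rewrite leq_exp2r //.
by rewrite ltn_pmul2l.
Qed.

Section CountingRelation.
Context (K : fieldType) (S : Type) (V : S -> Prop) (k m rho D N : nat).
Context (g : 'I_k -> S -> K) (E Q : 'I_m -> S -> K) (q : 'I_m -> 'I_D.+1 -> S -> K).

(** After multiplication by the N-th powers of the [Q i], every product of powers of the [E i] lies
    in the span of the functions [phi x], with coefficients that do not depend on s. A dependency
    among the coefficient arrays is thus valid at all points of [V]. *)
Lemma counting_relation :
  (((D.+1) ^ m * (m * N).+1 ^ k) ^ rho < N.+1 ^ m)%N ->
  (forall i b, in_span g 1 (q i b)) -> (forall i, in_span g 1 (Q i)) ->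
  (forall i s, V s -> Q i s != 0) ->
  (forall i s, V s -> Q i s * E i s ^+ D.+1 = \sum_(b < D.+1) q i b s * E i s ^+ b) ->
  exists c : {ffun 'I_m -> 'I_N.+1} -> K, (exists alpha, c alpha != 0) /\
    forall s : 'I_rho -> S, (forall j, V (s j)) ->
      \sum_alpha c alpha * \prod_(j < rho) \prod_(i < m) E i (s j) ^+ alpha i = 0.
Proof.
move=> count qP QP Q0 rel.
have /choice[A AP] : forall x : 'I_m * 'I_N.+1, exists A : 'I_D.+1 -> S -> K,
    (forall b, in_span g N (A b)) /\
    forall s, V s -> Q x.1 s ^+ N * E x.1 s ^+ x.2 = \sum_(b < D.+1) A b s * E x.1 s ^+ b.
  move=> [i a] /=.
  have [A [AP AE]] := power_reduction (qP i) (QP i) (rel i) a.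
  have aN : (a + (N - a))%N = N by rewrite subnKC // -ltnS.
  have Qp : in_span g (N - a) (fun s => Q i s ^+ (N - a)).
    have := in_span_prod (m := N - a) (fun _ => QP i); rewrite muln1.
    by apply: in_span_ext => s; rewrite prodr_const card_ord.
  (* Padding by Q^(N-a) gives all exponents a <= N the same factor Q^N and the same degree bound
     N. *)
  exists (fun b s => A b s * Q i s ^+ (N - a)); split.
    by move=> b; have := in_spanM (AP b) Qp; rewrite aN.
  move=> s Vs; have -> : Q i s ^+ N = Q i s ^+ a * Q i s ^+ (N - a) by rewrite -exprD aN.
  rewrite mulrAC AE // mulr_suml.
  by apply: eq_bigr => b _; rewrite mulrAC.
have /choice[w wP] : forall x : {ffun 'I_m -> 'I_N.+1} * {ffun 'I_m -> 'I_D.+1},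
    exists w : {ffun 'I_k -> 'I_(m * N).+1} -> K, forall s,
      \prod_(i < m) A (i, x.1 i) (x.2 i) s =
      \sum_kap w kap * \prod_(l < k) g l s ^+ kap l.
  move=> [al be] /=; apply: in_span_coords; apply: in_span_prod => i.
  by have [] := AP (i, al i).
pose X := ({ffun 'I_m -> 'I_D.+1} * {ffun 'I_k -> 'I_(m * N).+1})%type.
pose C (al : {ffun 'I_m -> 'I_N.+1}) (x : X) := w (al, x.1) x.2.
pose phi (x : X) s := \prod_(l < k) g l s ^+ x.2 l * \prod_(i < m) E i s ^+ x.1 i.
have QE (al : {ffun 'I_m -> 'I_N.+1}) s : V s -> \prod_(i < m) Q i s ^+ N * \prod_(i < m) E i s ^+ al i =
    \sum_(x : X) C al x * phi x s.
  move=> Vs; rewrite -big_split /=.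
  rewrite (eq_bigr (fun i => \sum_(b < D.+1) A (i, al i) b s * E i s ^+ b)); last first.
    by move=> i _; have [_ /(_ s Vs)] := AP (i, al i).
  rewrite bigA_distr_bigA /= (eq_bigr (fun be : {ffun 'I_m -> 'I_D.+1} =>
    \sum_(kap : {ffun 'I_k -> 'I_(m * N).+1}) C al (be, kap) * phi (be, kap) s)).
    by rewrite pair_big /=; apply: eq_bigr => -[].
  move=> be _; rewrite big_split /= (wP (al, be)) mulr_suml.
  by apply: eq_bigr => kap _; rewrite -mulrA.
(* A product over [rho] points expands over tuples of elements of [X], so [Y] indexes the linear
   conditions on the coefficients of the dependency. *)
pose Y := {ffun 'I_rho -> X}.
have card_lt : (#|Y| < #|{ffun 'I_m -> 'I_N.+1}|)%N.
  by rewrite !card_ffun !card_ord card_prod !card_ffun !card_ord.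
have [c [c0 cP]] := dependent (fun al (y : Y) => \prod_(j < rho) C al (y j)) card_lt.
exists c; split=> // s Vs.
have QQ : \prod_(j < rho) \prod_(i < m) Q i (s j) ^+ N != 0.
  apply/prodf_neq0 => j _; apply/prodf_neq0 => i _.
  by rewrite expf_neq0 // Q0.
apply: (mulfI QQ); rewrite mulr0 mulr_sumr.
rewrite (eq_bigr (fun al => \sum_(y : Y) c al * \prod_(j < rho) C al (y j) *
    \prod_(j < rho) phi (y j) (s j))).
  rewrite exchange_big /= big1 // => y _.
  by rewrite -mulr_suml cP mul0r.
move=> al _; rewrite mulrCA -big_split /=.
rewrite (eq_bigr (fun j => \sum_(x : X) C al x * phi x (s j))); last by move=> j _; exact: QE.
rewrite bigA_distr_bigA /= mulr_sumr; apply: eq_bigr => y _.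
by rewrite big_split mulrA.
Qed.

End CountingRelation.

Section DistinctSums.
Context (K : fieldType) (T : Type) (U : T -> Prop) (lam : T -> K) (N : nat).
Context (char0 : forall a b : nat, a%:R = b%:R :> K -> a = b).

(** The points are chosen one at a time; each new point has to avoid the finitely many values of
    [lam] that could create a coincidence with the earlier ones. *)
Lemma distinct_sums (avoid : forall F : seq K, exists t, U t /\ lam t \notin F) m :
  exists tau : nat -> T, (forall i, (i < m)%N -> U (tau i)) /\
    forall a b : nat -> nat, (forall i, (i < m)%N -> (a i <= N)%N /\ (b i <= N)%N) ->
      \sum_(i < m) lam (tau i) *+ a i = \sum_(i < m) lam (tau i) *+ b i ->
      forall i, (i < m)%N -> a i = b i.
Proof.
elim: m => [|m [tau [tauU tauP]]].
  by have [t _] := avoid [::]; exists (fun _ => t).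
pose X := ({ffun 'I_m -> 'I_N.+1} * {ffun 'I_m -> 'I_N.+1} * ('I_N.+1 * 'I_N.+1))%type.
(* The value that [lam t] must take if two sums agree and the exponents of the new point differ.
   Equal exponents give a division by zero, hence the harmless extra value 0. *)
pose bad (x : X) : K := (\sum_(i < m) lam (tau i) *+ x.1.2 i - \sum_(i < m) lam (tau i) *+ x.1.1 i)
   / (x.2.1%:R - x.2.2%:R).
have [t [Ut tF]] := avoid [seq bad x | x <- enum {: X}].
exists (fun i => if (i < m)%N then tau i else t); split.
  by move=> i _; case: ifP => // /tauU.
move=> a b abN; rewrite !big_ord_recr /= ltnn.
have sumE (c : nat -> nat) :
    \sum_(i < m) lam (if (i < m)%N then tau i else t) *+ c i = \sum_(i < m) lam (tau i) *+ c i.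
  by apply: eq_bigr => i _; rewrite ltn_ord.
rewrite !sumE => E.
have abm : a m = b m.
  apply/eqP/negPn/negP => ne; move/negP: tF; apply.
  pose fa : {ffun 'I_m -> 'I_N.+1} := [ffun i : 'I_m => inord (a i)].
  pose fb : {ffun 'I_m -> 'I_N.+1} := [ffun i : 'I_m => inord (b i)].
  apply/mapP; exists ((fa, fb), (inord (a m), inord (b m))); first by rewrite mem_enum.
  have [aN bN] := abN m (ltnSn m).
  rewrite /bad /= !inordK ?ltnS //.
  have Sa : \sum_(i < m) lam (tau i) *+ fa i = \sum_(i < m) lam (tau i) *+ a i.
    apply: eq_bigr => i _; rewrite ffunE inordK // ltnS.
    by have [] := abN i (ltnW (ltn_ord i)).
  have Sb : \sum_(i < m) lam (tau i) *+ fb i = \sum_(i < m) lam (tau i) *+ b i.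
    apply: eq_bigr => i _; rewrite ffunE inordK // ltnS.
    by have [] := abN i (ltnW (ltn_ord i)).
  rewrite Sa Sb.
  have d0 : (a m)%:R - (b m)%:R != 0 :> K.
    by rewrite subr_eq0; apply: contraNneq ne => /char0 ->.
  apply: (mulIf d0); rewrite divfK // mulrBr !mulr_natr.
  by apply/eqP; rewrite subr_eq addrAC -E addrAC subrr add0r.
move=> i; rewrite ltnS leq_eqVlt => /predU1P[->//|im].
apply: (tauP a b) im => [j jm|]; first exact: abN (ltnW jm).
by move: E; rewrite abm => /addIr.
Qed.

End DistinctSums.

Section Vandermonde.
Context (K : fieldType) (A : finType) (lam c e : A -> K).

(** The relations extend linearly from powers to all polynomials in [lam]; the polynomial vanishing
    at every other value isolates the term of a. *)
Lemma vandermonde : injective lam ->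
  (forall p, \sum_a c a * lam a ^+ p * e a = 0) -> forall a, c a * e a = 0.
Proof.
move=> inj H a.
have HP (p : {poly K}) : \sum_b c b * p.[lam b] * e b = 0.
  transitivity (\sum_(i < size p) p`_i * \sum_b c b * lam b ^+ i * e b); last first.
    by rewrite big1 // => i _; rewrite H mulr0.
  under [RHS]eq_bigr do rewrite mulr_sumr.
  rewrite exchange_big /=; apply: eq_bigr => b _.
  rewrite horner_coef mulr_sumr mulr_suml; apply: eq_bigr => i _.
  by rewrite [c b * (_ * _)]mulrCA !mulrA.
have := HP (\prod_(b | b != a) ('X - (lam b)%:P)).
rewrite (bigD1 a) //= [X in _ + X]big1 ?addr0 => [|b ba]; last first.
  by rewrite horner_prod (bigD1 b) //= hornerXsubC subrr mul0r mulr0 mul0r.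
rewrite mulrAC => /eqP; rewrite mulf_eq0 => /orP[/eqP //|].
rewrite horner_prod prodf_seq_eq0 => /hasP[b _ /andP[ba]].
by rewrite hornerXsubC subr_eq0 => /eqP/inj ab; rewrite ab eqxx in ba.
Qed.

End Vandermonde.

Section LogDerivative.
Context (K : numFieldType).
Implicit Types (f g : K -> K) (x a b c : K).

(** Derivatives are kept in the form a * f, so that logarithmic derivatives add under products
    without any logarithm. *)
Lemma log_deriveM f g x a b : is_derive x (1 : K) f (a * f x) ->
  is_derive x (1 : K) g (b * g x) ->
  is_derive x (1 : K) (fun s => f s * g s) ((a + b) * (f x * g x)).
Proof.
move=> df dg; have D := @is_deriveM _ _ f g x 1 _ _ df dg.
apply: is_derive_eq D _.
by rewrite -[_ *: _]/(f x * (b * g x)) -[_ *: (a * _)]/(g x * (a * f x)); ring.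
Qed.

Lemma log_derive_cst x c : is_derive x (1 : K) ((fun _ : K => c) : K -> K) (0 * c).
Proof. by rewrite mul0r; exact: is_derive_cst. Qed.

Lemma log_deriveX f x a n : is_derive x (1 : K) f (a * f x) ->
  is_derive x (1 : K) (fun s => f s ^+ n) (a *+ n * f x ^+ n).
Proof.
move=> df; elim: n => [|n IHn].
  by rewrite mulr0n; exact: (log_derive_cst x 1).
have := log_deriveM df IHn; rewrite -mulrS -exprS.
by under eq_fun do rewrite -exprS.
Qed.

Lemma log_derive_prod n (F : 'I_n -> K -> K) x (a : 'I_n -> K) :
  (forall i, is_derive x (1 : K) (F i) (a i * F i x)) ->
  is_derive x (1 : K) (fun s => \prod_(i < n) F i s) ((\sum_(i < n) a i) * \prod_(i < n) F i x).
Proof.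
elim: n F a => [|n IHn] F a dF.
  rewrite !big_ord0; under eq_fun do rewrite big_ord0.
  exact: (log_derive_cst x 1).
rewrite !big_ord_recl; under eq_fun do rewrite big_ord_recl.
exact: (log_deriveM (dF ord0)
  (IHn (fun i => F (lift ord0 i)) (fun i => a (lift ord0 i)) (fun i => dF _))).
Qed.

Lemma is_derive_lincomb (I : Type) (r : seq I) (c : I -> K) (F : I -> K -> K) x (l : I -> K) :
  (forall i, is_derive x (1 : K) (F i) (l i)) ->
  is_derive x (1 : K) (fun s => \sum_(i <- r) c i * F i s) (\sum_(i <- r) c i * l i).
Proof.
move=> dF; elim: r => [|i r IHr].
  rewrite big_nil; under eq_fun do rewrite big_nil.
  exact: is_derive_cst.
rewrite big_cons; under eq_fun do rewrite big_cons.
exact: (@is_deriveD _ _ _ _ _ x 1 _ _ (@is_deriveZ _ _ _ (F i) (c i) x 1 _ (dF i)) IHr).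
Qed.

Lemma is_derive_near0 f x l : is_derive x (1 : K) f l ->
  (\forall s \near x, f s = 0) -> l = 0.
Proof.
move=> [_ <-] f0.
rewrite (@near_eq_derive _ _ _ f (cst 0) x 1 f0).
exact: derive_cst.
Qed.

End LogDerivative.

(** * Contradiction by differentiating the dependency *)

Section CountingCore.
Context (K : numFieldType) (n : nat).

(** Bilinear, with no conjugation, so that pairing with [Hp s] stays holomorphic in both
    variables. *)
Definition dot (a b : 'rV[K]_n) : K := (a *m b^T) 0 0.

Lemma dot_suml (I : Type) (r : seq I) (F : I -> 'rV[K]_n) b :
  dot (\sum_(i <- r) F i) b = \sum_(i <- r) dot (F i) b.
Proof. by rewrite /dot mulmx_suml summxE. Qed.

Lemma dot_mulr rho (a : 'rV[K]_n) (M : 'M[K]_(rho, n)) (b : 'rV[K]_rho) :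
  dot a (b *m M) = \sum_(j < rho) b 0 j * dot a (row j M).
Proof.
rewrite /dot trmx_mul mulmxA mxE; apply: eq_bigr => j _; rewrite mulrC mxE; congr (_ * _).
by rewrite [LHS]mxE [RHS]mxE; apply: eq_bigr => i _; rewrite !mxE.
Qed.

Lemma dotMn a b k : dot (a *+ k) b = dot a b *+ k.
Proof. by rewrite /dot !mxE -sumrMnl; apply: eq_bigr => i _; rewrite mulmxnE mulrnAl. Qed.

Context (V : set K) (s1 : K) (Hp : K -> 'rV[K]_n).
Context (Vs1 : V s1) (Vopen : forall s, V s -> \forall s' \near s, V s').
Context (Hpcts : forall s, V s -> {for s, continuous Hp}).

Definition rows_of rho (S : 'I_rho -> K) : 'M[K]_(rho, n) := \matrix_j Hp (S j).

Definition upd rho (S : 'I_rho -> K) (j : 'I_rho) (s : K) : 'I_rho -> K :=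
  fun i => if i == j then s else S i.

(* [ok] is stable under small moves of a single coordinate, so an identity that
   holds at all ok tuples may be differentiated in each coordinate separately. *)
Lemma spanning_tuples : exists rho (ok : ('I_rho -> K) -> Prop),
  [/\ exists S, ok S, forall S, ok S -> forall j, V (S j),
      forall S, ok S -> exists b : 'rV[K]_rho, Hp s1 = b *m rows_of S &
      forall S j, ok S -> \forall s \near S j, ok (upd S j s)].
Proof.
pose Pr r := exists S : 'I_r -> K, (forall j, V (S j)) /\ row_free (rows_of S).
have P0 : exists r, `[< Pr r >].
  exists 0%N; apply/asboolP; exists (fun _ => s1); split=> //.
  by rewrite /row_free flatmx0 mxrank0.
have Pn r : `[< Pr r >] -> (r <= n)%N.
  by move=> /asboolP[S [_ /eqP <-]]; exact: rank_leq_col.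
have [rho /asboolP[S0 [VS0 free0]] maxrho] := ex_maxnP P0 Pn.
have [B0 AB0] := row_freeP free0.
(* [rho] is the maximal number of points of [V] with independent vectors, attained at [S0], and [B0]
   is a right inverse of the frame there. Nonvanishing of this determinant is an open condition that
   implies independence. *)
pose ok (S : 'I_rho -> K) := (forall j, V (S j)) /\ \det (rows_of S *m B0) != 0.
have ok_free S : ok S -> row_free (rows_of S).
  move=> [_ dS]; rewrite /row_free eqn_leq rank_leq_row /=.
  apply: leq_trans (mxrankM_maxl _ B0).
  by rewrite mxrank_unit // unitmxE unitfE.
exists rho, ok; split.
- by exists S0; split=> //; rewrite AB0 det1 oner_neq0.
- by move=> S [].
(* If [Hp s1] were outside the span of the frame, s1 could be added as a further point, against
   maximality of [rho]. *)
- move=> S okS; have freeS := ok_free S okS; have [VS _] := okS.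
  apply/submxP; apply/negPn/negP => nsub.
  suff : `[< Pr rho.+1 >] by move=> /maxrho; rewrite ltnn.
  apply/asboolP; pose S' (j : 'I_rho.+1) := if unlift ord0 j is Some i then S i else s1.
  exists S'; split; first by move=> j; rewrite /S'; case: (unlift ord0 j) => [i|].
  have S'0 : S' ord0 = s1 by rewrite /S' unlift_none.
  have S'l i : S' (lift ord0 i) = S i by rewrite /S' liftK.
  have -> : rows_of S' = col_mx (Hp s1) (rows_of S) :> 'M[K]_(1 + rho, n).
    apply/row_matrixP => j; rewrite rowK.
    have [i ->|i ->] := split_ordP j.
      rewrite rowKu (ord1 i) row_id; congr (Hp _); rewrite -S'0; congr S'; exact: val_inj.
    rewrite rowKd rowK; congr (Hp _); rewrite -S'l; congr S'; exact: val_inj.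
  rewrite /row_free eqn_leq rank_leq_row /=.
  have E : \rank (Hp s1 + rows_of S)%MS = \rank (col_mx (Hp s1) (rows_of S)).
    by rewrite addsmxE.
  move: E => <-.
  have : (rows_of S < Hp s1 + rows_of S)%MS.
    rewrite ltmxE addsmxSr /=; apply: contra nsub; apply: submx_trans.
    exact: addsmxSl.
  by rewrite ltmxErank (eqP freeS) => /andP[].
move=> S j [VS dS].
have Vnear := Vopen (VS j).
(* The cofactors of row j do not involve the point j, so the determinant is a fixed linear form in
   [Hp s], continuous in s. *)
pose w : 'cV[K]_n := B0 *m \col_l cofactor (rows_of S *m B0) j l.
have detE s : \det (rows_of (upd S j s) *m B0) = dot (Hp s) w^T.
  rewrite (expand_det_row _ j) /dot trmxK /w mulmxA [RHS]mxE; apply: eq_bigr => l _.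
  congr (_ * _).
    rewrite !mxE; apply: eq_bigr => i _; congr (_ * _).
    by rewrite mxE /upd eqxx.
  rewrite mxE /cofactor; congr (_ * \det _); apply/matrixP => a b; rewrite !mxE.
  apply: eq_bigr => i _; congr (_ * _); rewrite !mxE /upd.
  by rewrite eq_sym (negPf (neq_lift _ _)).
have cdet : {for S j, continuous (fun s => dot (Hp s) w^T)}.
  pose L (u : 'rV[K]_n) : K := \sum_l u 0 l * w l 0.
  have -> : (fun s => dot (Hp s) w^T) = L \o Hp.
    by apply/funext => s; rewrite /dot trmxK mxE.
  apply: continuous_comp; first exact: Hpcts.
  apply: differentiable_continuous.
  rewrite (_ : L = \sum_(l < n) (fun u : 'rV[K]_n => u 0 l * w l 0)); last first.
    by apply/funext => u; rewrite fct_sumE.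
  apply: differentiable_sum => l.
  apply: (@differentiableM _ _ (fun u : 'rV[K]_n => u 0 l) (cst (w l 0))).
    exact: differentiable_coord.
  exact: differentiable_cst.
have d0 : dot (Hp (S j)) w^T != 0.
  rewrite -detE (_ : upd S j (S j) = S) //.
  by apply/funext => i; rewrite /upd; case: eqP => [->|].
have dnear : \forall s \near S j, dot (Hp s) w^T != 0.
  exact: (@cvgr_neq0 K K K (nbhs (S j)) _ (fun s => dot (Hp s) w^T) _ cdet d0).
near=> s; split.
  move=> i; rewrite /upd; case: eqP => _; last exact: VS.
  by near: s.
by rewrite detE; near: s.
Unshelve. all: by end_near. Qed.

End CountingCore.

Section CountingTheorem.
Context (K : numFieldType) (n k D : nat) (U V : set K) (s1 : K).
Context (Hp Gam : K -> 'rV[K]_n) (E : K -> K -> K).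
Context (f : 'I_D.+2 -> 'I_k -> K -> K) (g : 'I_k -> K -> K).

(** Index [D.+2] makes the degree of the relation [D.+1], so positive; as the top coefficient does
    not vanish, it serves as a reduction rule for E^(D+1). The avoidance hypothesis makes the
    frequencies at s1 distinct, and nonvanishing of E contradicts the vanishing of all terms of the
    dependency. *)
Theorem no_algebraic_relation :
  V s1 -> (forall s, V s -> \forall s' \near s, V s') ->
  (forall s, V s -> {for s, continuous Hp}) ->
  (forall t s, U t -> V s -> E t s != 0) ->
  (forall t s, U t -> V s -> is_derive s (1 : K) (E t) (- dot (Gam t) (Hp s) * E t s)) ->
  (forall t s, U t -> V s -> \sum_(b < D.+2) (\sum_(l < k) f b l t * g l s) * E t s ^+ b = 0) ->
  (forall t s, U t -> V s -> \sum_(l < k) f ord_max l t * g l s != 0) ->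
  (forall F : seq K, exists t, U t /\ dot (Gam t) (Hp s1) \notin F) -> False.
Proof.
move=> Vs1 Vopen Hpc E0 dE rel top0 avoid.
have [rho [ok [[S0 okS0] okV okspan oknear]]] := spanning_tuples Vs1 Vopen Hpc.
pose m := (k * rho).+1; pose N := (D.+1 ^ (m * rho) * m ^ (k * rho))%N.
have count := @counting_ineq D.+1 m k rho N (ltn0Sn _) erefl erefl.
pose lam t := dot (Gam t) (Hp s1).
have char0 (a b : nat) : a%:R = b%:R :> K -> a = b.
  by move=> /eqP; rewrite eqr_nat => /eqP.
have [tau [tauU tauP]] := @distinct_sums K K U lam N char0 avoid m.
have tU (i : 'I_m) : U (tau i) by exact: tauU.
pose Et (i : 'I_m) := E (tau i).
pose Q (i : 'I_m) s := \sum_(l < k) f ord_max l (tau i) * g l s.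
pose q (i : 'I_m) (b : 'I_D.+1) s :=
  \sum_(l < k) (- f (widen_ord (leqnSn _) b) l (tau i)) * g l s.
have span1 (w : 'I_k -> K) : in_span g 1 (fun s => \sum_(l < k) w l * g l s).
  by apply: in_span_sum => l; apply: in_spanZ; exact: in_span_gen.
have [||||c [[al0 c0] cP]] := @counting_relation K K V k m rho D N g Et Q q count.
- by move=> i b; exact: span1.
- by move=> i; exact: span1.
- by move=> i s Vs; exact: top0.
- move=> i s Vs; have := rel (tau i) s (tU i) Vs.
  rewrite big_ord_recr /= addrC => /eqP; rewrite addr_eq0 => /eqP ->.
  rewrite -sumrN; apply: eq_bigr => b _; rewrite -mulNr; congr (_ * _).
  by rewrite -sumrN; apply: eq_bigr => l _; rewrite mulNr.
pose A := {ffun 'I_m -> 'I_N.+1}.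
pose e (al : A) (S : 'I_rho -> K) := \prod_(j < rho) \prod_(i < m) Et i (S j) ^+ al i.
pose gam (al : A) := \sum_(i < m) Gam (tau i) *+ al i.
pose L (al : A) := dot (gam al) (Hp s1).
have LE al : L al = \sum_(i < m) lam (tau i) *+ al i.
  by rewrite /L dot_suml; apply: eq_bigr => i _; rewrite dotMn.
have Linj : injective L.
  move=> al be; rewrite !LE => Eab; apply/ffunP => i; apply: val_inj.
  have extE (al' : A) : \sum_(i < m) lam (tau i) *+ al' i =
      \sum_(i < m) lam (tau i) *+ (fun j : nat => al' (inord j) : nat) i.
    by apply: eq_bigr => j _; rewrite inord_val.
  rewrite (extE al) (extE be) in Eab.
  have bd (j : nat) : (j < m)%N -> (al (inord j) <= N)%N /\ (be (inord j) <= N)%N.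
    by move=> _; split; rewrite -ltnS ltn_ord.
  have := tauP (fun j => al (inord j) : nat) (fun j => be (inord j) : nat) bd Eab i (ltn_ord i).
  by rewrite !inord_val.
have dP (al : A) s : V s -> is_derive s (1 : K) (fun s => \prod_(i < m) Et i s ^+ al i)
    (- dot (gam al) (Hp s) * \prod_(i < m) Et i s ^+ al i).
  move=> Vs; have -> : - dot (gam al) (Hp s) = \sum_(i < m) (- dot (Gam (tau i)) (Hp s)) *+ al i.
    by rewrite dot_suml -sumrN; apply: eq_bigr => i _; rewrite dotMn mulNrn.
  apply: (log_derive_prod (F := fun i s => Et i s ^+ al i)) => i.
  by apply: log_deriveX; exact: dE.
have dprod (al : A) S j : ok S ->
    is_derive (S j) (1 : K) (fun s => e al (upd S j s)) (- dot (gam al) (Hp (S j)) * e al S).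
  move=> okS; have VS := okV S okS.
  have updS : upd S j (S j) = S by apply/funext => i; rewrite /upd; case: eqP => [->|].
  pose a (i : 'I_rho) := if i == j then - dot (gam al) (Hp (S j)) else 0.
  have -> : - dot (gam al) (Hp (S j)) = \sum_(i < rho) a i.
    by rewrite (bigD1 j) //= /a eqxx big1 ?addr0 // => i /negPf ->.
  have -> : e al S = \prod_(j' < rho) \prod_(i < m) Et i (upd S j (S j) j') ^+ al i.
    by rewrite updS.
  apply: (log_derive_prod (F := fun j' s => \prod_(i < m) Et i (upd S j s j') ^+ al i)) => j'.
  rewrite /a /upd; case: (j' == j); first exact: dP.
  exact: log_derive_cst.
(* Differentiating in coordinate j multiplies the term of [al] by minus the pairing of [gam al] with
   [Hp (S j)]. Combined with the coefficients expressing [Hp s1] in the frame, this yields one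
   factor [L al]. The identity holds again at every ok tuple, so it can be repeated. *)
have key p : forall S, ok S -> \sum_(al : A) c al * L al ^+ p * e al S = 0.
  elim: p => [|p IHp] S okS.
    rewrite -[RHS](cP S (okV S okS)); apply: eq_bigr => al _.
    by rewrite expr0 mulr1.
  have step j : \sum_(al : A) c al * L al ^+ p * (- dot (gam al) (Hp (S j)) * e al S) = 0.
    apply: (is_derive_near0 (is_derive_lincomb (index_enum A) (fun al => c al * L al ^+ p)
       (fun al => dprod al S j okS))).
    apply: filterS (oknear S j okS) => s oks; exact: IHp.
  have [b bE] := okspan S okS.
  transitivity (\sum_(j < rho) - b 0 j *
     \sum_(al : A) c al * L al ^+ p * (- dot (gam al) (Hp (S j)) * e al S)); last first.
    by rewrite big1 // => j _; rewrite step mulr0.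
  under [RHS]eq_bigr do rewrite mulr_sumr.
  rewrite exchange_big /=; apply: eq_bigr => al _.
  rewrite exprSr {2}/L bE dot_mulr mulrA mulr_sumr mulr_suml; apply: eq_bigr => j _.
  rewrite rowK; move: (L al ^+ p) (dot _ _) (e al S) => x1 x2 x3; ring.
have := vandermonde Linj (fun p => key p S0 okS0) al0.
move/eqP; rewrite mulf_eq0 (negPf c0) /=; apply/negP.
apply/prodf_neq0 => j _; apply/prodf_neq0 => i _; rewrite expf_neq0 //.
by apply: E0; [exact: tU|exact: okV].
Qed.

End CountingTheorem.

(** * Algebraic relations with separated coefficients *)

Section NonvanishingPoint.
Context (K : numFieldType).

Lemma poly_nonroot (p : {poly K}) : p != 0 -> exists x : K, p.[x] != 0.
Proof.
move=> p0; apply: contrapT => H.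
have := @max_poly_roots K p [seq (i%:R : K) | i <- iota 0 (size p)] p0.
rewrite size_map size_iota ltnn => Hr; suff: false by [].
apply: Hr.
  by apply/allP => x _; apply: contrapT => /negP rx; apply: H; exists x.
by rewrite map_inj_uniq ?iota_uniq // => i j /eqP; rewrite eqr_nat => /eqP.
Qed.

(** Uniqueness of base B digits: the lowest digit is the remainder modulo B, the others are those of
    the quotient. *)
Lemma digits_inj n B (a b : 'I_n -> nat) : (forall i, a i < B)%N -> (forall i, b i < B)%N ->
  (\sum_(i < n) a i * B ^ i = \sum_(i < n) b i * B ^ i)%N -> a =1 b.
Proof.
elim: n a b => [a b _ _ _ []//|n IHn] a b aB bB.
have split (c : 'I_n.+1 -> nat) : (\sum_(i < n.+1) c i * B ^ i =
    (\sum_(i < n) c (lift ord0 i) * B ^ i) * B + c ord0)%N.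
  rewrite big_ord_recl expn0 muln1 addnC; congr (_ + _)%N.
  by rewrite big_distrl; apply: eq_bigr => i _ /=; rewrite /bump expnS -mulnA (mulnC B).
rewrite (split a) (split b) => E.
have B0 : (0 < B)%N by apply: leq_ltn_trans (aB ord0).
have E0 : a ord0 = b ord0.
  by have := congr1 (modn^~ B) E; rewrite !modnMDl !modn_small.
move: E; rewrite E0 => /addIn /eqP; rewrite eqn_pmul2r // => /eqP E.
have H := IHn _ _ (fun i => aB _) (fun i => bB _) E.
by move=> i; case: (unliftP ord0 i) => [j ->|-> //]; exact: H.
Qed.

(* Kronecker substitution: for B larger than all exponents, distinct monomials
   take distinct powers of t at the point (t, t^B, t^(B^2), ...). *)
Lemma mpoly_nonvanishing n (P : mpoly n K) : P != 0 -> exists v : 'I_n -> K, meval v P != 0.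
Proof.
move=> P0; pose B := (\max_(m <- msupp P) \max_(i < n) m i).+1.
have mB m i : m \in msupp P -> (m i < B)%N.
  by move=> mP; rewrite ltnS; apply: (leq_trans (leq_bigmax i)); exact: leq_bigmax_seq.
pose w (m : multinom n) := (\sum_(i < n) m i * B ^ i)%N.
have winj : {in msupp P &, injective w}.
  move=> m m' mP m'P E; apply/mnmP => i.
  by apply: (@digits_inj n B m m') E i => j; exact: mB.
pose p : {poly K} := \sum_(m <- msupp P) mcoeff m P *: 'X^(w m).
have p0 : p != 0.
  have [m mP] : exists m, m \in msupp P.
    by case E: (msupp P) (msupp_eq0 P) => [|m s]; [rewrite (negPf P0)|exists m; rewrite mem_head].
  apply/negP => /eqP/(congr1 (fun p : {poly K} => p`_(w m))).
  rewrite coef0 coef_sum (bigD1_seq m) ?msupp_uniq //= coefZ coefXn eqxx mulr1.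
  rewrite big_seq_cond big1 ?addr0 => [/eqP|m' /andP[m'P mm']].
    by rewrite mcoeff_eq0 mP.
  rewrite coefZ coefXn; case: eqP => [/winj E|]; last by rewrite mulr0.
  by rewrite E ?eqxx in mm'.
have [t pt] := poly_nonroot p0; exists (fun i : 'I_n => t ^+ (B ^ i)).
rewrite mevalE; move: pt; congr (_ != 0).
rewrite horner_sum; apply: eq_bigr => m _; rewrite hornerZ hornerXn; congr (_ * _).
by rewrite /w expr_sum; apply: eq_bigr => i _; rewrite -exprM mulnC.
Qed.

End NonvanishingPoint.

Section TensorPolynomials.
Context (K : numFieldType).

Definition hol0 (h : K -> K) := \forall t \near (0 : K), differentiable h t.

(* Polynomials in e and y whose coefficients are finite sums f(t) g(s). *)
Definition tensor_poly (W : K -> K -> K -> K -> K) :=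
  exists (I : finType) (j b : I -> nat) (f g : I -> K -> K),
  [/\ forall i, hol0 (f i), forall i, hol0 (g i) &
      forall t s e y, W t s e y = \sum_i f i t * g i s * e ^+ j i * y ^+ b i].

Lemma hol0_cst c : hol0 (fun _ => c).
Proof. by apply: filterE => t; exact: differentiable_cst. Qed.

Lemma hol0M f g : hol0 f -> hol0 g -> hol0 (fun t => f t * g t).
Proof. by apply: filterS2 => t ft gt; exact: differentiableM. Qed.

Lemma tensor_ext W W' : (forall t s e y, W t s e y = W' t s e y) -> tensor_poly W -> tensor_poly W'.
Proof.
move=> E [I [j [b [f [g [Hf Hg HW]]]]]]; exists I, j, b, f, g; split=> // t s e y.
by rewrite -E.
Qed.

Lemma tensor_mono f g j b : hol0 f -> hol0 g ->
  tensor_poly (fun t s e y => f t * g s * e ^+ j * y ^+ b).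
Proof.
move=> Hf Hg; exists unit, (fun _ => j), (fun _ => b), (fun _ => f), (fun _ => g).
by split=> // t s e y; rewrite (big_pred1 tt) //; case.
Qed.

Lemma tensor_t f : hol0 f -> tensor_poly (fun t s e y => f t).
Proof.
move=> Hf; apply: tensor_ext (tensor_mono 0 0 Hf (hol0_cst 1)) => t s e y.
by rewrite !mulr1.
Qed.

Lemma tensor_s f : hol0 f -> tensor_poly (fun t s e y => f s).
Proof.
move=> Hf; apply: tensor_ext (tensor_mono 0 0 (hol0_cst 1) Hf) => t s e y.
by rewrite !mulr1 mul1r.
Qed.

Lemma tensor_cst c : tensor_poly (fun t s e y => c).
Proof. exact: tensor_t (hol0_cst c). Qed.

Lemma tensor_e : tensor_poly (fun t s e y => e).
Proof.
apply: tensor_ext (tensor_mono 1 0 (hol0_cst 1) (hol0_cst 1)) => t s e y.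
by rewrite !mulr1 mul1r.
Qed.

Lemma tensor_y : tensor_poly (fun t s e y => y).
Proof.
apply: tensor_ext (tensor_mono 0 1 (hol0_cst 1) (hol0_cst 1)) => t s e y.
by rewrite !mulr1 mul1r.
Qed.

Lemma tensorD W W' : tensor_poly W -> tensor_poly W' ->
  tensor_poly (fun t s e y => W t s e y + W' t s e y).
Proof.
move=> [I [j [b [f [g [Hf Hg HW]]]]]] [I' [j' [b' [f' [g' [Hf' Hg' HW']]]]]].
pose sm (T : Type) (u : I -> T) (u' : I' -> T) (i : I + I') :=
  match i with inl i => u i | inr i => u' i end.
exists (I + I')%type, (sm _ j j'), (sm _ b b'), (sm _ f f'), (sm _ g g').
split=> [[i|i]|[i|i]|t s e y] /=; rewrite ?HW ?HW' ?big_sumType //.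
all: by [apply: Hf|apply: Hf'|apply: Hg|apply: Hg'].
Qed.

Lemma tensorM W W' : tensor_poly W -> tensor_poly W' ->
  tensor_poly (fun t s e y => W t s e y * W' t s e y).
Proof.
move=> [I [j [b [f [g [Hf Hg HW]]]]]] [I' [j' [b' [f' [g' [Hf' Hg' HW']]]]]].
exists (I * I')%type, (fun i => j i.1 + j' i.2)%N, (fun i => b i.1 + b' i.2)%N,
  (fun i t => f i.1 t * f' i.2 t), (fun i t => g i.1 t * g' i.2 t).
split=> [i|i|t s e y].
- exact: hol0M.
- exact: hol0M.
- rewrite HW HW' big_distrlr pair_bigA; apply: eq_bigr => -[i i'] _ /=.
  by rewrite !exprD; ring.
Qed.

Lemma tensorX W n : tensor_poly W -> tensor_poly (fun t s e y => W t s e y ^+ n).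
Proof.
move=> HW; elim: n => [|n IHn]; first exact: (tensor_cst 1).
by apply: tensor_ext (tensorM HW IHn) => t s e y; rewrite exprS.
Qed.

Lemma tensor_sum (I : Type) (r : seq I) (W : I -> K -> K -> K -> K -> K) :
  (forall i, tensor_poly (W i)) -> tensor_poly (fun t s e y => \sum_(i <- r) W i t s e y).
Proof.
move=> HW; elim: r => [|i r IHr].
  by apply: tensor_ext (tensor_cst 0) => t s e y; rewrite big_nil.
by apply: tensor_ext (tensorD (HW i) IHr) => t s e y; rewrite big_cons.
Qed.

Lemma tensor_prod (I : Type) (r : seq I) (W : I -> K -> K -> K -> K -> K) :
  (forall i, tensor_poly (W i)) -> tensor_poly (fun t s e y => \prod_(i <- r) W i t s e y).
Proof.
move=> HW; elim: r => [|i r IHr].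
  by apply: tensor_ext (tensor_cst 1) => t s e y; rewrite big_nil.
by apply: tensor_ext (tensorM (HW i) IHr) => t s e y; rewrite big_cons.
Qed.

Lemma tensor_meval n (P : mpoly n K) (h : 'I_n -> K -> K -> K -> K -> K) :
  (forall i, tensor_poly (h i)) ->
  tensor_poly (fun t s e y => meval (fun i => h i t s e y) P).
Proof.
move=> Hh; apply: (@tensor_ext (fun t s e y =>
    \sum_(m <- msupp P) mcoeff m P * \prod_(i < n) h i t s e y ^+ m i)).
  by move=> t s e y; rewrite mevalE.
apply: tensor_sum => m; apply: tensorM; first exact: tensor_cst.
by apply: tensor_prod => i; exact: tensorX.
Qed.

Lemma tensor_subst W V : tensor_poly W -> tensor_poly V ->
  tensor_poly (fun t s e y => W t s e (V t s e y)).
Proof.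
move=> [I [j [b [f [g [Hf Hg HW]]]]]] HV.
apply: (@tensor_ext (fun t s e y => \sum_i f i t * g i s * e ^+ j i * V t s e y ^+ b i)).
  by move=> t s e y; rewrite HW.
apply: tensor_sum => i; apply: tensorM; last exact: tensorX.
by apply: tensor_ext (tensor_mono (j i) 0 (Hf i) (Hg i)) => t s e y; rewrite mulr1.
Qed.

Lemma differentiable_proj1 (U V : normedModType K) (p : U * V) : differentiable fst p.
Proof. by apply: (linear_differentiable (f := fst)) => q; exact: cvg_fst. Qed.

Lemma differentiable_proj2 (U V : normedModType K) (p : U * V) : differentiable snd p.
Proof. by apply: (linear_differentiable (f := snd)) => q; exact: cvg_snd. Qed.

Lemma kernel_differentiable (I : finType) (A : pred I) (f g : I -> K -> K) :
  (forall i, hol0 (f i)) -> (forall i, hol0 (g i)) ->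
  \forall p \near (0 : K * K), differentiable (fun p : K * K => \sum_(i | A i) f i p.1 * g i p.2) p.
Proof.
move=> Hf Hg.
have H i : \forall p \near (0 : K * K), differentiable (fun p : K * K => f i p.1 * g i p.2) p.
  have H1 : \forall p \near (0 : K * K), differentiable (f i) p.1.
    exact: (@cvg_fst K K (nbhs 0) (nbhs 0) _ _ (Hf i)).
  have H2 : \forall p \near (0 : K * K), differentiable (g i) p.2.
    exact: (@cvg_snd K K (nbhs 0) (nbhs 0) _ _ (Hg i)).
  apply: filterS2 H1 H2 => p f1 g2.
  apply: differentiableM.
    by apply: (@differentiable_comp _ _ _ _ fst (f i)) => //; exact: differentiable_proj1.
  by apply: (@differentiable_comp _ _ _ _ snd (g i)) => //; exact: differentiable_proj2.
suff Hs (r : seq I) : \forall p \near (0 : K * K),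
    differentiable (fun p : K * K => \sum_(i <- r | A i) f i p.1 * g i p.2) p.
  exact: Hs.
elim: r => [|i r IHr].
  apply: filterE => p; under eq_fun do rewrite big_nil; exact: differentiable_cst.
apply: filterS2 (H i) IHr => p d1 d2.
under eq_fun do rewrite big_cons.
by case: (A i) => //; exact: differentiableD.
Qed.

End TensorPolynomials.

Section LowestOrder.
Context (K : numFieldType) (I : finType) (j b : I -> nat) (a : I -> K).

Lemma sumX_coef (A : pred I) m :
  (\sum_(i | A i) a i *: 'X^(b i) : {poly K})`_m = \sum_(i | A i && (b i == m)) a i.
Proof.
rewrite coef_sum big_mkcondr /=; apply: eq_bigr => i _; rewrite coefZ coefXn eq_sym.
by case: eqP => _; rewrite ?mulr1 ?mulr0.
Qed.

Lemma sumX_horner (A : pred I) y :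
  (\sum_(i | A i) a i *: 'X^(b i) : {poly K}).[y] = \sum_(i | A i) a i * y ^+ b i.
Proof. by rewrite horner_sum; apply: eq_bigr => i _; rewrite hornerZ hornerXn. Qed.

Lemma cvg_sum_seq (r : seq I) (A : pred I) (h : I -> K -> K) (l : I -> K) :
  (forall i, A i -> h i @ (0 : K) --> l i) ->
  (fun e => \sum_(i <- r | A i) h i e) @ (0 : K) --> \sum_(i <- r | A i) l i.
Proof.
move=> Hh; elim: r => [|i r IHr].
  by rewrite big_nil; under eq_fun do rewrite big_nil; exact: (@cst_continuous K K 0 0).
rewrite big_cons; under eq_fun do rewrite big_cons.
by case Ai: (A i) => //; exact: (cvgD (Hh i Ai) IHr).
Qed.

Lemma cvg_expn (h : K -> K) (l : K) m : h @ (0 : K) --> l -> (fun e => h e ^+ m) @ (0 : K) --> l ^+ m.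
Proof.
move=> hl; elim: m => [|m IHm]; first exact: (@cst_continuous K K 1 0).
by rewrite exprS; under eq_fun do rewrite exprS; exact: (cvgM hl IHm).
Qed.

(** Divide by e^j0 and let e tend to 0: the quotient [h] is continuous and vanishes for small
    nonzero e, and at e = 0 only the terms with exponent j0 survive. *)
Lemma lowest_order j0 (Y : K -> K) :
  (forall j1, (j1 < j0)%N -> \sum_(i | j i == j1) a i *: 'X^(b i) = 0 :> {poly K}) ->
  {for 0, continuous Y} ->
  (\forall e \near (0 : K), \sum_i a i * e ^+ j i * Y e ^+ b i = 0) ->
  \sum_(i | j i == j0) a i * Y 0 ^+ b i = 0.
Proof.
move=> low Yc WY.
pose h e := \sum_(i | (j0 <= j i)%N) a i * e ^+ (j i - j0) * Y e ^+ b i.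
have hc : h @ (0 : K) --> h 0.
  apply: (@cvg_sum_seq _ _ (fun i e => a i * e ^+ (j i - j0) * Y e ^+ b i)
    (fun i => a i * 0 ^+ (j i - j0) * Y 0 ^+ b i)) => i _.
  have c1 := @cvg_expn (fun e => e) 0 (j i - j0) (fun A HA => HA).
  exact: (cvgM (cvgM (@cst_continuous K K (a i) 0) c1) (@cvg_expn Y (Y 0) (b i) Yc)).
have h0 : \forall e \near (0 : K)^', h e = 0.
  near=> e.
  have e0 : e != 0 by near: e; exact: nbhs_dnbhs_neq.
  have : \sum_i a i * e ^+ j i * Y e ^+ b i = 0 by near: e; apply: nbhs_dnbhs WY.
  rewrite (bigID (fun i => (j i < j0)%N)) /=.
  have -> : \sum_(i | (j i < j0)%N) a i * e ^+ j i * Y e ^+ b i = 0.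
    (* The terms below j0 are grouped by exponent; each group is a power of e times a polynomial
       that is identically 0, evaluated at [Y e]. *)
    rewrite (partition_big (fun i => inord (j i) : 'I_j0.+1) (fun j1 : 'I_j0.+1 => (j1 < j0)%N)) /=; last first.
      by move=> i ij; rewrite inordK // ltnS ltnW.
    rewrite big1 // => j1 j10.
    have := congr1 (fun p : {poly K} => e ^+ j1 * p.[Y e]) (low _ j10).
    rewrite horner0 mulr0 sumX_horner mulr_sumr => H0; rewrite -[RHS]H0.
    apply: eq_big => [i|i /andP[ij /eqP <-]].
      apply/andP/eqP => [[ij /eqP <-]|ij]; first by rewrite inordK // ltnS ltnW.
      by rewrite ij; split=> //; apply/eqP/val_inj; rewrite /= inordK // ltnS ltnW.
    rewrite inordK ?ltnS; last exact: ltnW.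
    by rewrite mulrCA mulrA.
  rewrite add0r => H1; apply: (mulfI (expf_neq0 j0 e0)).
  rewrite mulr0 -[RHS]H1 mulr_sumr; apply: eq_big => [i|i ij].
    by rewrite -leqNgt.
  by rewrite -{2}(subnK ij) exprD; move: (e ^+ j0) => u; ring.
have -> : \sum_(i | j i == j0) a i * Y 0 ^+ b i = h 0.
  rewrite /h [RHS](bigID (fun i => j i == j0)) /= [X in _ + X]big1 ?addr0.
    apply: eq_big => [i|i /eqP ->]; last by rewrite subnn mulr1.
    by apply/idP/andP => [/eqP ->|[]//].
  move=> i /andP[ij nj]; have : (0 < j i - j0)%N by rewrite subn_gt0 ltn_neqAle eq_sym nj.
  by case: (j i - j0)%N => // m _; rewrite expr0n mulr0 mul0r.
have hc' : h @ (0 : K)^' --> h 0 by apply: cvg_trans hc; exact: cvg_within_filter.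
apply: (@cvg_unique _ _ (h @ 0^') _ _ _ hc') => //.
by apply: cvg_near_cst.
Unshelve. all: by end_near. Qed.

End LowestOrder.

Section DiagonalKernels.
Context (R : realType).
Local Notation C := R[i].
Implicit Types (I : finType).

Lemma near_diag (P : C * C -> Prop) :
  (\forall p \near (0 : C * C), P p) -> \forall t \near (0 : C), P (t, t^*).
Proof.
move=> /(@near_prod R C C 0 0 P)[r r0 HP].
apply/(@near_vn R C 0 (fun t => P (t, t^*))); exists r => // t; rewrite subr0 => tr.
apply: HP; rewrite subr0 //.
by rewrite (_ : vn _ = vn t) // /vn norm_conjC.
Qed.

Lemma poly_eq0P (p : {poly C}) : (forall y, p.[y] = 0) -> p = 0.
Proof.
move=> H; apply/eqP; apply: contrapT => /negP /poly_nonroot[x].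
by rewrite H eqxx.
Qed.

Lemma diag_kernel_zero I (A : pred I) (f g : I -> C -> C) :
  (forall i, hol0 (f i)) -> (forall i, hol0 (g i)) ->
  (\forall t \near (0 : C), \sum_(i | A i) f i t * g i t^* = 0) ->
  \forall p \near (0 : C * C), \sum_(i | A i) f i p.1 * g i p.2 = 0.
Proof.
move=> Hf Hg H.
exact: (@diag_zero R (fun p => \sum_(i | A i) f i p.1 * g i p.2)
  (@kernel_differentiable C I A f g Hf Hg) H).
Qed.

Lemma diag_poly_zero I (A : pred I) (b : I -> nat) (f g : I -> C -> C) :
  (forall i, hol0 (f i)) -> (forall i, hol0 (g i)) ->
  (\forall t \near (0 : C), forall y, \sum_(i | A i) f i t * g i t^* * y ^+ b i = 0) ->
  \forall p \near (0 : C * C), \sum_(i | A i) (f i p.1 * g i p.2) *: 'X^(b i) = 0 :> {poly C}.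
Proof.
move=> Hf Hg H; pose B := (\max_i b i).+1.
have Hm (m : 'I_B) : \forall p \near (0 : C * C), \sum_(i | A i && (b i == m)) f i p.1 * g i p.2 = 0.
  apply: diag_kernel_zero => //; apply: filterS H => t Ht.
  rewrite -(sumX_coef b (fun i => f i t * g i t^*) A m).
  suff -> : \sum_(i | A i) (f i t * g i t^*) *: 'X^(b i) = 0 :> {poly C} by rewrite coef0.
  by apply: poly_eq0P => y; rewrite sumX_horner.
apply: filterS (filter_forall _ Hm) => p Hp; apply/polyP => m.
rewrite coef0 (sumX_coef b (fun i => f i p.1 * g i p.2) A m).
have [mB|Bm] := ltnP m B; first exact: (Hp (Ordinal mB)).
rewrite big_pred0 // => i; apply/negP => /andP[_ /eqP E].
by move: Bm; rewrite -E ltnNge (leq_bigmax i).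
Qed.

(** [T] is the coefficient of the smallest power of e that is not identically 0 along s = conj t.
    The smaller ones vanish there, hence in a full neighbourhood of 0 by the identity theorem, so
    [lowest_order] applies at every nearby (t, s). *)
Lemma lowest_coefficient (W : C -> C -> C -> C -> C) : tensor_poly W ->
  (exists e y, W 0 0 e y != 0) ->
  exists T : C -> C -> C -> C, [/\ tensor_poly (fun t s e y => T t s y),
    ~ (\forall t \near (0 : C), forall y, T t t^* y = 0) &
    \forall p \near (0 : C * C), forall Y : C -> C, {for 0, continuous Y} ->
      (\forall e \near (0 : C), W p.1 p.2 e (Y e) = 0) -> T p.1 p.2 (Y 0) = 0].
Proof.
move=> [I [j [b [f [g [Hf Hg HW]]]]]] [e [y Wey]].
pose T m t s y := \sum_(i | j i == m) f i t * g i s * y ^+ b i.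
pose P m := `[< ~ (\forall t \near (0 : C), forall y, T m t t^* y = 0) >].
(* If every coefficient vanished near 0 on the diagonal, it would vanish at t = s = 0, against the
   given nonzero value of [W 0 0]. *)
have exP : exists m, P m.
  apply: contrapT => nP; move/negP: Wey; apply; apply/eqP; rewrite HW.
  have T0 m : T m 0 0 y = 0.
    have /nbhs_singleton H : \forall t \near (0 : C), forall y, T m t t^* y = 0.
      by apply: contrapT => H; apply: nP; exists m; apply/asboolP.
    by have := H y; rewrite conjC0.
  have ji i : (j i < (\max_i j i).+1)%N by rewrite ltnS (leq_bigmax i).
  rewrite (partition_big (fun i => Ordinal (ji i)) xpredT) //= big1 // => m _.
  transitivity (e ^+ m * T m 0 0 y); last by rewrite T0 mulr0.
  rewrite mulr_sumr; apply: eq_big => // i /eqP <- /=.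
  by rewrite mulrAC [RHS]mulrC.
case: (ex_minnP exP) => m /asboolP Pm minm; exists (T m); split=> //.
  apply: (@tensor_ext _ (fun t s e y => \sum_(i | j i == m) f i t * g i s * y ^+ b i)) => //.
  apply: (@tensor_ext _ (fun t s e y => \sum_i (j i == m)%:R * (f i t * g i s * y ^+ b i))).
    move=> t s e' y'; rewrite [RHS]big_mkcond /=; apply: eq_bigr => i _.
    by case: eqP; rewrite ?mul1r ?mul0r.
  apply: tensor_sum => i; apply: tensorM; first exact: tensor_cst.
  by apply: tensor_ext (tensor_mono 0 (b i) (Hf i) (Hg i)) => t s e' y'; rewrite mulr1.
have low (m' : 'I_m) : \forall p \near (0 : C * C),
    \sum_(i | j i == m') (f i p.1 * g i p.2) *: 'X^(b i) = 0 :> {poly C}.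
  apply: diag_poly_zero => //; apply: contrapT => H.
  have := minm m' (asboolT H); by rewrite leqNgt ltn_ord.
apply: filterS (filter_forall _ low) => p Hp Y Yc WY.
apply: (@lowest_order C I j b (fun i => f i p.1 * g i p.2) m Y _ Yc).
  by move=> j1 j1m; exact: (Hp (Ordinal j1m)).
by apply: filterS WY => e'; rewrite HW.
Qed.

End DiagonalKernels.

Section AlgebraicRelation.
Context (R : realType).
Local Notation C := R[i].
Implicit Types (I : finType).

Lemma sum_enum_val (K : nmodType) I (F : I -> K) : \sum_(l < #|I|) F (enum_val l) = \sum_i F i.
Proof. by rewrite -(big_enum_val (A := I)). Qed.

(* A polynomial identity T(t, s, E rho + kap) = 0, expanded in powers of E and
   truncated at the last coefficient that does not vanish identically on the
   diagonal s = conj t. *)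
Lemma truncated_relation (T : C -> C -> C -> C) (E rho kap : C -> C -> C) :
  tensor_poly (fun t s e y => T t s y) ->
  ~ (\forall t \near (0 : C), forall y, T t t^* y = 0) ->
  tensor_poly (fun t s e y => rho t s) -> tensor_poly (fun t s e y => kap t s) ->
  (\forall p \near (0 : C * C), rho p.1 p.2 != 0) ->
  (\forall p \near (0 : C * C), T p.1 p.2 (E p.1 p.2 * rho p.1 p.2 + kap p.1 p.2) = 0) ->
  exists D k (f : 'I_D.+1 -> 'I_k -> C -> C) (g : 'I_k -> C -> C),
  [/\ forall b l, hol0 (f b l), forall l, hol0 (g l),
      \forall p \near (0 : C * C),
        \sum_(b < D.+1) (\sum_(l < k) f b l p.1 * g l p.2) * E p.1 p.2 ^+ b = 0 &
      ~ (\forall t \near (0 : C), \sum_(l < k) f ord_max l t * g l t^* = 0)].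
Proof.
move=> HT Tn0 Hrho Hkap rho0 TE.
have [I [j [b [f [g [Hf Hg HW]]]]]] := tensor_subst HT
  (tensorD (tensorM (@tensor_y C) Hrho) Hkap).
have {}HW t s y : T t s (y * rho t s + kap t s) = \sum_i f i t * g i s * y ^+ b i.
  by rewrite (HW t s 1 y); apply: eq_bigr => i _; rewrite expr1n mulr1.
pose Q m t s := \sum_(i | b i == m) f i t * g i s.
pose B := (\max_i b i).+1.
have bB i : (b i < B)%N by rewrite ltnS (leq_bigmax i).
have expand t s y : T t s (y * rho t s + kap t s) = \sum_(m < B) Q m t s * y ^+ m.
  rewrite HW (partition_big (fun i => Ordinal (bB i)) xpredT) //=; apply: eq_bigr => m _.
  by rewrite mulr_suml; apply: eq_big => // i /eqP <-.
pose P m := `[< ~ (\forall t \near (0 : C), Q m t t^* = 0) >].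
have exP : exists m, P m.
  apply: contrapT => nP; apply: Tn0.
  have Q0 (m : 'I_B) : \forall t \near (0 : C), Q m t t^* = 0.
    by apply: contrapT => H; apply: nP; exists (m : nat); apply/asboolP.
  apply: filterS2 (near_diag rho0) (filter_forall _ Q0) => t /= rt Qt y.
  (* As [rho] is nonzero, any y can be written y' rho + kap, so [T] vanishes for all y once all
     coefficients in y' vanish. *)
  rewrite -(divfK rt y) -[X in T _ _ X](subrK (kap t t^*)) -(divfK rt (_ - kap _ _)) expand.
  by rewrite big1 // => m _; rewrite Qt mul0r.
have Pb m : P m -> (m <= \max_i b i)%N.
  move=> /asboolP Pm; rewrite leqNgt; apply/negP => mb; apply: Pm.
  apply: filterE => t; rewrite /Q big_pred0 // => i.
  by apply/negP => /eqP E0; move: mb; rewrite -E0 ltnNge (leq_bigmax i).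
case: (ex_maxnP exP Pb) => D PD maxD; have DB : (D < B)%N by rewrite ltnS Pb.
move/asboolP: PD => PD.
pose f' (m : 'I_D.+1) (l : 'I_#|I|) t := if b (enum_val l) == m then f (enum_val l) t else 0.
pose g' (l : 'I_#|I|) := g (enum_val l).
have fgE (m : 'I_D.+1) t s : \sum_(l < #|I|) f' m l t * g' l s = Q m t s.
  rewrite (sum_enum_val (fun i => (if b i == m then f i t else 0) * g i s)) /Q [RHS]big_mkcond /=.
  by apply: eq_bigr => i _; case: eqP; rewrite ?mul0r.
exists D, #|I|, f', g'; split.
- move=> m l; rewrite /f'; case: (_ == _) => //.
  exact: hol0_cst.
- by move=> l; exact: Hg.
- have high (m : 'I_B) : \forall p \near (0 : C * C), (D < m)%N -> Q m p.1 p.2 = 0.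
    case: (ltnP D m) => Dm; last by apply: filterE.
    have Qm0 : \forall t \near (0 : C), Q m t t^* = 0.
      apply: contrapT => H; have := maxD m (asboolT H).
      by rewrite leqNgt Dm.
    by have := diag_kernel_zero Hf Hg Qm0; apply: filterS => p Hp _.
  apply: filterS2 TE (filter_forall _ high) => p; rewrite expand => TEp Qp.
  rewrite -[RHS]TEp; under eq_bigr do rewrite fgE.
  rewrite (big_ord_widen_cond B xpredT (fun m => Q m p.1 p.2 * E p.1 p.2 ^+ m)) //= big_mkcond /=.
  apply: eq_bigr => m _; rewrite ltnS; case: leqP => // Dm.
  by rewrite Qp // mul0r.
- move=> H; apply: PD; apply: filterS H => t.
  by rewrite fgE.
Qed.

Lemma tensor_perturbed_meval k (X : C -> C -> 'rV[C]_k) (v : 'rV[C]_k) (P : mpoly (k + 1) C) :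
  (forall i, tensor_poly (fun t s e y => X t s 0 i)) ->
  tensor_poly (fun t s e y =>
    meval (fun i => row_mx (X t s + e *: v) (const_mx y : 'rV_1) 0 i) P).
Proof.
move=> HX.
apply: (tensor_meval P (h := fun i t s e y => row_mx (X t s + e *: v) (const_mx y : 'rV_1) 0 i)) => i.
case: (split_ordP i) => l ->.
  apply: (@tensor_ext _ (fun t s e y => X t s 0 l + e * v 0 l)).
    by move=> t s e y; rewrite row_mxEl !mxE.
  by apply: tensorD => //; apply: tensorM; [exact: tensor_e|exact: tensor_cst].
apply: (@tensor_ext _ (fun t s e y => y)).
  by move=> t s e y; rewrite row_mxEr !mxE.
exact: tensor_y.
Qed.

(** The direction v leads from x to the base of a point where P is nonzero, which is reached at e =
    1. *)
Lemma perturbed_nonvanishing k (x : 'rV[C]_k) (P : mpoly (k + 1) C) : P != 0 ->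
  exists v y, meval (fun i => row_mx (x + 1 *: v) (const_mx y : 'rV_1) 0 i) P != 0.
Proof.
move=> P0; have [w Pw] := mpoly_nonvanishing P0.
exists (\row_j w (lshift 1 j) - x), (w (rshift k ord0)).
suff -> : (fun i => row_mx (x + 1 *: (\row_j w (lshift 1 j) - x))
    (const_mx (w (rshift k ord0)) : 'rV_1) 0 i) = w by [].
apply/funext => i; case: (split_ordP i) => l ->.
  by rewrite row_mxEl scale1r addrC subrK mxE.
by rewrite row_mxEr mxE; congr (w (rshift k _)); rewrite [LHS]ord1 [RHS]ord1.
Qed.

Lemma line_cvg0 (V : normedModType C) (x v : V) : (fun e : C => x + e *: v) @ (0 : C) --> x.
Proof.
have E0 : x = x + 0 *: v by rewrite scale0r addr0.
by rewrite [X in _ --> X]E0; exact: (@affine_line_cts C V x v 0).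
Qed.

Lemma line_comp_cts (V : normedModType C) (Phi : V -> C) (x v : V) :
  {for x, continuous Phi} -> {for 0, continuous (fun e : C => Phi (x + e *: v))}.
Proof.
move=> cp; have E0 : x + 0 *: v = x by rewrite scale0r addr0.
have cp' : {for x + 0 *: v, continuous Phi} by rewrite E0.
exact: (@continuous_comp C V C (fun e : C => x + e *: v) Phi 0 (@affine_line_cts C V x v 0) cp').
Qed.

Lemma near_near_comp (V : normedModType C) (X : C * C -> V) (Q : V -> Prop) :
  (X @ (0 : C * C) --> X 0) -> (\forall x \near X 0, Q x) ->
  \forall p \near (0 : C * C), \forall x \near X p, Q x.
Proof. by move=> Xc HQ; exact: (Xc _ (nbhs_interior HQ)). Qed.

Lemma near_comp (V : normedModType C) (X : C * C -> V) (Q : V -> Prop) :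
  (X @ (0 : C * C) --> X 0) -> (\forall x \near X 0, Q x) ->
  \forall p \near (0 : C * C), Q (X p).
Proof. by move=> Xc HQ; exact: (Xc _ HQ). Qed.

(** [lowest_coefficient] is applied to Y e = Phi (X + e v), for which the relation holds at all
    small e. At e = 0 it gives T(t, s, Phi (X t s)) = 0, even where the original relation is trivial
    along X. *)
Lemma relation_near_graph (V : normedModType C) (Phi : V -> C) (G : V -> C -> C)
    (X : C -> C -> V) (v : V) (E rho kap : C -> C -> C) :
  tensor_poly (fun t s e y => G (X t s + e *: v) y) ->
  (exists e y, G (X 0 0 + e *: v) y != 0) ->
  (\forall x \near X 0 0, G x (Phi x) = 0) ->
  (\forall p \near (0 : C * C), {for X p.1 p.2, continuous Phi}) ->
  ((fun p : C * C => X p.1 p.2) @ (0 : C * C) --> X 0 0) ->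
  tensor_poly (fun t s e y => rho t s) -> tensor_poly (fun t s e y => kap t s) ->
  (\forall p \near (0 : C * C), rho p.1 p.2 != 0) ->
  (\forall p \near (0 : C * C),
     Phi (X p.1 p.2) = E p.1 p.2 * rho p.1 p.2 + kap p.1 p.2) ->
  exists D k (f : 'I_D.+1 -> 'I_k -> C -> C) (g : 'I_k -> C -> C),
  [/\ forall b l, hol0 (f b l), forall l, hol0 (g l),
      \forall p \near (0 : C * C),
        \sum_(b < D.+1) (\sum_(l < k) f b l p.1 * g l p.2) * E p.1 p.2 ^+ b = 0 &
      ~ (\forall t \near (0 : C), \sum_(l < k) f ord_max l t * g l t^* = 0)].
Proof.
move=> HW Wn0 HG Phic Xc Hrho Hkap rho0 PhiE.
have [T [HT Tn0 TW]] := lowest_coefficient HW Wn0.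
apply: (truncated_relation HT Tn0 Hrho Hkap rho0).
have HGX := @near_near_comp V (fun p => X p.1 p.2) (fun x => G x (Phi x) = 0) Xc HG.
near=> p; have <- : Phi (X p.1 p.2) = E p.1 p.2 * rho p.1 p.2 + kap p.1 p.2.
  by near: p.
have TWp : forall Y : C -> C, {for 0, continuous Y} ->
      (\forall e \near (0 : C), G (X p.1 p.2 + e *: v) (Y e) = 0) -> T p.1 p.2 (Y 0) = 0.
  by near: p.
have HGp : \forall x \near X p.1 p.2, G x (Phi x) = 0 by near: p.
have cp : {for X p.1 p.2, continuous Phi} by near: p.
have TWY := TWp (fun e => Phi (X p.1 p.2 + e *: v)) (@line_comp_cts V Phi (X p.1 p.2) v cp) (line_cvg0 v HGp).
by rewrite scale0r addr0 in TWY.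
Unshelve. all: by end_near. Qed.

Lemma algebraic_relation k (Phi : 'rV[C]_k -> C) (X : C -> C -> 'rV[C]_k)
    (P : mpoly (k + 1) C) (E rho kap : C -> C -> C) :
  P != 0 ->
  (\forall x \near X 0 0, meval (fun i => row_mx x (const_mx (Phi x) : 'rV_1) 0 i) P = 0) ->
  (\forall p \near (0 : C * C), {for X p.1 p.2, continuous Phi}) ->
  ((fun p : C * C => X p.1 p.2) @ (0 : C * C) --> X 0 0) ->
  (forall i, tensor_poly (fun t s e y => X t s 0 i)) ->
  tensor_poly (fun t s e y => rho t s) -> tensor_poly (fun t s e y => kap t s) ->
  (\forall p \near (0 : C * C), rho p.1 p.2 != 0) ->
  (\forall p \near (0 : C * C),
     Phi (X p.1 p.2) = E p.1 p.2 * rho p.1 p.2 + kap p.1 p.2) ->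
  exists D k (f : 'I_D.+1 -> 'I_k -> C -> C) (g : 'I_k -> C -> C),
  [/\ forall b l, hol0 (f b l), forall l, hol0 (g l),
      \forall p \near (0 : C * C),
        \sum_(b < D.+1) (\sum_(l < k) f b l p.1 * g l p.2) * E p.1 p.2 ^+ b = 0 &
      ~ (\forall t \near (0 : C), \sum_(l < k) f ord_max l t * g l t^* = 0)].
Proof.
move=> P0 HP Phic Xc HX Hrho Hkap rho0 PhiE.
have [v [y0 Pv]] := perturbed_nonvanishing (X 0 0) P0.
have HW := tensor_perturbed_meval v P HX.
have Wn0 : exists e y, meval (fun i => row_mx (X 0 0 + e *: v) (const_mx y : 'rV_1) 0 i) P != 0.
  by exists 1, y0.
exact: (@relation_near_graph 'rV[C]_k Phi
  (fun x y => meval (fun i => row_mx x (const_mx y : 'rV_1) 0 i) P) X v E rho kap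
  HW Wn0 HP Phic Xc Hrho Hkap rho0 PhiE).
Qed.

End AlgebraicRelation.

Section AvoidValues.
Context (K : numFieldType).

(** A nonzero derivative isolates the point: if lam t' = lam t = c near t, then |l| |t' - t| <= (|l|
    / 2) |t' - t|, so t' = t. *)
Lemma avoid_value (lam : K -> K) t (l c : K) : l != 0 -> is_derive t (1 : K) lam l ->
  \forall t' \near t^', lam t' != c.
Proof.
move=> l0 /is_derive_diff[dlam dl].
have [E|nE] := eqVneq (lam t) c; last first.
  have H : \forall t' \near t, lam t' != c.
    have lc : {for t, continuous lam} := differentiable_continuous dlam.
    have cc : {for t, continuous (cst c : K -> K)} := @cst_continuous K K c t.
    have := cvgr_neq0 (lam t - c) (continuousB lc cc); rewrite subr_eq0 => /(_ _ nE).
    by apply: filterS => t' /=; rewrite !fctE subr_eq0.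
  by apply: nbhs_dnbhs H.
have l2 : 0 < `|l| / 2 by rewrite divr_gt0 // normr_gt0.
have := diff_eps dlam l2 => /nbhs_ballP[e /= e0 He].
apply/nbhs_ballP; exists e => // t' /= tt' t't; apply/eqP => lt'.
have tt2 : ball (0 : K) e (t' - t).
  by move: tt'; rewrite -!ball_normE /= sub0r normrN distrC.
have := He _ tt2; rewrite subrK lt' E subrr sub0r normrN.
have -> : 'd lam t (t' - t) = (t' - t) * l.
  transitivity ('d lam t ((t' - t) *: (1 : K))); last by rewrite linearZ dl.
  by congr ('d lam t _); rewrite -[RHS]/((t' - t) * 1) mulr1.
rewrite normrM mulrC ler_pM2r ?normr_gt0 ?subr_eq0 //.
rewrite ler_pdivlMr // ger_pMr ?normr_gt0 //.
by rewrite (_ : (2 <= 1 :> K) = false) // (ler_nat K 2 1).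
Qed.

Lemma avoid_values (lam : K -> K) t (l : K) (F : seq K) (U : set K) : l != 0 ->
  is_derive t (1 : K) lam l -> (\forall t' \near t, U t') -> exists t', U t' /\ lam t' \notin F.
Proof.
move=> l0 dl Ut.
have H : \forall t' \near t^', lam t' \notin F.
  elim: F => [|c F IHF]; first exact: filterE.
  by near=> t'; rewrite in_cons negb_or; apply/andP; split; near: t'; [exact: (@avoid_value lam t l c)|exact: IHF].
have : \forall t' \near t^', U t' /\ lam t' \notin F.
  by near=> t'; split; near: t' => //; exact: nbhs_dnbhs Ut.
by move=> /filter_ex.
Unshelve. all: by end_near. Qed.

End AvoidValues.

Section Transcendence.
Context (R : realType).
Local Notation C := R[i].

Lemma vn_ball_open (V : normedModType C) (x0 x : V) (r : R) : vn (x - x0) < r ->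
  \forall y \near x, vn (y - x0) < r.
Proof.
move=> xr; apply/near_vn; exists (r - vn (x - x0)); first by rewrite subr_gt0.
move=> y yr; apply: le_lt_trans (_ : vn (y - x) + vn (x - x0) < r); last by rewrite -ltrBrDr.
by rewrite (le_trans _ (vnD _ _)) // addrA subrK.
Qed.

Lemma differentiable_neq0 (V : normedModType C) (h : V -> C) x : differentiable h x -> h x != 0 ->
  \forall y \near x, h y != 0.
Proof. by move=> dh h0; exact: (cvgr_neq0 (h x) (differentiable_continuous dh) h0). Qed.

(** The top coefficient may vanish at 0, so the base point is moved to some nearby (t1, conj t1)
    where it does not. On small discs around t1 and conj t1 the hypotheses of the counting theorem
    hold; the frequency has nonzero derivative at t1, so it avoids any finite set. *)
Theorem no_relation n D k (Hp Gam : C -> 'rV[C]_n) (E : C -> C -> C)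
    (f : 'I_D.+1 -> 'I_k -> C -> C) (g : 'I_k -> C -> C) :
  (\forall p \near (0 : C * C), E p.1 p.2 != 0) ->
  (\forall p \near (0 : C * C), is_derive p.2 (1 : C) (E p.1)
      (- dot (Gam p.1) (Hp p.2) * E p.1 p.2)) ->
  (\forall s \near (0 : C), {for s, continuous Hp}) ->
  (\forall t \near (0 : C), exists2 l : C, l != 0 &
     is_derive t (1 : C) (fun t' => dot (Gam t') (Hp t^*)) l) ->
  (forall b l, hol0 (f b l)) -> (forall l, hol0 (g l)) ->
  (\forall p \near (0 : C * C),
        \sum_(b < D.+1) (\sum_(l < k) f b l p.1 * g l p.2) * E p.1 p.2 ^+ b = 0) ->
  ~ (\forall t \near (0 : C), \sum_(l < k) f ord_max l t * g l t^* = 0) -> False.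
Proof.
move=> /(@near_prod R C C 0 0)[r1 r10 E0] /(@near_prod R C C 0 0)[r2 r20 dE].
move=> /(@near_vn R C 0)[r3 r30 Hpc] /(@near_vn R C 0)[r4 r40 lam].
move=> Hf Hg /(@near_prod R C C 0 0)[r5 r50 rel].
have /(@near_prod R C C 0 0)[r6 r60 dq] := @kernel_differentiable C 'I_k xpredT (f ord_max) g (Hf ord_max) Hg.
pose r := Num.min (Num.min r1 r2) (Num.min (Num.min r3 r4) (Num.min r5 r6)).
have r0 : 0 < r by rewrite !lt_min r10 r20 r30 r40 r50 r60.
have rP (x : C) : vn (x - 0) < r -> [/\ vn (x - 0) < r1, vn (x - 0) < r2 & vn (x - 0) < r3] /\
    [/\ vn (x - 0) < r4, vn (x - 0) < r5 & vn (x - 0) < r6].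
  by rewrite !lt_min => /andP[/andP[-> ->] /andP[/andP[-> ->] /andP[-> ->]]].
clearbody r => top; apply: top.
apply/(@near_vn R C 0 (fun t => \sum_(l < k) f ord_max l t * g l t^* = 0)); exists r => // t1 t1r.
apply: contrapT => /eqP q1.
have t1r' : vn (t1^* - 0 : C) < r.
  by move: t1r; rewrite !subr0 (_ : vn t1^* = vn t1) // /vn norm_conjC.
have [[a1 a2 a3] [a4 a5 a6]] := rP _ t1r; have [[b1 b2 b3] [b4 b5 b6]] := rP _ t1r'.
have := differentiable_neq0 (dq t1 t1^* a6 b6) q1.
move=> /(@near_prod R C C t1 t1^*)[r' r'0 q0].
pose U (t : C) := vn (t - 0) < r /\ vn (t - t1) < r'.
pose V (s : C) := vn (s - 0) < r /\ vn (s - t1^*) < r'.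
have Vs1 : V t1^* by split=> //; rewrite subrr vn0.
have Vopen s : V s -> \forall s' \near s, V s'.
  move=> [s1 s2]; have H1 := vn_ball_open s1; have H2 := vn_ball_open s2.
  by near=> s'; split; near: s'.
have Ut1 : \forall t \near t1, U t.
  have H1 := vn_ball_open t1r; have H2 : \forall t \near t1, vn (t - t1) < r'.
    by apply: vn_ball_open; rewrite subrr vn0.
  by near=> t; split; near: t.
have avoid (F : seq C) : exists t, U t /\ dot (Gam t) (Hp t1^*) \notin F.
  by have [l l0 dl] := lam t1 a4; exact: (avoid_values F l0 dl Ut1).
have relUV t s : U t -> V s -> \sum_(b < D.+1) (\sum_(l < k) f b l t * g l s) * E t s ^+ b = 0.
  by move=> [/rP[_ [_ ? _]] _] [/rP[_ [_ ? _]] _]; exact: rel.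
have topUV t s : U t -> V s -> \sum_(l < k) f ord_max l t * g l s != 0.
  by move=> [_ tr] [_ sr]; exact: q0.
(* In degree 0 the relation is the top coefficient itself, which is nonzero at the base point. *)
case: D f Hf rel dq q1 q0 relUV topUV => [|D] f Hf rel dq q1 q0 relUV topUV.
  have U1 : U t1 := nbhs_singleton Ut1.
  have := relUV _ _ U1 Vs1; rewrite big_ord1 expr0 mulr1 => /eqP.
  by apply/negP; have := topUV _ _ U1 Vs1; rewrite (_ : ord_max = ord0) //; exact: val_inj.
apply: (@no_algebraic_relation C n k D U V t1^* Hp Gam E f g Vs1 Vopen _ _ _ relUV topUV avoid).
- by move=> s [/rP[[_ _ ?] _] _]; exact: Hpc.
- by move=> t s [/rP[[? _ _] _] _] [/rP[[? _ _] _] _]; exact: E0.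
- by move=> t s [/rP[[_ ? _] _] _] [/rP[[_ ? _] _] _]; exact: (dE t s).
Unshelve. all: by end_near. Qed.

End Transcendence.

(** * Calculus of curves *)

Section VectorCurves.
Context (K : numFieldType).
Implicit Types (U V W : normedModType K).

Lemma diff_is_derive (f : K -> K) x : differentiable f x -> is_derive x (1 : K) f ('d f x 1).
Proof. by move=> df; apply: DeriveDef; [exact: diff_derivable|rewrite deriveE]. Qed.

Lemma near_diff_eq U V (f g : U -> V) x : differentiable f x -> differentiable g x ->
  (\forall y \near x, f y = g y) -> forall u, 'd f x u = 'd g x u.
Proof.
move=> df dg E u; rewrite -(deriveE u df) -(deriveE u dg).
exact: near_eq_derive.
Qed.

Lemma diff_affine V (p v : V) z :
  differentiable (fun z : K => p + z *: v) z /\ 'd (fun z : K => p + z *: v) z 1 = v.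
Proof.
have did : differentiable (id : K -> K) z by exact: ex_diff.
have Eid : 'd (id : K -> K) z = id :> (K -> K) by exact: diff_val.
have d1 : differentiable (fun z : K => z *: v) z by exact: (differentiableZl v did).
have d2 : differentiable (cst p : K -> V) z by exact: differentiable_cst.
split; first exact: (differentiableD d2 d1).
have -> : 'd (fun z : K => p + z *: v) z 1 = 'd (cst p : K -> V) z 1 + 'd (fun z : K => z *: v) z 1.
  by have := congr1 (fun F => F 1) (diffD d2 d1).
rewrite (congr1 (fun F => F 1) (diff_cst p z)) add0r.
rewrite (congr1 (fun F => F 1) (diffZl v did)) /=.
by rewrite (congr1 (fun F => F 1) Eid) scale1r.
Qed.

Lemma diff_along_vec V W (f : V -> W) p v (z : K) : differentiable f (p + z *: v) ->
  differentiable (fun z : K => f (p + z *: v)) z /\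
  'd (fun z : K => f (p + z *: v)) z 1 = 'd f (p + z *: v) v.
Proof.
move=> df; have [d1 E1] := diff_affine p v z.
split; first exact: (differentiable_comp d1 df).
by rewrite (congr1 (fun F => F 1) (diff_comp d1 df)) /= E1.
Qed.

Lemma diff_coord V n (h : V -> 'rV[K]_n) x l : differentiable h x ->
  differentiable (fun x => h x 0 l) x /\
  forall u, 'd (fun x => h x 0 l) x u = ('d h x u) 0 l.
Proof.
move=> dh; have dc := @differentiable_coord K 1 n (h x) 0 l.
split; first exact: (differentiable_comp dh dc).
have lin : linear (fun N : 'rV[K]_n => N 0 l) by move=> k u v; rewrite !mxE.
pose LM := GRing.isLinear.Build _ _ _ _ _ lin.
pose L : {linear 'rV[K]_n -> K} := HB.pack (fun N : 'rV[K]_n => N 0 l) LM.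
have cL : continuous L by exact: coord_continuous.
move=> u; rewrite (congr1 (fun F => F u) (diff_comp dh dc)) /=.
by rewrite (congr1 (fun F => F ('d h x u)) (@diff_lin _ _ _ L (h x) cL)).
Qed.

Lemma differentiable_row V n (h : 'I_n -> V -> K) x :
  (forall l, differentiable (h l) x) -> differentiable (fun x => \row_l h l x) x.
Proof.
move=> dh.
have -> : (fun x => \row_l h l x) = \sum_(l < n) (fun x => h l x *: delta_mx 0 l : 'rV[K]_n).
  apply/funext => y; rewrite fct_sumE [LHS]row_sum_delta.
  by apply: eq_bigr => l _; rewrite mxE.
by apply: differentiable_sum => l; exact: differentiableZl.
Qed.

Lemma diff_row V n (h : 'I_n -> V -> K) x u : (forall l, differentiable (h l) x) ->
  'd (fun x => \row_l h l x) x u = \row_l 'd (h l) x u.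
Proof.
move=> dh; have dr := differentiable_row dh.
apply/rowP => l; rewrite mxE; have [_ <-] := diff_coord l dr.
by congr ('d _ x u); apply/funext => y; rewrite mxE.
Qed.

Lemma diff_curve U1 U2 V1 V2 (A : V1 * V2 -> K) (F : U1 -> V1) (F' : U2 -> V2) (t : U1) (s : U2) :
  differentiable F t -> differentiable F' s -> differentiable A (F t, F' s) ->
  differentiable (fun p : U1 * U2 => A (F p.1, F' p.2)) (t, s) /\
  forall u w, 'd (fun p : U1 * U2 => A (F p.1, F' p.2)) (t, s) (u, w) =
    'd A (F t, F' s) ('d F t u, 'd F' s w).
Proof.
move=> dF dF' dA.
have d1 : differentiable (fun p : U1 * U2 => F p.1) (t, s).
  by apply: (@differentiable_comp _ _ _ _ fst F) => //; exact: differentiable_proj1.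
have d2 : differentiable (fun p : U1 * U2 => F' p.2) (t, s).
  by apply: (@differentiable_comp _ _ _ _ snd F') => //; exact: differentiable_proj2.
have d12 := differentiable_pair d1 d2.
split; first exact: (@differentiable_comp _ _ _ _ (fun p : U1 * U2 => (F p.1, F' p.2)) A).
have c1 : continuous (fst : U1 * U2 -> U1) by move=> q; exact: cvg_fst.
have c2 : continuous (snd : U1 * U2 -> U2) by move=> q; exact: cvg_snd.
move=> u w; rewrite (congr1 (fun G => G (u, w)) (@diff_comp _ _ _ _ (fun p : U1 * U2 => (F p.1, F' p.2)) A _ d12 dA)) /=.
rewrite (congr1 (fun G => G (u, w)) (diff_pair d1 d2)) /=.
rewrite (congr1 (fun G => G (u, w)) (@diff_comp _ _ _ _ fst F (t, s) (differentiable_proj1 _) dF)) /=.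
rewrite (congr1 (fun G => G (u, w)) (@diff_comp _ _ _ _ snd F' (t, s) (differentiable_proj2 _) dF')) /=.
rewrite (congr1 (fun G => G (u, w)) (@diff_lin _ _ _ fst (t, s) c1)).
by rewrite (congr1 (fun G => G (u, w)) (@diff_lin _ _ _ snd (t, s) c2)).
Qed.

End VectorCurves.

Section ConjugationFacts.
Context (F : numClosedFieldType).
Implicit Types (a b h s t : F).

Fact dist_conj t s : `|t - s^*| = `|t^* - s|.
Proof. by rewrite -norm_conjC rmorphB /= conjCK. Qed.

Fact conj_increment a b c h : a^* - b^* - h * c^* = (a - b - h^* * c)^*.
Proof. by rewrite !rmorphB rmorphM /= conjCK. Qed.

Fact conjD s t : (s + t)^* = s^* + t^*.
Proof. exact: rmorphD. Qed.

End ConjugationFacts.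

Section Conjugation.
Context (R : realType).
Local Notation C := R[i].

Lemma near_conj (P : C -> Prop) (s : C) :
  (\forall t \near s, P t) -> \forall t \near s^*, P t^*.
Proof.
move=> /(@near_vn R C s)[r r0 H]; apply/(@near_vn R C s^* (fun t => P t^*)); exists r => // t tr.
by apply: H; move: tr; rewrite /vn (dist_conj t s).
Qed.

Lemma diff_conj (f : C -> C) (s : C) : differentiable f (s^*) ->
  differentiable (fun s => (f s^*)^*) s /\ 'd (fun s => (f s^*)^*) s 1 = ('d f (s^*) 1)^*.
Proof.
move=> df; apply: (@diff_scalar C (fun s : C => (f s^*)^*) s ('d f (s^*) 1)^*) => e e0.
have H := near_conj (diff_eps df e0); rewrite conjC0 in H.
near=> h.
have Hh : `|f (h^* + s^*) - f s^* - 'd f (s^*) (h^*)| <= e * `|h^*| by near: h.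
have -> : (f (h + s)^*)^* - (f s^*)^* - h * ('d f (s^*) 1)^* =
    (f (h^* + s^*) - f s^* - 'd f (s^*) (h^*))^*.
  by rewrite (diffC_scale f (s^*) (h^*)) (conj_increment _ _ _ h) (conjD h s).
by move: Hh; rewrite !norm_conjC.
Unshelve. all: by end_near. Qed.

End Conjugation.

Section PartialDerivatives.
Context (K : numFieldType).

Lemma dotE n (a b : 'rV[K]_n) : dot a b = \sum_(l < n) a 0 l * b 0 l.
Proof. by rewrite /dot mxE; apply: eq_bigr => l _; rewrite mxE. Qed.

Lemma diff_partial1 (f : K * K -> K) t s : differentiable f (t, s) ->
  differentiable (fun t => f (t, s)) t /\ 'd (fun t => f (t, s)) t 1 = 'd f (t, s) (1, 0).
Proof.
pose q : K * K := (0, s); pose v : K * K := (1, 0).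
have E u : q + u *: v = (u, s).
  by congr (_, _); rewrite /= ?scaler0 ?addr0 // -[X in _ + X]/(u * 1) mulr1 add0r.
move=> df; have df' : differentiable f (q + t *: v) by rewrite E.
have H (h : K -> K) : h = (fun z => f (q + z *: v)) ->
    differentiable h t /\ 'd h t 1 = 'd f (q + t *: v) v.
  by move=> ->; exact: diff_along_vec.
have [|d1 d2] := H (fun z => f (z, s)); first by apply/funext => z; rewrite E.
split; first exact: d1.
exact: (etrans d2 (congr1 (fun x : K * K => 'd f x v) (E t))).
Qed.

Lemma diff_partial2 (f : K * K -> K) t s : differentiable f (t, s) ->
  differentiable (fun s => f (t, s)) s /\ 'd (fun s => f (t, s)) s 1 = 'd f (t, s) (0, 1).
Proof.
pose q : K * K := (t, 0); pose v : K * K := (0, 1).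
have E u : q + u *: v = (t, u).
  by congr (_, _); rewrite /= ?scaler0 ?addr0 // -[X in _ + X]/(u * 1) mulr1 add0r.
move=> df; have df' : differentiable f (q + s *: v) by rewrite E.
have H (h : K -> K) : h = (fun z => f (q + z *: v)) ->
    differentiable h s /\ 'd h s 1 = 'd f (q + s *: v) v.
  by move=> ->; exact: diff_along_vec.
have [|d1 d2] := H (fun z => f (t, z)); first by apply/funext => z; rewrite E.
split; first exact: d1.
exact: (etrans d2 (congr1 (fun x : K * K => 'd f x v) (E s))).
Qed.

Lemma diff_add (f g : K -> K) t (l1 l2 : K) :
  differentiable f t /\ 'd f t 1 = l1 -> differentiable g t /\ 'd g t 1 = l2 ->
  differentiable (fun t => f t + g t) t /\ 'd (fun t => f t + g t) t 1 = l1 + l2.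
Proof.
move=> [d1 <-] [d2 <-]; split; first exact: (differentiableD d1 d2).
exact: (congr1 (fun F => F 1) (diffD d1 d2)).
Qed.

Lemma log_deriveV (f : K -> K) x a : is_derive x (1 : K) f (a * f x) -> f x != 0 ->
  is_derive x (1 : K) (fun s => (f s)^-1) (- a * (f x)^-1).
Proof.
move=> /is_derive_diff[df Ef] f0.
apply: is_derive_eq (diff_is_derive (differentiableV df f0)) _.
rewrite (congr1 (fun F => F 1) (diffV df f0)) /= Ef.
rewrite -[LHS]/(- (f x) ^- 2 * (a * f x)).
by field.
Qed.

Lemma log_derive_quotient (f g : K -> K) (k c : K) x a b :
  is_derive x (1 : K) f (a * f x) -> is_derive x (1 : K) g (b * g x) -> g x != 0 ->
  is_derive x (1 : K) (fun s => f s * k / (c * g s)) ((a - b) * (f x * k / (c * g x))).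
Proof.
move=> df dg g0.
have D := log_deriveM (log_derive_cst x (k / c)) (log_deriveM df (log_deriveV dg g0)).
have E s : f s * k / (c * g s) = k / c * (f s / g s).
  by rewrite invfM; ring.
rewrite E; under eq_fun do rewrite E.
by rewrite add0r in D.
Qed.

End PartialDerivatives.

Section ZeroDerivative.
Context (R : realType).
Local Notation C := R[i].
Local Open Scope complex_scope.

(** Apply the fundamental theorem on the segment from 0 to t. *)
Lemma zero_derivative_const (f : C -> C) (r : R) :
  (forall t, vn t < r -> differentiable f t /\ 'd f t 1 = 0) ->
  forall t, vn t < r -> f t = f 0.
Proof.
move=> df t tr.
have D (x : R) : 0 <= x <= 1 -> cder (fun x : R => f (0 + x%:C *: t)) x 0.
  move=> /andP[x0 x1].
  have xr : vn (0 + x%:C *: t) < r.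
    by rewrite add0r vnZ rnorm_real ger0_norm //; apply: le_lt_trans tr; rewrite ler_piMl ?vn_ge0.
  have [d1 d2] := df _ xr.
  have := cder_line d1.
  by rewrite (diffC_scale f (0 + x%:C *: t) t) d2 mulr0.
have c0 : {in `[0, 1]%R, continuous (fun _ : R => 0 : C)}.
  by move=> x _; exact: (@cst_continuous R C 0 x).
have := cint_FTC ler01 c0 D.
rewrite /cint (@rint_cst R 0 1 0 ler01) mul0r => /esym/eqP.
rewrite subr_eq0 !add0r scale0r scale1r => /eqP; exact.
Qed.

End ZeroDerivative.

(** * Exponentials of a flat diastasis *)

Section ComplexPlane.
Context (R : realType).
Local Notation C := R[i].

Lemma hol0P (h : C -> C) : hol0 h <-> \forall t \near (0 : C), differentiable h t.
Proof. by []. Qed.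

Lemma hol_partial1 (f : C * C -> C) t s : differentiable f (t, s) ->
  differentiable (fun t : C => f (t, s)) t /\ 'd (fun t : C => f (t, s)) t 1 = 'd f (t, s) (1, 0).
Proof. exact (@diff_partial1 C f t s). Qed.

Lemma hol_partial2 (f : C * C -> C) t s : differentiable f (t, s) ->
  differentiable (fun s : C => f (t, s)) s /\ 'd (fun s : C => f (t, s)) s 1 = 'd f (t, s) (0, 1).
Proof. exact (@diff_partial2 C f t s). Qed.

Lemma hol_add (f g : C -> C) t (l1 l2 : C) :
  differentiable f t /\ 'd f t 1 = l1 -> differentiable g t /\ 'd g t 1 = l2 ->
  differentiable (fun t => f t + g t) t /\ 'd (fun t => f t + g t) t 1 = l1 + l2.
Proof. exact (@diff_add C f g t l1 l2). Qed.

End ComplexPlane.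

Section Disc.
Context (R : realType).
Local Notation C := R[i].
Context (n : nat) (a : C * C -> C) (G : 'I_n -> C -> C).

(** The logarithmic derivative of [a] in its second variable; it replaces log a, so no branch has to
    be chosen. *)
Let b (p : C * C) : C := 'd a p (0, 1) / a p.
Let Gp (t : C) : 'rV[C]_n := \row_l 'd (G l) t 1.
Let Hp (s : C) : 'rV[C]_n := conjv (Gp (s^*)).
Let Gam (t : C) : 'rV[C]_n := \row_l (G l t - G l 0).
(** The exponential of Calabi's diastasis up to sign: the normalization makes [E] equal to 1 on both
    axes, wherever [a] is nonzero. *)
Let E (t s : C) : C := a (t, s) * a (0, 0) / (a (t, 0) * a (0, s)).

Context (da : \forall p \near (0 : C * C), differentiable a p).
Context (a0 : a 0 != 0).
Context (dG : forall l, hol0 (G l)).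
Context (diag : \forall t \near (0 : C), 'd b (t, t^*) (1, 0) = - dot (Gp t) (conjv (Gp t))).
Context (Gp0 : \forall t \near (0 : C), Gp t != 0).

Lemma disc_near_neq0 : \forall p \near (0 : C * C), a p != 0.
Proof. exact: (differentiable_neq0 (nbhs_singleton da) a0). Qed.

Lemma disc_b_diff : \forall p \near (0 : C * C), differentiable b p.
Proof.
have d1 := @deriv_near_differentiable R (C * C)%type a 0 (0, 1) da.
have n0 := disc_near_neq0.
near=> p.
have dp1 : differentiable (fun p => 'd a p (0, 1)) p by near: p.
have dp2 : differentiable a p by near: p.
have dp3 : a p != 0 by near: p.
exact: (differentiableM dp1 (differentiableV dp2 dp3)).
Unshelve. all: by end_near. Qed.

Lemma disc_deriv_hol l : hol0 (fun t => 'd (G l) t 1).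
Proof.
apply/hol0P; exact: (@deriv_near_differentiable R C (G l) 0 1 (proj1 (hol0P _) (dG l))).
Qed.

Lemma disc_conj_hol l : hol0 (fun s => ('d (G l) (s^*) 1)^*).
Proof.
have H := @near_conj R _ 0 (proj1 (hol0P _) (disc_deriv_hol l)); rewrite conjC0 in H.
apply/hol0P; near=> s.
have ds : differentiable (fun t => 'd (G l) t 1) (s^*) by near: s.
by have [] := diff_conj ds.
Unshelve. all: by end_near. Qed.

Lemma disc_dot (t s : C) : dot (Gp t) (Hp s) =
  \sum_(l < n) 'd (G l) t 1 * ('d (G l) (s^*) 1)^*.
Proof. by rewrite dotE; apply: eq_bigr => l _; rewrite !mxE. Qed.

(** Conjugating both the argument and the value makes [Hp] holomorphic in s. Both sides are then
    holomorphic in (t, s), and agreement at s = conj t spreads by [diag_zero]. *)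
Lemma disc_off_diagonal :
  \forall p \near (0 : C * C), 'd b p (1, 0) = - dot (Gp p.1) (Hp p.2).
Proof.
pose S (p : C * C) : C := \sum_(l < n) 'd (G l) (p.1) 1 * ('d (G l) (p.2^*) 1)^*.
have d1 := @deriv_near_differentiable R (C * C)%type b 0 (1, 0) disc_b_diff.
have d2 : \forall p \near (0 : C * C), differentiable S p.
  exact (@kernel_differentiable C 'I_n xpredT _ _ disc_deriv_hol disc_conj_hol).
have d12 : \forall p \near (0 : C * C), differentiable (fun p => 'd b p (1, 0) + S p) p.
  near=> p.
  have dp1 : differentiable (fun p => 'd b p (1, 0)) p by near: p.
  have dp2 : differentiable S p by near: p.
  exact: (differentiableD dp1 dp2).
have z : \forall t \near (0 : C), 'd b (t, t^*) (1, 0) + S (t, t^*) = 0.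
  near=> t.
  have e1 : 'd b (t, t^*) (1, 0) = - dot (Gp t) (conjv (Gp t)) by near: t.
  have e2 : S (t, t^*) = dot (Gp t) (conjv (Gp t)).
    by rewrite dotE; apply: eq_bigr => l _; rewrite !mxE /= conjCK.
  exact: (etrans (congr2 +%R e1 e2) (addNr _)).
have dz := @diag_zero R (fun p => 'd b p (1, 0) + S p) d12 z.
near=> p.
have e : 'd b p (1, 0) + S p = 0 by near: p.
by rewrite disc_dot; move/eqP: e; rewrite addr_eq0 => /eqP.
Unshelve. all: by end_near. Qed.

Lemma disc_Hp_cts : \forall s \near (0 : C), {for s, continuous Hp}.
Proof.
have H : \forall s \near (0 : C), forall l, differentiable (fun s => ('d (G l) (s^*) 1)^*) s.
  exact: (filter_forall _ disc_conj_hol).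
near=> s.
have ds : forall l, differentiable (fun s => ('d (G l) (s^*) 1)^*) s by near: s.
have HpE : Hp = (fun s => \row_l ('d (G l) (s^*) 1)^*).
  by apply/funext => s'; apply/rowP => l; rewrite !mxE.
rewrite HpE; exact: (differentiable_continuous (differentiable_row ds)).
Unshelve. all: by end_near. Qed.

Lemma disc_Gam_diff (w : 'rV[C]_n) t : (forall l, differentiable (G l) t) ->
  is_derive t (1 : C) (fun t => dot (Gam t) w) (dot (Gp t) w).
Proof.
move=> dGt.
have -> : (fun t => dot (Gam t) w) = (fun t => \sum_(l < n) w 0 l * (G l t - G l 0)).
  by apply/funext => t'; rewrite dotE; apply: eq_bigr => l _; rewrite mxE mulrC.
have -> : dot (Gp t) w = \sum_(l < n) w 0 l * 'd (G l) t 1.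
  by rewrite dotE; apply: eq_bigr => l _; rewrite mxE mulrC.
apply: (@is_derive_lincomb C 'I_n (index_enum 'I_n) (fun l => w 0 l) (fun l t => G l t - G l 0)) => l.
have D := is_deriveB (diff_is_derive (dGt l)) (is_derive_cst (G l 0) t (1 : C)).
by rewrite subr0 in D.
Qed.

Lemma dot_conjv_neq0 (v : 'rV[C]_n) : v != 0 -> dot v (conjv v) != 0.
Proof.
move=> v0; rewrite dotE.
have -> : \sum_(l < n) v 0 l * (conjv v) 0 l = \sum_(l < n) `|v 0 l| ^+ 2.
  by apply: eq_bigr => l _; rewrite mxE normCK.
apply: contraNneq v0 => /eqP; rewrite psumr_eq0 => [/allP H|l _]; last exact: exprn_ge0.
apply/eqP/rowP => l; have := H l (mem_index_enum l).
by rewrite /= expf_eq0 /= normr_eq0 mxE => /eqP.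
Qed.

Lemma disc_G_near : \forall t \near (0 : C), forall l, differentiable (G l) t.
Proof. exact (filter_forall _ dG). Qed.

(** The derivative of the frequency at t, paired at s = conj t, is the squared length of G'(t). *)
Lemma disc_lam : \forall t \near (0 : C), exists2 l : C, l != 0 &
     is_derive t (1 : C) (fun t' => dot (Gam t') (Hp t^*)) l.
Proof.
have H := disc_G_near.
near=> t; exists (dot (Gp t) (Hp t^*)).
  rewrite (_ : Hp t^* = conjv (Gp t)); last by rewrite /Hp conjCK.
  by apply: dot_conjv_neq0; near: t.
by apply: disc_Gam_diff; near: t.
Unshelve. all: by end_near. Qed.

(** The sum of [b] and the pairing has zero t-derivative by [disc_off_diagonal], and [Gam 0] is
    0. *)
Lemma disc_potential : exists2 r : R, 0 < r & forall t s, vn t < r -> vn s < r ->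
  b (t, s) - b (0, s) = - dot (Gam t) (Hp s).
Proof.
have /(@near_prod R C C 0 0)[r1 r10 db] := disc_b_diff.
have /(@near_prod R C C 0 0)[r2 r20 off] := disc_off_diagonal.
have /(@near_vn R C 0)[r3 r30 dGr] := disc_G_near.
exists (Num.min r1 (Num.min r2 r3)); first by rewrite !lt_min r10 r20 r30.
move=> t s tr; rewrite !lt_min => /and3P[s1 s2 s3].
have H t' : vn t' < Num.min r1 (Num.min r2 r3) ->
    differentiable (fun t => b (t, s) + dot (Gam t) (Hp s)) t' /\
    'd (fun t => b (t, s) + dot (Gam t) (Hp s)) t' 1 = 0.
  rewrite !lt_min => /and3P[t1 t2 t3].
  have dbt : differentiable b (t', s) by apply: db; rewrite subr0.
  have D1 := hol_partial1 dbt.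
  have dGt l : differentiable (G l) t' by apply: dGr; rewrite subr0.
  have D2 := @is_derive_diff C (fun t => dot (Gam t) (Hp s)) t' _ (disc_Gam_diff (Hp s) dGt).
  have [d12 e12] := @hol_add R (fun t => b (t, s)) (fun t => dot (Gam t) (Hp s)) t' _ _ D1 D2.
  have e3 : 'd b (t', s) (1, 0) = - dot (Gp t') (Hp s) by apply: (off t' s); rewrite subr0.
  split; first exact: d12.
  exact (etrans e12 (etrans (congr1 (fun u => u + dot (Gp t') (Hp s)) e3) (addNr _))).
have := zero_derivative_const H tr.
rewrite (_ : Gam 0 = 0); last by apply/rowP => l; rewrite !mxE subrr.
rewrite [dot 0 _]dotE big1 ?addr0 => [<-|l _]; last by rewrite mxE mul0r.
by rewrite opprD addNKr.
Qed.

Lemma disc_E_neq0 : \forall p \near (0 : C * C), E p.1 p.2 != 0.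
Proof.
have /(@near_prod R C C 0 0)[r r0 H] := disc_near_neq0.
apply/(@near_prod R C C 0 0 (fun p => E p.1 p.2 != 0)); exists r => // t s tr sr.
have z : vn (0 - 0 : C) < r by rewrite subr0 vn0.
by rewrite /E mulf_neq0 ?invr_eq0 ?mulf_neq0 ?H.
Qed.

(** The factors a(t, 0) and a(0, 0) are constant in s, so the logarithmic derivative of [E] is b(t,
    s) - b(0, s). *)
Lemma disc_E_derive : \forall p \near (0 : C * C), is_derive p.2 (1 : C) (E p.1)
      (- dot (Gam p.1) (Hp p.2) * E p.1 p.2).
Proof.
have [r1 r10 pot] := disc_potential.
have /(@near_prod R C C 0 0)[r2 r20 n0] := disc_near_neq0.
have /(@near_prod R C C 0 0)[r3 r30 dar] := da.
apply/(@near_prod R C C 0 0 (fun p => is_derive p.2 (1 : C) (E p.1)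
      (- dot (Gam p.1) (Hp p.2) * E p.1 p.2))).
exists (Num.min r1 (Num.min r2 r3)) => [|t s]; first by rewrite !lt_min r10 r20 r30.
rewrite !lt_min => /and3P[t1 t2 t3] /and3P[s1 s2 s3] /=.
have z2 : vn (0 - 0 : C) < r2 by rewrite subr0 vn0.
have z3 : vn (0 - 0 : C) < r3 by rewrite subr0 vn0.
have D u : vn (u - 0) < r2 -> vn (u - 0) < r3 ->
    is_derive s (1 : C) (fun s => a (u, s)) (b (u, s) * a (u, s)).
  move=> u2 u3; have [d1 e1] := hol_partial2 (dar u s u3 s3).
  have := diff_is_derive d1; rewrite e1 /b divfK //.
  exact: n0.
have Dq := @log_derive_quotient C (fun s => a (t, s)) (fun s => a (0, s)) (a (0, 0)) (a (t, 0)) s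
  _ _ (D t t2 t3) (D 0 z2 z3) (n0 0 s z2 s2).
have t1' : vn t < r1 by move: t1; rewrite subr0.
have s1' : vn s < r1 by move: s1; rewrite subr0.
exact: (is_derive_eq Dq (congr1 (fun u => u * E t s) (pot t s t1' s1'))).
Qed.

Theorem disc_transcendental D k (f : 'I_D.+1 -> 'I_k -> C -> C) (g : 'I_k -> C -> C) :
  (forall m l, hol0 (f m l)) -> (forall l, hol0 (g l)) ->
  (\forall p \near (0 : C * C), \sum_(m < D.+1) (\sum_(l < k) f m l p.1 * g l p.2) *
     (a (p.1, p.2) * a (0, 0) / (a (p.1, 0) * a (0, p.2))) ^+ m = 0) ->
  ~ (\forall t \near (0 : C), \sum_(l < k) f ord_max l t * g l t^* = 0) -> False.
Proof.
exact: (@no_relation R n D k Hp Gam E f g disc_E_neq0 disc_E_derive disc_Hp_cts disc_lam).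
Qed.

End Disc.

(** * The polarized potential of a Hartogs domain *)

Section BlockMaps.
Context (K : numFieldType) (d0 d : nat).
Local Notation V := 'rV[K]_(d0 + d).

Lemma differentiable_coord_comp (U : normedModType K) n (h : U -> 'rV[K]_n) x l :
  differentiable h x -> differentiable (fun x => h x 0 l) x.
Proof. by move=> /(diff_coord l)[]. Qed.

Lemma rsubmx_differentiable (q : V) : differentiable (fun q : V => rsubmx q) q.
Proof.
have -> : (fun q : V => rsubmx q) = (fun q => \row_l q 0 (rshift d0 l)).
  by apply/funext => q'; apply/rowP => l; rewrite !mxE.
by apply: differentiable_row => l; exact: differentiable_coord.
Qed.

Lemma join_differentiable (Q : V * V) :
  differentiable (fun Q : V * V => row_mx (rsubmx Q.1) (rsubmx Q.2)) Q.
Proof.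
have d1 : differentiable (fst : V * V -> V) Q by exact: differentiable_proj1.
have d2 : differentiable (snd : V * V -> V) Q by exact: differentiable_proj2.
pose h (i : 'I_(d + d)) (Q : V * V) := match fintype.split i with
  inl l => Q.1 0 (rshift d0 l) | inr l => Q.2 0 (rshift d0 l) end.
have -> : (fun Q : V * V => row_mx (rsubmx Q.1) (rsubmx Q.2)) = (fun Q => \row_i h i Q).
  apply/funext => Q'; apply/rowP => i; rewrite !mxE /h.
  by case: (fintype.split i) => l; rewrite mxE.
apply: differentiable_row => i; rewrite /h.
by case: (fintype.split i) => l; exact: differentiable_coord_comp.
Qed.

Lemma pairing_differentiable (Q : V * V) :
  differentiable (fun Q : V * V => \sum_(j < d0) lsubmx Q.1 0 j * lsubmx Q.2 0 j) Q.
Proof.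
have d1 : differentiable (fst : V * V -> V) Q by exact: differentiable_proj1.
have d2 : differentiable (snd : V * V -> V) Q by exact: differentiable_proj2.
have -> : (fun Q : V * V => \sum_(j < d0) lsubmx Q.1 0 j * lsubmx Q.2 0 j) =
    \sum_(j < d0) (fun Q : V * V => Q.1 0 (lshift d j) * Q.2 0 (lshift d j)).
  by apply/funext => Q'; rewrite fct_sumE; apply: eq_bigr => j _; rewrite !mxE.
apply: differentiable_sum => j.
by apply: differentiableM; exact: differentiable_coord_comp.
Qed.

Lemma diff_split (U1 U2 : normedModType K) (f : U1 * U2 -> K) Q u w :
  'd f Q (u, w) = 'd f Q (u, 0) + 'd f Q (0, w).
Proof. by rewrite -linearD; congr ('d f Q _); congr (_, _); rewrite /= ?addr0 ?add0r. Qed.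

Lemma diff_splitZ (U1 U2 : normedModType K) (f : U1 * U2 -> K) Q u w (a b : K) :
  'd f Q (a *: u, b *: w) = a * 'd f Q (u, 0) + b * 'd f Q (0, w).
Proof.
rewrite diff_split; congr (_ + _).
  have -> : (a *: u, 0) = a *: (u, 0) :> U1 * U2 by congr (_, _); rewrite /= scaler0.
  by rewrite linearZ.
have -> : (0, b *: w) = b *: (0, w) :> U1 * U2 by congr (_, _); rewrite /= scaler0.
by rewrite linearZ.
Qed.

Lemma diff_basis2 (U1 : normedModType K) n (f : U1 * 'rV[K]_n -> K) Q (w : 'rV[K]_n) :
  'd f Q (0, w) = \sum_(k < n) w 0 k * 'd f Q (0, delta_mx 0 k).
Proof.
have -> : (0, w) = \sum_(k < n) w 0 k *: (0, delta_mx 0 k) :> U1 * 'rV[K]_n.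
  have -> : \sum_(k < n) w 0 k *: (0, delta_mx 0 k) =
      (\sum_(k < n) w 0 k *: 0, \sum_(k < n) w 0 k *: delta_mx 0 k) :> U1 * 'rV[K]_n.
    by elim/big_rec3: _ => // k x y z _ ->.
  by rewrite -row_sum_delta big1 // => k _; rewrite scaler0.
by rewrite linear_sum; apply: eq_bigr => k _; rewrite linearZ.
Qed.

Lemma diff_basis1 (U2 : normedModType K) n (f : 'rV[K]_n * U2 -> K) Q (u : 'rV[K]_n) :
  'd f Q (u, 0) = \sum_(k < n) u 0 k * 'd f Q (delta_mx 0 k, 0).
Proof.
have -> : (u, 0) = \sum_(k < n) u 0 k *: (delta_mx 0 k, 0) :> 'rV[K]_n * U2.
  have -> : \sum_(k < n) u 0 k *: (delta_mx 0 k, 0) =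
      (\sum_(k < n) u 0 k *: delta_mx 0 k, \sum_(k < n) u 0 k *: 0) :> 'rV[K]_n * U2.
    by elim/big_rec3: _ => // k x y z _ ->.
  congr (_, _); first exact: row_sum_delta.
  by rewrite big1 // => k _; rewrite scaler0.
by rewrite linear_sum; apply: eq_bigr => k _; rewrite linearZ.
Qed.

End BlockMaps.

Section RealDirections.
Context (R : realType) (N : nat).
Local Notation C := R[i].
Local Notation V := 'rV[C]_N.
Local Open Scope complex_scope.

Lemma vn_conjv (z : V) : vn (conjv z) = vn z.
Proof.
rewrite /vn; congr (complex.Re _); rewrite /Num.norm /= /mx_norm; congr (_%:num).
apply: eq_bigr => i _; apply: val_inj => /=.
by rewrite mxE norm_conjC.
Qed.

Lemma conjvD (z w : V) : conjv (z + w) = conjv z + conjv w.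
Proof. by apply/rowP => i; rewrite !mxE rmorphD. Qed.

Lemma conjvB (z w : V) : conjv (z - w) = conjv z - conjv w.
Proof. by apply/rowP => i; rewrite !mxE rmorphB. Qed.

Lemma conjvK (z : V) : conjv (conjv z) = z.
Proof. by apply/rowP => i; rewrite !mxE conjCK. Qed.

Lemma conjv_cts : continuous (@conjv R N).
Proof.
move=> z P /(@near_vn R V (conjv z) P)[r r0 H].
apply/(@near_vn R V z (fun z => P (conjv z))); exists r => // w wr; apply: H.
by rewrite -conjvB vn_conjv.
Qed.

Lemma conjvZ_real (t : R) (v : V) : conjv (t%:C *: v) = t%:C *: conjv v.
Proof.
apply/rowP => i; rewrite !mxE rmorphM; congr (_ * _).
by rewrite /= conj_Creal // complex_real.
Qed.

Lemma rderive_cder (f : V -> C) v p l : cder (fun t => f (p + t%:C *: v)) 0 l ->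
  rderive f v p = l.
Proof.
move=> [h1 h2]; rewrite /rderive !derive1E (@derive_val _ _ _ _ _ _ _ h1) (@derive_val _ _ _ _ _ _ _ h2).
by case: l {h1 h2}.
Qed.

Lemma near_real_line (P : V -> Prop) (p v : V) : (\forall q \near p, P q) ->
  \forall t \near (0 : R), P (p + t%:C *: v).
Proof.
move=> HP.
have c1 : (fun e : C => p + e *: v) @ (0 : C) --> p.
  have E0 : p = p + 0 *: v by rewrite scale0r addr0.
  by rewrite [X in _ --> X]E0; exact: (@affine_line_cts C _ p v 0).
exact: (@real_complex_cts R 0 _ (c1 _ HP)).
Qed.

Lemma rderive_near (f f' : V -> C) (v p : V) : (\forall q \near p, f q = f' q) ->
  rderive f v p = rderive f' v p.
Proof.
move=> /(@near_real_line _ p v) E; rewrite /rderive !derive1E.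
congr (_ +i* _); apply: near_eq_derive; apply: filterS E => t -> //.
Qed.

Lemma cder_eq (f f' : R -> C) x l l' : f =1 f' -> l = l' -> cder f x l -> cder f' x l'.
Proof. by move=> /funext -> ->. Qed.

Lemma rderive_diag (Kf : V * V -> C) v p : differentiable Kf (p, conjv p) ->
  cder (fun t : R => Kf (p + t%:C *: v, conjv (p + t%:C *: v))) 0
    ('d Kf (p, conjv p) (v, conjv v)).
Proof.
move=> dK.
pose q : V * V := (p, conjv p); pose w : V * V := (v, conjv v).
have E (t : R) : q + t%:C *: w = (p + t%:C *: v, conjv (p + t%:C *: v)).
  by rewrite conjvD conjvZ_real.
have q0 : q + 0%:C *: w = q by rewrite scale0r addr0.
have dK0 : differentiable Kf (q + 0%:C *: w) by rewrite q0.
apply: (cder_eq _ _ (cder_line dK0)) => [t|]; first by rewrite E.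
exact: (congr1 (fun x : V * V => 'd Kf x w) q0).
Qed.

End RealDirections.

Section GraphContinuity.
Context (K : numFieldType) (V W : normedModType K).

Lemma graph_comp_cts (f : V * W -> K) (g : V -> W) (q : V) : {for q, continuous g} ->
  {for (q, g q), continuous f} -> {for q, continuous (fun q => f (q, g q))}.
Proof.
move=> cg cf; apply: (@continuous_comp V (V * W)%type K (fun q => (q, g q)) f) => //.
by apply: cvg_pair; [exact: cvg_id|exact: cg].
Qed.

End GraphContinuity.

Section PolarizedPotential.
Context (R : realType) (d0 d : nat) (D : set 'rV[R[i]]_d).
Context (phi : 'rV[R[i]]_d -> R) (Phi : 'rV[R[i]]_(d + d) -> R[i]).
Local Notation C := R[i].
Local Notation V := 'rV[C]_(d0 + d).
Local Open Scope complex_scope.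
Local Notation Omega := (hartogs_domain (d0 := d0) D phi).

(** The second slot already holds the conjugate variable, so the pairing has no conjugation and
    [polar] is holomorphic in both slots. *)
Definition polar (Q : V * V) : C := Phi (row_mx (rsubmx Q.1) (rsubmx Q.2)) -
  \sum_(j < d0) lsubmx Q.1 0 j * lsubmx Q.2 0 j.

Definition defect (q : V) : R := phi (rsubmx q) - sqnorm (lsubmx q).

Context (Dopen : open D) (pol : polarization_on D phi Phi).

Lemma polar_diff (Q : V * V) : D (rsubmx Q.1) -> D (conjv (rsubmx Q.2)) ->
  differentiable polar Q.
Proof.
move=> D1 D2.
have dP : differentiable Phi (row_mx (rsubmx Q.1) (rsubmx Q.2)).
  by apply: pol.1; split; rewrite ?row_mxKl ?row_mxKr.
have dc := @differentiable_comp C _ _ _ (fun Q : V * V => row_mx (rsubmx Q.1) (rsubmx Q.2)) Phi Q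
  (@join_differentiable C d0 d Q) dP.
exact: (differentiableB dc (@pairing_differentiable C d0 d Q)).
Qed.

Lemma polar_diag (q : V) : D (rsubmx q) -> polar (q, conjv q) = (defect q)%:C.
Proof.
move=> Dq; rewrite /polar /defect /=.
have -> : rsubmx (conjv q) = conjv (rsubmx q) by apply/rowP => l; rewrite !mxE.
rewrite pol.2 // rmorphB; congr (_ - _).
rewrite /sqnorm rmorph_sum; apply: eq_bigr => j _.
by rewrite !mxE /= add_Re2_Im2 normCK.
Qed.

Lemma defect_gt0 (q : V) : Omega q -> 0 < defect q.
Proof. by move=> [_]; rewrite subr_gt0. Qed.

Lemma near_base (q : V) : D (rsubmx q) -> \forall q' \near q, D (rsubmx q').
Proof.
move=> Dq; have c : {for q, continuous (fun q : V => rsubmx q)}.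
  exact: (differentiable_continuous (@rsubmx_differentiable C d0 d q)).
exact: (c _ (open_nbhs_nbhs (conj Dopen Dq))).
Qed.

Lemma near_polar_diff (q : V) : D (rsubmx q) ->
  \forall Q \near (q, conjv q), differentiable polar Q.
Proof.
move=> /near_base /(@near_vn R V q)[r r0 H].
apply: (proj2 (@near_prod R V V q (conjv q) (fun Q => differentiable polar Q))).
exists r; [exact: r0|move=> a b ar br].
apply: polar_diff; first exact: H.
have -> : conjv (rsubmx (a, b).2) = rsubmx (conjv b) by apply/rowP => l; rewrite !mxE.
by apply: H; rewrite -vn_conjv conjvB conjvK.
Qed.

Lemma diag_cts (Kf : V * V -> C) (q : V) : {for (q, conjv q), continuous Kf} ->
  {for q, continuous (fun q => Kf (q, conjv q))}.
Proof.
by move=> cK; exact: (@graph_comp_cts C V V Kf (@conjv R _) q (@conjv_cts R _ q) cK).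
Qed.

(** The defining inequality is open because [defect] is the real part of [polar] along the graph of
    conjugation, and that is continuous. *)
Lemma near_hartogs (q : V) : Omega q -> \forall q' \near q, Omega q'.
Proof.
move=> Oq; have Dq : D (rsubmx q) := Oq.1.
have cA : {for q, continuous (fun q => polar (q, conjv q))}.
  exact: (diag_cts (differentiable_continuous (nbhs_singleton (near_polar_diff Dq)))).
have cR : {for q, continuous (fun q => complex.Re (polar (q, conjv q)))}.
  by apply: (@continuous_comp V C R _ (@complex.Re R)) => //; exact: Re_cts.
have nD := near_base Dq.
have nR : \forall q' \near q, 0 < complex.Re (polar (q', conjv q')).
  apply: (cvgr_gt _ cR); rewrite polar_diag //.
  exact: defect_gt0.
near=> q'; have Dq' : D (rsubmx q') by near: q'.
split=> //; rewrite -subr_gt0.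
have : 0 < complex.Re (polar (q', conjv q')) by near: q'.
by rewrite polar_diag.
Unshelve. all: by end_near. Qed.

Lemma polar_neq0 (q : V) : Omega q -> polar (q, conjv q) != 0.
Proof.
move=> Oq; rewrite polar_diag; last exact: Oq.1.
by rewrite (_ : 0 = 0%:C) // (inj_eq (@complexI R)) gt_eqF // defect_gt0.
Qed.

(** Near q the function [polar] is real along the graph of conjugation, so its derivative there has
    zero imaginary part and the real chain rule for [ln] applies. *)
Lemma rderive_log (q v : V) : Omega q ->
  rderive (fun q => (ln (defect q))%:C) v q =
    'd polar (q, conjv q) (v, conjv v) / polar (q, conjv q).
Proof.
move=> Oq; have Dq : D (rsubmx q) := Oq.1.
have [dRe dIm] := rderive_diag v (nbhs_singleton (near_polar_diff Dq)).
set l := 'd polar _ _ in dRe dIm *.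
have nD := near_real_line v (near_base Dq).
have dRe' : is_derive (0 : R) (1 : R) (fun t : R => defect (q + t%:C *: v)) (complex.Re l).
  apply: near_eq_is_derive dRe; near=> t.
  by rewrite polar_diag //; near: t.
have Im0 : complex.Im l = 0.
  apply: (is_derive_near0 dIm); near=> t.
  by rewrite polar_diag //; near: t.
have u0 : 0 < defect (q + 0%:C *: v) by rewrite scale0r addr0; exact: defect_gt0.
have dln := @is_derive1_comp R (@ln R) (fun t : R => defect (q + t%:C *: v)) 0 _ _ (is_derive1_ln u0) dRe'.
rewrite scale0r addr0 in dln.
rewrite polar_diag // (_ : l = (complex.Re l)%:C); last by case: (l) Im0 => ? ? /= ->.
rewrite -[RHS](_ : ((defect q)^-1 * complex.Re l)%:C = _); last first.
  by rewrite rmorphM fmorphV mulrC.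
apply: rderive_cder; split; first exact: dln.
exact: is_derive_cst.
Unshelve. all: by end_near. Qed.

End PolarizedPotential.

Section WirtingerAlgebra.
Context (K : fieldType) (i : K).

(** Here x and y are the derivatives in the first and second slot: the direction e_j gives x + y and
    the direction i e_j gives i x - i y. The combination for d/dz keeps x, that for d/dzbar keeps
    y. *)
Fact wirtinger_dz (x y : K) : 2%:R != 0 :> K -> i * i = -1 ->
  (x + y - i * (i * x + - i * y)) / 2%:R = x.
Proof.
move=> two0 ii; apply: (mulIf two0); rewrite divfK // mulrDr !mulrA mulrN ii.
ring.
Qed.

Fact wirtinger_dzbar (x y a : K) : 2%:R != 0 :> K -> i * i = -1 ->
  ((x + y) / a + i * ((i * x + - i * y) / a)) / 2%:R = y / a.
Proof.
move=> two0 ii; apply: (mulIf two0); rewrite divfK // mulrA mulrDr !mulrA mulrN ii.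
ring.
Qed.

End WirtingerAlgebra.

Section Wirtinger.
Context (R : realType) (N : nat).
Local Notation C := R[i].
Local Notation V := 'rV[C]_N.
Local Open Scope complex_scope.

Fact two_neq0 : 2%:R != 0 :> C.
Proof. by rewrite pnatr_eq0. Qed.

Fact imag_sq : 'i * 'i = -1 :> C.
Proof. by rewrite -expr2 sqrCi. Qed.

Lemma conjv_delta (j : 'I_N) : conjv (delta_mx 0 j) = delta_mx 0 j :> V.
Proof. by apply/rowP => l; rewrite !mxE; case: (_ && _); rewrite ?conjC1 ?conjC0. Qed.

Lemma conjv_i_delta (j : 'I_N) : conjv ('i *: delta_mx 0 j) = (- 'i) *: delta_mx 0 j :> V.
Proof.
rewrite -[in RHS]conjv_delta; apply/rowP => l; rewrite !mxE rmorphM; congr (_ * _).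
exact: conjCi.
Qed.

Lemma rderive_diag_basis (Kf : V * V -> C) p (j : 'I_N) : differentiable Kf (p, conjv p) ->
  'd Kf (p, conjv p) (delta_mx 0 j, conjv (delta_mx 0 j)) =
    'd Kf (p, conjv p) (delta_mx 0 j, 0) + 'd Kf (p, conjv p) (0, delta_mx 0 j) /\
  'd Kf (p, conjv p) ('i *: delta_mx 0 j, conjv ('i *: delta_mx 0 j)) =
    'i * 'd Kf (p, conjv p) (delta_mx 0 j, 0) + - 'i * 'd Kf (p, conjv p) (0, delta_mx 0 j).
Proof.
move=> dK; rewrite conjv_i_delta conjv_delta; split; first exact: (@diff_split C).
exact: (@diff_splitZ C).
Qed.

Lemma dz_diag (Kf : V * V -> C) p (j : 'I_N) : differentiable Kf (p, conjv p) ->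
  dz j (fun q => Kf (q, conjv q)) p = 'd Kf (p, conjv p) (delta_mx 0 j, 0).
Proof.
move=> dK; have [e1 e2] := rderive_diag_basis j dK.
rewrite /dz (rderive_cder (rderive_diag (delta_mx 0 j) dK)).
rewrite (rderive_cder (rderive_diag ('i *: delta_mx 0 j) dK)) e1 e2.
exact: (wirtinger_dz _ _ two_neq0 imag_sq).
Qed.

Lemma dz_near (f f' : V -> C) p j : (\forall q \near p, f q = f' q) -> dz j f p = dz j f' p.
Proof. by move=> E; rewrite /dz !(rderive_near _ E). Qed.

(** The pair e_j, e_k gives h_jk = h_kj, and the pair e_j, i e_k gives h_jk = - h_kj. *)
Lemma form11_eq0 (h : 'M[C]_N) : (forall v w, form11 h v w = 0) -> forall j k, h j k = 0.
Proof.
move=> H j k.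
have E (a b : 'I_N) (c e : C) : form11 h (c *: delta_mx 0 a) (e *: delta_mx 0 b) =
    h a b * (c * e^*) - h b a * (e * c^*).
  rewrite /form11; under eq_bigr do under eq_bigr do rewrite mulrBr.
  under eq_bigr do rewrite big_split /=; rewrite big_split /=; congr (_ + _).
    rewrite (bigD1 a) //= (bigD1 b) //= [X in _ + X]big1 ?addr0; last first.
      by move=> l la; rewrite big1 // => m _; rewrite !mxE (negPf la) andbF mulr0 !mul0r mulr0.
    rewrite [X in _ + X]big1 ?addr0; last first.
      by move=> m mb; rewrite !mxE (negPf mb) andbF mulr0 conjC0 !mulr0.
    by rewrite !mxE !eqxx /= !mulr1.
  rewrite (bigD1 b) //= (bigD1 a) //= [X in _ + X]big1 ?addr0; last first.
    by move=> l lb; rewrite big1 // => m _; rewrite !mxE (negPf lb) andbF mulr0 !mul0r mulr0 oppr0.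
  rewrite [X in _ + X]big1 ?addr0; last first.
    by move=> m ma; rewrite !mxE (negPf ma) andbF mulr0 conjC0 !mulr0 oppr0.
  by rewrite !mxE !eqxx /= !mulr1.
have h1 := H (1 *: delta_mx 0 j) (1 *: delta_mx 0 k).
have h2 := H (1 *: delta_mx 0 j) ('i *: delta_mx 0 k).
rewrite E conjC1 !mulr1 in h1; rewrite E conjC1 mulr1 mul1r conjCi in h2.
have i0 : 'i != 0 :> C by rewrite neq0Ci.
have /eqP : 'i * 2%:R * h j k = 0.
  rewrite -[RHS]oppr0 -[in RHS]h2; move/eqP: h1; rewrite subr_eq0 => /eqP <-.
  by move: (h j k) => x; ring.
by rewrite !mulf_eq0 (negPf i0) (negPf two_neq0) => /eqP.
Qed.

End Wirtinger.

Section MetricEntries.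
Context (R : realType) (d0 d : nat) (D : set 'rV[R[i]]_d).
Context (phi : 'rV[R[i]]_d -> R) (Phi : 'rV[R[i]]_(d + d) -> R[i]).
Local Notation C := R[i].
Local Notation V := 'rV[C]_(d0 + d).
Local Open Scope complex_scope.
Local Notation Omega := (hartogs_domain (d0 := d0) D phi).
Local Notation A := (@polar R d0 d Phi).
Context (Dopen : open D) (pol : polarization_on D phi Phi).

(** The holomorphic extension of d/dzbar_k of the log potential to pairs of points; a quotient, so
    that no complex logarithm is involved. *)
Definition log_slope (k : 'I_(d0 + d)) (Q : V * V) : C := 'd A Q (0, delta_mx 0 k) / A Q.

Lemma log_slope_diff k p : Omega p -> differentiable (log_slope k) (p, conjv p).
Proof.
move=> Op; have dA := near_polar_diff Dopen pol Op.1.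
have d1 := @deriv_differentiable R _ A (p, conjv p) (0, delta_mx 0 k) dA.
exact: (differentiableM d1 (differentiableV (nbhs_singleton dA) (polar_neq0 pol Op))).
Qed.

Lemma dzbar_log k q : Omega q ->
  dzbar k (fun q => (ln (@defect R d0 d phi q))%:C) q = log_slope k (q, conjv q).
Proof.
move=> Oq; have dA := nbhs_singleton (near_polar_diff Dopen pol Oq.1).
have [e1 e2] := rderive_diag_basis k dA.
rewrite /dzbar !(rderive_log Dopen pol _ Oq) e1 e2.
exact: (wirtinger_dzbar _ _ _ (two_neq0 R) (imag_sq R)).
Qed.

Lemma ddbar_log j k p : Omega p ->
  dz j (dzbar k (fun q => (ln (@defect R d0 d phi q))%:C)) p =
    'd (log_slope k) (p, conjv p) (delta_mx 0 j, 0).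
Proof.
move=> Op; rewrite -(dz_diag j (log_slope_diff k Op)); apply: dz_near.
by apply: filterS (near_hartogs Dopen pol Op) => q Oq; exact: dzbar_log.
Qed.

(** A (1,1)-form determines its matrix by [form11_eq0]; the minus sign is that of [omega_hartogs].
    On the graph of conjugation, d/dz_j acts only on the first slot of [log_slope]. *)
Lemma metric_entry (g : V -> 'M[C]_(d0 + d)) p : Omega p ->
  (forall v w, kahler_form g p v w = omega_hartogs phi p v w) ->
  forall j k, g p j k = - 'd (log_slope k) (p, conjv p) (delta_mx 0 j, 0).
Proof.
move=> Op Hg j k.
pose M : 'M[C]_(d0 + d) :=
  \matrix_(j, k) dz j (dzbar k (fun q => (ln (@defect R d0 d phi q))%:C)) p.
have H v w : form11 (g p + M) v w = 0.
  have i2 : 'i / 2%:R != 0 :> C by rewrite mulf_neq0 ?neq0Ci ?invr_eq0 ?two_neq0.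
  apply: (mulfI i2); rewrite mulr0.
  have -> : form11 (g p + M) v w = form11 (g p) v w + form11 M v w.
    rewrite /form11 -big_split; apply: eq_bigr => a _ /=.
    by rewrite -big_split; apply: eq_bigr => b _ /=; rewrite mxE mulrDl.
  by rewrite mulrDr -[X in X + _]/(kahler_form g p v w) Hg /omega_hartogs mulNr addNr.
have := form11_eq0 H j k; rewrite !mxE (ddbar_log j k Op) => /eqP.
by rewrite addr_eq0 => /eqP.
Qed.

End MetricEntries.

(** * Curves in both manifolds *)

Section OneVariable.
Context (K : numFieldType) (V1 V2 : normedModType K).

Lemma diff_first (A : V1 * V2 -> K) (F : K -> V1) (q : V2) (t : K) :
  differentiable F t -> differentiable A (F t, q) ->
  differentiable (fun t => A (F t, q)) t /\
  'd (fun t => A (F t, q)) t 1 = 'd A (F t, q) ('d F t 1, 0).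
Proof.
move=> dF dA; have dc : differentiable (cst q : K -> V2) t by exact: differentiable_cst.
have dp := differentiable_pair dF dc.
split; first exact: (@differentiable_comp _ _ _ _ (fun t : K => (F t, q)) A).
rewrite (congr1 (fun G => G 1) (@diff_comp _ _ _ _ (fun t : K => (F t, q)) A _ dp dA)) /=.
rewrite (congr1 (fun G => G 1) (diff_pair dF dc)) /=.
by rewrite (congr1 (fun G => G 1) (diff_cst q t)).
Qed.

Lemma diff_lincomb k (c : 'I_k -> K) (f : 'I_k -> K -> K) (l : 'I_k -> K) t :
  (forall i, differentiable (f i) t /\ 'd (f i) t 1 = l i) ->
  differentiable (fun t => \sum_(i < k) c i * f i t) t /\
  'd (fun t => \sum_(i < k) c i * f i t) t 1 = \sum_(i < k) c i * l i.
Proof.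
move=> H; apply: is_derive_diff; apply: is_derive_lincomb => i.
by have [df <-] := H i; exact: diff_is_derive.
Qed.

Fact opp_pairing k (x y z : 'I_k -> K) (c : K) : (forall j, y j = - z j) ->
  c * (\sum_j x j * y j) = - ((\sum_j x j * z j) * c).
Proof.
move=> yz; rewrite mulrC -mulNr -sumrN; congr (_ * _); apply: eq_bigr => j _.
by rewrite yz mulrN.
Qed.

End OneVariable.

Section CurveInHartogsDomain.
Context (R : realType) (d0 d n : nat) (D : set 'rV[R[i]]_d).
Context (phi : 'rV[R[i]]_d -> R) (Phi : 'rV[R[i]]_(d + d) -> R[i]).
Local Notation C := R[i].
Local Notation V := 'rV[C]_(d0 + d).
Local Notation Omega := (hartogs_domain (d0 := d0) D phi).
Local Notation A := (@polar R d0 d Phi).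
Local Notation slope := (@log_slope R d0 d Phi).
Context (Dopen : open D) (pol : polarization_on D phi Phi).
Context (g : V -> 'M[C]_(d0 + d)).
Context (Hg : forall p, Omega p -> forall j k,
  g p j k = - 'd (slope k) (p, conjv p) (delta_mx 0 j, 0)).
Context (F : C -> V) (G : C -> 'rV[C]_n).
Context (dF : \forall t \near (0 : C), differentiable F t).
Context (dG : \forall t \near (0 : C), differentiable G t).
Context (OF : \forall t \near (0 : C), Omega (F t)).
Context (FG : \forall t \near (0 : C),
  ('d F t 1 *m g (F t) *m (conjv ('d F t 1))^T) 0 0 = dot ('d G t 1) (conjv ('d G t 1))).

(** Conjugation inside and outside makes this curve holomorphic; at s = conj t it takes the value
    conj (F t), where the metric can be read off. *)
Definition conj_curve (s : C) : V := conjv (F (s^*)).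
Definition polar_curve (p : C * C) : C := A (F p.1, conj_curve p.2).

Lemma conj_curve_diff s : differentiable F (s^*) ->
  differentiable conj_curve s /\ 'd conj_curve s 1 = conjv ('d F (s^*) 1).
Proof.
move=> dFs; pose h (k : 'I_(d0 + d)) (s : C) := (F (s^*) 0 k)^*.
have H k : differentiable (h k) s /\ 'd (h k) s 1 = ('d F (s^*) 1 0 k)^*.
  have [d1 e1] := diff_coord k dFs; have [d2 e2] := diff_conj d1.
  by split; [exact: d2|rewrite -e1; exact: e2].
have E : conj_curve = (fun s => \row_k h k s).
  by apply/funext => s'; apply/rowP => k; rewrite !mxE.
have d1 := @differentiable_row C C _ h s (fun k => (H k).1).
have e1 : 'd (fun s => \row_k h k s) s 1 = conjv ('d F (s^*) 1).
  apply: (etrans (@diff_row C C _ h s 1 (fun k => (H k).1))).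
  by apply/rowP => k; rewrite !mxE; exact: (H k).2.
by rewrite E; split; [exact: d1|exact: e1].
Qed.

Lemma near_conj_curve : \forall s \near (0 : C), differentiable conj_curve s.
Proof.
have H := @near_conj R _ 0 dF; rewrite conjC0 in H.
near=> s; have dFs : differentiable F (s^*) by near: s.
by have [] := conj_curve_diff dFs.
Unshelve. all: by end_near. Qed.

Lemma conj_curve0 : conj_curve 0 = conjv (F 0).
Proof. by rewrite /conj_curve conjC0. Qed.

Lemma curve_cts : (fun p : C * C => (F p.1, conj_curve p.2)) @ (0 : C * C) --> (F 0, conj_curve 0).
Proof.
have c1 : (fun p : C * C => F p.1) @ (0 : C * C) --> F 0.
  exact: (cvg_comp _ _ (@cvg_fst C C (nbhs 0) (nbhs 0) _)
    (differentiable_continuous (nbhs_singleton dF))).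
have c2 : (fun p : C * C => conj_curve p.2) @ (0 : C * C) --> conj_curve 0.
  exact: (cvg_comp _ _ (@cvg_snd C C (nbhs 0) (nbhs 0) _)
    (differentiable_continuous (nbhs_singleton near_conj_curve))).
exact: cvg_pair c1 c2.
Qed.

Lemma curve_near : exists2 r : R, 0 < r & forall t s : C, vn t < r -> vn s < r ->
  [/\ differentiable F t, differentiable conj_curve s & differentiable A (F t, conj_curve s)].
Proof.
have dA : \forall Q \near (F 0, conj_curve 0), differentiable A Q.
  by rewrite conj_curve0; exact: (near_polar_diff Dopen pol (nbhs_singleton OF).1).
have /(@near_prod R C C 0 0)[r1 r10 H1] := @near_comp R _ (fun p : C * C => (F p.1, conj_curve p.2))
  (fun Q => differentiable A Q) curve_cts dA.
have /(@near_vn R C 0)[r2 r20 H2] := dF.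
have /(@near_vn R C 0)[r3 r30 H3] := near_conj_curve.
exists (Num.min r1 (Num.min r2 r3)) => [|t s]; first by rewrite !lt_min r10 r20 r30.
rewrite !lt_min -[t]subr0 -[s]subr0 => /and3P[t1 t2 t3] /and3P[s1 s2 s3]; rewrite !subr0; split.
- by rewrite -[t]subr0; apply: H2; rewrite subr0.
- by rewrite -[s]subr0; apply: H3; rewrite subr0.
- exact: (H1 t s).
Qed.

Lemma polar_curve_diff t s : differentiable F t -> differentiable conj_curve s ->
  differentiable A (F t, conj_curve s) ->
  differentiable polar_curve (t, s) /\
  'd polar_curve (t, s) (0, 1) = 'd A (F t, conj_curve s) (0, 'd conj_curve s 1).
Proof.
move=> dFt dcs dAts; have [d1 e1] := diff_curve dFt dcs dAts.
split; first exact: d1.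
apply: (etrans (e1 0 1)).
exact: (congr1 (fun u => 'd A (F t, conj_curve s) (u, 'd conj_curve s 1)) (linear0 _)).
Qed.

Lemma near_polar_curve : \forall p \near (0 : C * C), differentiable polar_curve p.
Proof.
have [r r0 H] := curve_near.
apply: (proj2 (@near_prod R C C 0 0 (fun p : C * C => differentiable polar_curve p))).
exists r; [exact: r0|move=> t s].
rewrite !subr0 => tr sr; have [h1 h2 h3] := H t s tr sr.
by have [] := polar_curve_diff h1 h2 h3.
Qed.

Lemma polar_curve_neq0 : polar_curve 0 != 0.
Proof. by rewrite /polar_curve conj_curve0; exact: (polar_neq0 pol (nbhs_singleton OF)). Qed.

Lemma polar_curve_slope t s : differentiable F t -> differentiable conj_curve s ->
  differentiable A (F t, conj_curve s) ->
  'd polar_curve (t, s) (0, 1) / polar_curve (t, s) =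
    \sum_k ('d conj_curve s 1) 0 k * slope k (F t, conj_curve s).
Proof.
move=> h1 h2 h3; have [_ e1] := polar_curve_diff h1 h2 h3.
have e2 := @diff_basis2 C V _ A (F t, conj_curve s) ('d conj_curve s 1).
apply: (etrans (congr1 (fun u => u / polar_curve (t, s)) (etrans e1 e2))).
by rewrite mulr_suml; apply: eq_bigr => k _; rewrite -mulrA.
Qed.

(** With s fixed at conj t, the log derivative in s is a combination of the slopes along F.
    Differentiating it in t at the point (F t, conj (F t)) produces the metric entries, hence minus
    the squared length of F'(t), which equals that of G'(t). *)
Lemma polar_curve_diag : \forall t \near (0 : C),
  'd (fun p => 'd polar_curve p (0, 1) / polar_curve p) (t, t^*) (1, 0) =
    - dot ('d G t 1) (conjv ('d G t 1)).
Proof.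
pose b (p : C * C) : C := 'd polar_curve p (0, 1) / polar_curve p.
have /(@near_prod R C C 0 0)[r1 r10 db] := disc_b_diff near_polar_curve polar_curve_neq0.
have [r2 r20 good] := curve_near.
have near1 : \forall t \near (0 : C), vn (t - 0) < Num.min r1 r2.
  by apply: vn_ball_open; rewrite subrr vn0 lt_min r10 r20.
near=> t; pose s : C := t^*.
have tr : vn (t - 0) < Num.min r1 r2 by near: t.
have [t1 t2] : vn t < r1 /\ vn t < r2 by move: tr; rewrite subr0 lt_min => /andP[].
have sE : vn s = vn t by rewrite /vn /s norm_conjC.
have s1 : vn s < r1 by rewrite sE.
have s2 : vn s < r2 by rewrite sE.
have Ot : Omega (F t) by near: t.
have [dFt dcs dAts] := good t s t2 s2.
have csE : conj_curve s = conjv (F t) by rewrite /conj_curve /s conjCK.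
have dcsE : 'd conj_curve s 1 = conjv ('d F t 1).
  have dFss : differentiable F (s^*) := eq_ind_r (fun u : C => differentiable F u) dFt (conjCK t).
  apply: (etrans (conj_curve_diff dFss).2).
  exact: (congr1 (fun u : C => conjv ('d F u 1)) (conjCK t)).
have dbts : differentiable b (t, s) by apply: db; rewrite subr0.
have [d1 e1] := hol_partial1 dbts.
apply: (etrans (esym e1)).
pose c k : C := ('d conj_curve s 1) 0 k.
pose B t' : C := \sum_k c k * slope k (F t', conj_curve s).
(* The identity is needed on a whole neighbourhood of t with s frozen, since it is to be
   differentiated in t. *)
have BE : \forall t' \near t, b (t', s) = B t'.
  have t2' : vn (t - 0) < r2 by rewrite subr0.
  have := vn_ball_open t2'; apply: filterS => t'; rewrite subr0 => t'2.
  by have [h1 h2 h3] := good t' s t'2 s2; exact: (@polar_curve_slope t' s h1 h2 h3).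
have dsl k : differentiable (slope k) (F t, conj_curve s).
  by rewrite csE; exact: (log_slope_diff Dopen pol k Ot).
have [d2 e2] := @diff_lincomb C _ c (fun k t' => slope k (F t', conj_curve s)) _ t
  (fun k => @diff_first C V V (slope k) F (conj_curve s) t dFt (dsl k)).
apply: (etrans (near_diff_eq d1 d2 BE 1)); apply: (etrans e2).
have FGt : ('d F t 1 *m g (F t) *m (conjv ('d F t 1))^T) 0 0 = dot ('d G t 1) (conjv ('d G t 1)).
  by near: t.
rewrite -FGt mxE -sumrN; apply: eq_bigr => k _.
have ck : c k = (conjv ('d F t 1)) 0 k := congr1 (fun u : V => u 0 k) dcsE.
have e3 := @diff_basis1 C V _ (slope k) (F t, conj_curve s) ('d F t 1).
have e4 j : 'd (slope k) (F t, conj_curve s) (delta_mx 0 j, 0) = - g (F t) j k.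
  have e5 := congr1 (fun q : V => 'd (slope k) (F t, q) (delta_mx 0 j, 0)) csE.
  exact: (etrans e5 (esym (etrans (congr1 -%R (Hg Ot j k)) (opprK _)))).
have e6 : ('d F t 1 *m g (F t)) 0 k = \sum_j 'd F t 1 0 j * g (F t) j k by rewrite mxE.
have e7 : (conjv ('d F t 1))^T k 0 = (conjv ('d F t 1)) 0 k by rewrite mxE.
exact: (etrans (congr2 *%R ck e3) (etrans (opp_pairing _ _ e4)
  (congr1 -%R (esym (congr2 *%R e6 e7))))).
Unshelve. all: by end_near. Qed.

End CurveInHartogsDomain.

Section NoFlatCurve.
Context (R : realType) (d0 d n : nat) (D : set 'rV[R[i]]_d).
Context (phi : 'rV[R[i]]_d -> R) (Phi : 'rV[R[i]]_(d + d) -> R[i]).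
Local Notation C := R[i].
Local Notation V := 'rV[C]_(d0 + d).
Local Notation Omega := (hartogs_domain (d0 := d0) D phi).
Local Notation A := (@polar R d0 d Phi).
Local Notation slope := (@log_slope R d0 d Phi).
Context (Dopen : open D) (pol : polarization_on D phi Phi).
Context (nash : nash_on (conj_prod D) Phi).
Context (g : V -> 'M[C]_(d0 + d)).
Context (Hg : forall p, Omega p -> forall j k,
  g p j k = - 'd (slope k) (p, conjv p) (delta_mx 0 j, 0)).
Context (F : C -> V) (G : C -> 'rV[C]_n).
Context (dF : \forall t \near (0 : C), differentiable F t).
Context (dG : \forall t \near (0 : C), differentiable G t).
Context (OF : \forall t \near (0 : C), Omega (F t)).
Context (FG : \forall t \near (0 : C),
  ('d F t 1 *m g (F t) *m (conjv ('d F t 1))^T) 0 0 = dot ('d G t 1) (conjv ('d G t 1))).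
Context (G0 : \forall t \near (0 : C), 'd G t 1 != 0).
Local Notation Fb := (conj_curve F).
Local Notation a := (polar_curve Phi F).

(** Along the curve, Phi (X t s) = E rho + kap: [kap] is the polarized |xi|^2 and [rho] undoes the
    normalization of [E]. The coordinates of [X], [rho] and [kap] are all finite sums of products of
    a function of t and a function of s. *)
Let X (t s : C) : 'rV[C]_(d + d) := row_mx (rsubmx (F t)) (rsubmx (Fb s)).
Let kap (t s : C) : C := \sum_(j < d0) lsubmx (F t) 0 j * lsubmx (Fb s) 0 j.
Let rho (t s : C) : C := a (t, 0) * a (0, s) / a (0, 0).
Let E (t s : C) : C := a (t, s) * a (0, 0) / (a (t, 0) * a (0, s)).

Let da : \forall p \near (0 : C * C), differentiable a p := near_polar_curve Dopen pol dF OF.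
Let a0 : a 0 != 0 := polar_curve_neq0 pol OF.

Lemma coord_hol N (H : C -> 'rV[C]_N) l : (\forall t \near (0 : C), differentiable H t) ->
  hol0 (fun t => H t 0 l).
Proof. by apply: filterS => t /(diff_coord l)[]. Qed.

Lemma curve_axes_neq0 : exists2 r : R, 0 < r & forall t s : C, vn t < r -> vn s < r ->
  [/\ a (t, s) != 0, a (t, 0) != 0, a (0, s) != 0 & a (0, 0) != 0].
Proof.
have /(@near_prod R C C 0 0)[r r0 H] := disc_near_neq0 da a0.
have z : vn (0 - 0 : C) < r by rewrite subr0 vn0.
by exists r => // t s tr sr; split; apply: H; rewrite ?subr0 ?vn0.
Qed.

Lemma curve_base : \forall p \near (0 : C * C),
  D (rsubmx (F p.1)) /\ D (conjv (rsubmx (Fb p.2))).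
Proof.
have /(@near_vn R C 0)[r r0 H] := OF.
apply/(@near_prod R C C 0 0 (fun p => D (rsubmx (F p.1)) /\ D (conjv (rsubmx (Fb p.2))))).
exists r => // t s tr sr; split; first exact: (H t tr).1.
have -> : conjv (rsubmx (Fb s)) = rsubmx (F (s^*)).
  by apply/rowP => l; rewrite !mxE conjCK.
have sr' : vn ((s^* : C) - 0) < r by move: sr; rewrite !subr0 /vn norm_conjC.
exact: (H (s^*) sr').1.
Qed.

Lemma curve_Phi_cts : \forall p \near (0 : C * C), {for X p.1 p.2, continuous Phi}.
Proof.
have H := curve_base; near=> p.
have [D1 D2] : D (rsubmx (F p.1)) /\ D (conjv (rsubmx (Fb p.2))) by near: p.
apply: differentiable_continuous; apply: pol.1.
by split; rewrite ?row_mxKl ?row_mxKr.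
Unshelve. all: by end_near. Qed.

Lemma curve_X_cts : (fun p : C * C => X p.1 p.2) @ (0 : C * C) --> X 0 0.
Proof.
have c := differentiable_continuous (@join_differentiable C d0 d (F 0, Fb 0)).
exact: (cvg_comp _ _ (curve_cts dF) c).
Qed.

Lemma tensor_X i : tensor_poly (fun t s e y : C => X t s 0 i).
Proof.
case: (split_ordP i) => l ->.
  apply: (@tensor_ext C (fun t s e y => F t 0 (rshift d0 l))).
    by move=> t s e y; rewrite row_mxEl mxE.
  exact: (tensor_t (coord_hol _ dF)).
apply: (@tensor_ext C (fun t s e y => Fb s 0 (rshift d0 l))).
  by move=> t s e y; rewrite row_mxEr; exact/esym/mxE.
exact: (tensor_s (coord_hol _ (near_conj_curve dF))).
Qed.

Lemma tensor_kap : tensor_poly (fun t s e y : C => kap t s).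
Proof.
apply: (@tensor_ext C (fun t s e y =>
    \sum_(j < d0) F t 0 (lshift d j) * Fb s 0 (lshift d j))).
  by move=> t s e y; apply: eq_bigr => j _; congr (_ * _); exact/esym/mxE.
apply: tensor_sum => j; apply: tensorM.
  exact: (tensor_t (coord_hol _ dF)).
exact: (tensor_s (coord_hol _ (near_conj_curve dF))).
Qed.

Lemma axis_hol : hol0 (fun t : C => a (t, 0)) /\ hol0 (fun s : C => a (0, s)).
Proof.
have /(@near_prod R C C 0 0)[r r0 H] := da.
have z : vn (0 - 0 : C) < r by rewrite subr0 vn0.
split; apply/hol0P.
  apply/(@near_vn R C 0 (fun t => differentiable (fun t : C => a (t, 0)) t)).
  exists r; [exact: r0|move=> t tr; exact (hol_partial1 (H t 0 tr z)).1].
apply/(@near_vn R C 0 (fun s => differentiable (fun s : C => a (0, s)) s)).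
exists r; [exact: r0|move=> s sr; exact (hol_partial2 (H 0 s z sr)).1].
Qed.

Lemma tensor_rho : tensor_poly (fun t s e y : C => rho t s).
Proof.
have [h1 h2] := axis_hol.
exact: (tensorM (tensorM (tensor_t h1) (tensor_s h2)) (tensor_cst (a (0, 0))^-1)).
Qed.

Lemma near_rho_neq0 : \forall p \near (0 : C * C), rho p.1 p.2 != 0.
Proof.
have [r r0 H] := curve_axes_neq0.
apply/(@near_prod R C C 0 0 (fun p => rho p.1 p.2 != 0)); exists r => // t s.
rewrite !subr0 => tr sr; have [h1 h2 h3 h4] := H t s tr sr.
by rewrite /rho /= !mulf_neq0 ?invr_eq0.
Qed.

Lemma near_Phi_curve : \forall p \near (0 : C * C),
  Phi (X p.1 p.2) = E p.1 p.2 * rho p.1 p.2 + kap p.1 p.2.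
Proof.
have [r r0 H] := curve_axes_neq0.
apply/(@near_prod R C C 0 0 (fun p => Phi (X p.1 p.2) = E p.1 p.2 * rho p.1 p.2 + kap p.1 p.2)).
exists r => // t s; rewrite !subr0 => tr sr; have [h1 h2 h3 h4] := H t s tr sr.
have -> : E (t, s).1 (t, s).2 * rho (t, s).1 (t, s).2 = a (t, s).
  rewrite /E /rho /=; move: (a (t, s)) (a (t, 0)) (a (0, s)) (a (0, 0)) h2 h3 h4 => x y z w y0 z0 w0.
  by field; rewrite y0 z0 w0.
by rewrite /polar_curve /polar /= subrK.
Qed.

Lemma velocity_row t : differentiable G t -> \row_l 'd (fun t => G t 0 l) t 1 = 'd G t 1.
Proof. by move=> dGt; apply/rowP => l; rewrite mxE (diff_coord l dGt).2. Qed.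

Theorem no_flat_curve : False.
Proof.
have X00 : conj_prod D (X 0 0).
  have [D1 D2] := nbhs_singleton curve_base.
  by split; rewrite ?row_mxKl ?row_mxKr.
have [P [P0 HP]] := nash.2 _ X00.
have [D' [k [f [h [Hf Hh rel top]]]]] := @algebraic_relation R (d + d) Phi X P E rho kap P0 HP
  curve_Phi_cts curve_X_cts tensor_X tensor_rho tensor_kap near_rho_neq0 near_Phi_curve.
pose Gl (l : 'I_n) (t : C) : C := G t 0 l.
have dGl l : hol0 (Gl l) := coord_hol l dG.
have Gl0 : \forall t \near (0 : C), (\row_l 'd (Gl l) t 1 : 'rV[C]_n) != 0.
  near=> t; have dGt : differentiable G t by near: t.
  have Gt0 : 'd G t 1 != 0 by near: t.
  exact: (eq_ind_r (fun u : 'rV[C]_n => u != 0) Gt0 (velocity_row dGt)).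
have dg : \forall t \near (0 : C), 'd (fun p => 'd a p (0, 1) / a p) (t, t^*) (1, 0) =
    - dot (\row_l 'd (Gl l) t 1) (conjv (\row_l 'd (Gl l) t 1)).
  have H := polar_curve_diag Dopen pol Hg dF OF FG.
  near=> t; have dGt : differentiable G t by near: t.
  have Ht : 'd (fun p => 'd a p (0, 1) / a p) (t, t^*) (1, 0) =
      - dot ('d G t 1) (conjv ('d G t 1)) by near: t.
  exact: (etrans Ht (congr1 (fun u : 'rV[C]_n => - dot u (conjv u)) (esym (velocity_row dGt)))).
exact (@disc_transcendental R n a Gl da a0 dGl dg Gl0 D' k f h Hf Hh rel top).
Unshelve. all: by end_near. Qed.

End NoFlatCurve.

Section ChartCurves.
Context (R : realType) (m N : nat) (S : complex_manifold R m).
Local Notation C := R[i].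
Context (f : S -> 'rV[C]_N) (i : mfd_index S) (z0 : 'rV[C]_m) (j0 : 'I_m).
Local Notation W := (chart i @` chart_dom i).

Lemma near_chart_line (v : 'rV[C]_m) : W z0 -> \forall t \near (0 : C), W (z0 + t *: v).
Proof.
move=> Wz0; have Wn : \forall z \near z0, W z.
  exact: (open_nbhs_nbhs (conj (@chart_img_open R m S i) Wz0)).
exact: (line_cvg0 v Wn).
Qed.

Lemma chart_line_diff (v z : 'rV[C]_m) (t : C) : differentiable (f \o chart_inv i) (z + t *: v) ->
  differentiable (fun t : C => f (chart_inv i (z + t *: v))) t /\
  'd (fun t : C => f (chart_inv i (z + t *: v))) t 1 =
    v *m 'J (f \o chart_inv i) (z + t *: v).
Proof.
move=> df; have [d1 e1] := @diff_along_vec C _ _ (f \o chart_inv i) z v t df.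
split; first exact: d1.
by apply: (etrans e1); rewrite /jacobian mul_rV_lin1.
Qed.

End ChartCurves.

(** Turns equality of the pulled back matrices into equality of the lengths of the two image
    velocities. *)
Lemma pullback_form (R : realType) (m N : nat) (v : 'rV[R[i]]_m) (J : 'M[R[i]]_(m, N))
    (h : 'M[R[i]]_N) :
  (v *m J) *m h *m (conjv (v *m J))^T = v *m (J *m h *m (map_mx Num.conj J)^T) *m (conjv v)^T.
Proof. by rewrite /conjv map_mxM trmx_mul !mulmxA. Qed.

Theorem theorem3p3 (R : realType) (d0 d : nat) (D : set 'rV[R[i]]_d)
    (phi : 'rV[R[i]]_d -> R) (Phi : 'rV[R[i]]_(d + d) -> R[i])
    (g : 'rV[R[i]]_(d0 + d) -> 'M[R[i]]_(d0 + d)) :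
  domain D ->
  real_analytic_on D phi ->
  (forall z, D z -> 0 < phi z) ->
  (1 <= d0)%N ->
  kahler_metric (hartogs_domain (d0 := d0) D phi) g ->
  (forall p, hartogs_domain D phi p ->
     forall v w, kahler_form g p v w = omega_hartogs phi p v w) ->
  polarization_on D phi Phi ->
  nash_on (conj_prod D) Phi ->
  forall n : nat, (1 <= n)%N ->
    ~ relatives (hartogs_domain D phi) g
                [set: 'rV[R[i]]_n] (@flat_metric R n).
Proof.
move=> [Dopen _ _] _ _ _ _ Hform pol nash n _.
move=> [m [S [f1 [f2 [[m0 [x _]] [Of1 _] im1 im2 pb]]]]].
have Hg p Op := metric_entry Dopen pol Op (Hform p Op).
have [i xi] := chart_cover x.
(* Positive dimension provides a coordinate direction v; both immersions are restricted to the line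
   through the chart image of x in this direction. *)
pose z0 := chart i x; pose v : 'rV[R[i]]_m := delta_mx 0 (Ordinal m0).
have Wz0 : (chart i @` chart_dom i) z0 by exists x.
have nW := near_chart_line v Wz0.
pose F (t : R[i]) := f1 (chart_inv i (z0 + t *: v)).
pose G (t : R[i]) := f2 (chart_inv i (z0 + t *: v)).
have v0 : v != 0.
  apply/eqP => /rowP /(_ (Ordinal m0)) /eqP.
  by rewrite !mxE !eqxx oner_eq0.
have HF t : (chart i @` chart_dom i) (z0 + t *: v) ->
    differentiable F t /\ 'd F t 1 = v *m 'J (f1 \o chart_inv i) (z0 + t *: v).
  by move=> Wt; apply: chart_line_diff; exact: (im1 i _ Wt).1.
have HG t : (chart i @` chart_dom i) (z0 + t *: v) ->
    differentiable G t /\ 'd G t 1 = v *m 'J (f2 \o chart_inv i) (z0 + t *: v).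
  by move=> Wt; apply: chart_line_diff; exact: (im2 i _ Wt).1.
apply: (@no_flat_curve R d0 d n D phi Phi Dopen pol nash g Hg F G).
- by apply: filterS nW => t Wt; exact: (HF t Wt).1.
- by apply: filterS nW => t Wt; exact: (HG t Wt).1.
- by apply: filterE => t; exact: Of1.
- apply: filterS nW => t Wt; rewrite (HF t Wt).2 (HG t Wt).2 pullback_form.
  have := pb i _ Wt; rewrite /pullback => ->.
  by rewrite /dot -pullback_form mulmx1.
(* The immersion into flat space has injective differential, so the velocity of [G] never vanishes;
   this is what makes the frequencies vary. *)
- apply: filterS nW => t Wt; rewrite (HG t Wt).2 mulmx_free_eq0 //.
  exact: (im2 i _ Wt).2.
Qed.
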